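(* Let $p$ be a prime and let $G$ be an infinite, finitely presented, residually $p$-finite group. If $\Lambda \subseteq G$ is a subgroup such that $G$ is normally generated by $\Lambda$, then $$\beta_1^{(2)}(G) \leq \beta_1^{(2)}(\Lambda).$$ In particular, if $G$ is normally generated by elements $g_1,\dots,g_k \in G$ of order $n_1,\dots,n_k \in \{1,2,\dots\}\cup\{\infty\}$ respectively, then $$\beta_1^{(2)}(G) \leq k-1-\sum_{i=1}^k \frac{1}{n_i}.$$
   Context: A group $G$ is residually $p$-finite if for every non-trivial $g \in G$ there is a normal subgroup $H \subseteq G$ whose index is a (finite) power of $p$ with $g \notin H$. A group $G$ is normally generated by a subgroup (or by a set of elements) if the smallest normal subgroup of $G$ containing it is $G$ itself. The convention $1/\infty = 0$ is used. First $\ell^2$-Betti number. For a discrete group $\Gamma$, let $\ell^2\Gamma$ be the Hilbert space with orthonormal basis $\{\delta_g : g \in \Gamma\}$, with left- and right-regular representations $\lambda(g)\delta_h = \delta_{gh}$ and $\rho(g)\delta_h = \delta_{hg^{-1}}$. The group von Neumann algebra is $L\Gamma = \{T \in B(\ell^2\Gamma) : \rho(g)T = T\rho(g)\ \forall g \in \Gamma\}$; it contains $\lambda(\mathbb{C}\Gamma)$, and it carries the faithful trace $\tau(a) = \langle a\delta_e,\delta_e\rangle$. Let $\dim_{L\Gamma}$, with values in $[0,\infty]$, be Lück's dimension function on (right) $L\Gamma$-modules: for a finitely generated projective module $P \cong q\,(L\Gamma)^n$ with $q=q^*=q^2 \in M_n(L\Gamma)$ one puts $\dim_{L\Gamma}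 P = \sum_{i=1}^n \tau(q_{ii})$, and for an arbitrary module $M$, $\dim_{L\Gamma} M$ is the supremum of $\dim_{L\Gamma} P$ over finitely generated projective submodules $P \subseteq M$. Then $$\beta_1^{(2)}(\Gamma) := \dim_{L\Gamma} H^1(\Gamma, L\Gamma),$$ where $H^1(\Gamma,L\Gamma)$ is algebraic group cohomology with coefficients in the left $\mathbb{Z}\Gamma$-module $L\Gamma$ (acting by left multiplication via $\lambda$), with the right $L\Gamma$-module structure induced by right multiplication on $L\Gamma$. *)

(* Defs.v *)
From HB Require Import structures.
From mathcomp Require Import all_boot all_order all_algebra.
From mathcomp Require Import generic_quotient ring_quotient.
From mathcomp Require Import complex ring lra.
From mathcomp Require Import boolp classical_sets functions cardinality.
From mathcomp Require Import reals ereal numfun esum.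

Set Implicit Arguments.
Unset Strict Implicit.
Unset Printing Implicit Defensive.
Import Order.TTheory GRing.Theory Num.Theory.
Import Normc.
Local Open Scope classical_set_scope.
Local Open Scope ring_scope.

Section SubgroupType.
Variables (G : groupType) (S : groupClosed G).

Record subgroup := Subgroup { subgroup_val :> G; _ : subgroup_val \in S }.
HB.instance Definition _ := [isSub for subgroup_val].
HB.instance Definition _ := [Choice of subgroup by <:].

Lemma groupClosed_closed : group_closed S.
Proof.
by split=> [|x y xS yS]; [exact: gpred1 | exact: gpredF].
Qed.

HB.instance Definition _ :=
  SubChoice_isSubGroup.Build G (fun x => x \in S) subgroup groupClosed_closed.

End SubgroupType.

Section GroupNotions.
Variable G : groupType.
Local Open Scope group_scope.

Definition normal_subgroup (N : set G) : Prop :=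
  [/\ N 1, forall x y, N x -> N y -> N (x * y), forall x, N x -> N x^-1
    & forall x y, N x -> N (x ^ y)].

Definition normally_generated (S : set G) : Prop :=
  smallest normal_subgroup S = [set: G].

Definition left_cosets (H : set G) : set (set G) :=
  [set [set x * h | h in H] | x in [set: G]].

Definition residually_finite_p (p : nat) : Prop :=
  forall g : G, g != 1 ->
    exists H : set G, [/\ normal_subgroup H,
      exists k : nat, (left_cosets H #= `I_(p ^ k)%N)%card & ~ H g].

(* [None] stands for infinite order. *)
Definition has_order (g : G) (n : option nat) : Prop :=
  if n is Some m then
    [/\ (0 < m)%N, g ^+ m = 1
      & forall j : nat, (0 < j)%N -> g ^+ j = 1 -> (m <= j)%N]
  else forall j : nat, (0 < j)%N -> g ^+ j <> 1.

End GroupNotions.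

Definition inv_order (R : realType) (n : option nat) : R :=
  if n is Some m then m%:R^-1 else 0.

(* A word is a list of letters x_i (encoded [(i, true)]) and x_i^-1 (encoded
   [(i, false)]); the quotient of the words by [pres_eq rels] is the group
   presented by the generators x_i and the relators [rels]. *)
Definition word (n : nat) := seq ('I_n * bool).

Inductive pres_eq (n : nat) (rels : seq (word n)) : word n -> word n -> Prop :=
| pres_refl u : pres_eq rels u u
| pres_sym u v : pres_eq rels u v -> pres_eq rels v u
| pres_trans u v w : pres_eq rels u v -> pres_eq rels v w -> pres_eq rels u w
| pres_cat u u' v v' :
    pres_eq rels u u' -> pres_eq rels v v' -> pres_eq rels (u ++ v) (u' ++ v')
| pres_cancel i b : pres_eq rels [:: (i, b); (i, ~~ b)] [::]
| pres_rel r : r \in rels -> pres_eq rels r [::].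

Definition word_eval (G : groupType) n (x : 'I_n -> G) (w : word n) : G :=
  (\big[*%g/1]_(l <- w) (if l.2 then x l.1 else (x l.1)^-1))%g.

Definition finitely_presented (G : groupType) : Prop :=
  exists (n : nat) (rels : seq (word n)) (x : 'I_n -> G),
    (forall g : G, exists w : word n, word_eval x w = g) /\
    (forall u v : word n, word_eval x u = word_eval x v <-> pres_eq rels u v).

Section QuotientModule.
Variables (A : pzRingType) (M : lmodType A) (S : {pred M})
  (S_closed : submod_closed S).
Local Open Scope quotient_scope.

Definition submod_zmodClosed : zmodClosed M :=
  HB.pack S (GRing.isZmodClosed.Build M S (GRing.submod_closedB S_closed)).
Local Notation N := submod_zmodClosed.
Local Notation Q := (Quotient.quot N).

Definition quot_scale (a : A) (x : Q) : Q := \pi_Q (a *: repr x).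

Lemma quot_scale_pi a (m : M) : quot_scale a (\pi_Q m) = \pi_Q (a *: m).
Proof.
apply/eqP; rewrite -Quotient.idealrBE -scalerBr.
have SZ : GRing.scaler_closed S := GRing.submod_closed_semi S_closed.
have mN : repr (\pi_Q m) - m \in N by rewrite Quotient.idealrBE reprK.
exact: SZ mN.
Qed.

Lemma quot_scaleA a b x : quot_scale a (quot_scale b x) = quot_scale (a * b) x.
Proof.
by rewrite -[x]reprK (quot_scale_pi b) (quot_scale_pi a) quot_scale_pi scalerA.
Qed.

Lemma quot_scale1 : left_id 1 quot_scale.
Proof. by move=> x; rewrite -[x]reprK quot_scale_pi scale1r. Qed.

Lemma quot_scaleDr : right_distributive quot_scale +%R.
Proof.
move=> a x y; rewrite -[x]reprK -[y]reprK !quot_scale_pi.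
by rewrite -!(raddfD (\pi_Q)) quot_scale_pi scalerDr.
Qed.

Lemma quot_scaleDl x : {morph quot_scale^~ x : a b / a + b}.
Proof.
move=> a b; rewrite -[x]reprK !quot_scale_pi.
by rewrite -(raddfD (\pi_Q)) scalerDl.
Qed.

Definition lmodquot : Type := Q.
HB.instance Definition _ := GRing.Zmodule.on lmodquot.
HB.instance Definition _ := GRing.Zmodule_isLmodule.Build A lmodquot
  quot_scaleA quot_scale1 quot_scaleDr quot_scaleDl.

End QuotientModule.

Section SquareSummable.
Variables (R : realType) (G : groupType).
Implicit Types f : G -> R[i].

Definition sqr_norm_fun f (g : G) : \bar R := ((normc (f g)) ^+ 2)%:E.

Definition sqr_summable : pred (G -> R[i]) :=
  fun f => `[< summable [set: G] (sqr_norm_fun f) >].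

Lemma sqr_norm_fun_ge0 f g : (0 <= sqr_norm_fun f g)%E.
Proof. by rewrite lee_fin sqr_ge0. Qed.

Lemma sqr_summableE f :
  (f \in sqr_summable) = (esum [set: G] (sqr_norm_fun f) < +oo)%E.
Proof.
rewrite unfold_in /sqr_summable /summable.
under eq_esum => g _ do rewrite gee0_abs ?sqr_norm_fun_ge0//.
by apply/asboolP/idP.
Qed.

Lemma ge0_esumZl_le (T : choiceType) (a : T -> \bar R) (c : R) :
  0 <= c -> (forall t, 0 <= a t)%E ->
  (\esum_(t in [set: T]) (c%:E * a t) <= c%:E * \esum_(t in [set: T]) a t)%E.
Proof.
move=> c0 a0; rewrite /esum ge_ereal_sup => // _ [X [finX _]] <-.
rewrite -ge0_mule_fsumr// lee_wpmul2l ?lee_fin//.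
by apply: ereal_sup_ubound; exists X.
Qed.

Lemma sqr_normcD (x y : R[i]) :
  normc (x + y) ^+ 2 <= 2 * normc x ^+ 2 + 2 * normc y ^+ 2.
Proof.
have nx : 0 <= normc x by case: x => ? ?; exact: sqrtr_ge0.
have ny : 0 <= normc y by case: y => ? ?; exact: sqrtr_ge0.
have nxy : 0 <= normc (x + y) by case: (x + y) => ? ?; exact: sqrtr_ge0.
have := sqr_ge0 (normc x - normc y).
have : normc (x + y) ^+ 2 <= (normc x + normc y) ^+ 2.
  by rewrite lerXn2r ?nnegrE ?addr_ge0 ?le_normcD.
by nra.
Qed.

Lemma esum_sqr_normD f h :
  (esum [set: G] (sqr_norm_fun (f + h)%R) <=
   2%:E * esum [set: G] (sqr_norm_fun f) +
   2%:E * esum [set: G] (sqr_norm_fun h))%E.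
Proof.
apply: (@le_trans _ _ (\esum_(g in [set: G])
  (2%:E * sqr_norm_fun f g + 2%:E * sqr_norm_fun h g))%E).
  by apply: le_esum => g _; rewrite -!EFinM -EFinD lee_fin sqr_normcD.
rewrite esumD; first last.
- by move=> g _; rewrite mule_ge0 ?sqr_norm_fun_ge0// lee_fin.
- by move=> g _; rewrite mule_ge0 ?sqr_norm_fun_ge0// lee_fin.
by rewrite leeD// ge0_esumZl_le// => g; exact: sqr_norm_fun_ge0.
Qed.

Lemma esum_sqr_normZ (a : R[i]) f :
  (esum [set: G] (sqr_norm_fun (a *: f)%R) <=
   (normc a ^+ 2)%:E * esum [set: G] (sqr_norm_fun f))%E.
Proof.
apply: le_trans (ge0_esumZl_le _ _); rewrite ?sqr_ge0//; last first.
  exact: sqr_norm_fun_ge0.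
by apply: le_esum => g _; rewrite -EFinM lee_fin -exprMn -normcM.
Qed.

Lemma sqr_summable_closed : submod_closed sqr_summable.
Proof.
have fin f : f \in sqr_summable ->
    (esum [set: G] (sqr_norm_fun f) \is a fin_num)%E.
  rewrite sqr_summableE => lty; rewrite ge0_fin_numE// esum_ge0// => g _.
  exact: sqr_norm_fun_ge0.
split.
  rewrite sqr_summableE (_ : esum _ _ = 0%E) ?ltry// esum1// => g _.
  by rewrite /sqr_norm_fun normc0 expr0n.
move=> a f h /fin ff /fin hf; rewrite sqr_summableE.
apply: le_lt_trans (esum_sqr_normD _ _) _; rewrite lte_add_pinfty//.
  apply: le_lt_trans (lee_wpmul2l _ (esum_sqr_normZ _ _)) _.
    by rewrite lee_fin.
  by rewrite -(fineK ff) -!EFinM ltry.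
by rewrite -(fineK hf) -!EFinM ltry.
Qed.

HB.instance Definition _ :=
  GRing.isSubmodClosed.Build R[i] (G -> R[i]) sqr_summable sqr_summable_closed.

Record l2 := L2 { l2_fun :> G -> R[i]; _ : l2_fun \in sqr_summable }.
HB.instance Definition _ := [isSub for l2_fun].
HB.instance Definition _ := [Choice of l2 by <:].
HB.instance Definition _ := [SubChoice_isSubLmodule of l2 by <:].

End SquareSummable.

Section RegularRepresentations.
Variables (R : realType) (G : groupType).
Local Notation l2 := (l2 R G).
Implicit Types (xi eta : l2) (g h : G).

Lemma delta_proof g : (fun h => (h == g)%:R) \in @sqr_summable R G.
Proof.
rewrite sqr_summableE (_ : esum _ _ =
    \esum_(h in [set g]) ((normc ((h == g)%:R : R[i])) ^+ 2)%:E)%E.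
  by rewrite esum_set1 ?ltry// lee_fin sqr_ge0.
rewrite [RHS]esum_mkcond; apply: eq_esum => h _; rewrite /sqr_norm_fun.
have [->|hg] := eqVneq h g; first by rewrite mem_set.
by rewrite memNset ?normc0 ?expr0n//= => /eqP; exact/negP.
Qed.

Definition delta g : l2 := L2 (delta_proof g).

Lemma esum_sqr_norm_reindex (e : G -> G) (f : G -> R[i]) : bijective e ->
  (esum [set: G] (sqr_norm_fun (f \o e)) = esum [set: G] (sqr_norm_fun f))%E.
Proof.
move=> bije; rewrite [RHS](@reindex_esum _ _ _ [set: G] [set: G] e)//.
by split=> // [x y _ _|y _]; [exact: bij_inj|case: bije => e' K K'; exists (e' y)].
Qed.

Lemma lam_bij g : bijective (fun h => (g^-1 * h)%g).
Proof. by exists (fun h => (g * h)%g) => h; rewrite ?mulKg ?mulVKg. Qed.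

Lemma rho_bij g : bijective (fun h => (h * g)%g).
Proof. by exists (fun h => (h * g^-1)%g) => h; rewrite ?mulgK ?mulgVK. Qed.

Lemma lam_proof g xi : (fun h => xi (g^-1 * h)%g) \in @sqr_summable R G.
Proof.
rewrite sqr_summableE (@esum_sqr_norm_reindex _ xi (lam_bij g)).
by rewrite -sqr_summableE; exact: valP.
Qed.

Lemma rho_proof g xi : (fun h => xi (h * g)%g) \in @sqr_summable R G.
Proof.
rewrite sqr_summableE (@esum_sqr_norm_reindex _ xi (rho_bij g)).
by rewrite -sqr_summableE; exact: valP.
Qed.

Definition lam g xi : l2 := L2 (lam_proof g xi).
Definition rho g xi : l2 := L2 (rho_proof g xi).

Lemma lam_delta g h : lam g (delta h) = delta (g * h)%g.
Proof.
apply/val_inj/funext => k /=.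
by congr (nat_of_bool _)%:R; apply/eqP/eqP => [<-|->]; rewrite ?mulKg ?mulVKg.
Qed.

Lemma rho_delta g h : rho g (delta h) = delta (h * g^-1)%g.
Proof.
apply/val_inj/funext => k /=.
by congr (nat_of_bool _)%:R; apply/eqP/eqP => [<-|->]; rewrite ?mulgK ?mulgVK.
Qed.

Definition sqr_norm xi : R := fine (esum [set: G] (sqr_norm_fun xi)).

Definition l2norm xi : R := Num.sqrt (sqr_norm xi).

(* Sum of an absolutely summable real (resp. complex) family: [esum] is the
   supremum of the finite partial sums, hence the positive and negative parts. *)
Definition rsum (u : G -> R) : R :=
  fine (esum [set: G] (EFin \o u)^\+ - esum [set: G] (EFin \o u)^\-)%E.

Definition csum (u : G -> R[i]) : R[i] :=
  (rsum (fun g => complex.Re (u g)) +i* rsum (fun g => complex.Im (u g)))%C.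

Definition inner xi eta : R[i] := csum (fun g => xi g * (eta g)^*%C).

Lemma sqr_normE xi : (sqr_norm xi)%:E = esum [set: G] (sqr_norm_fun xi).
Proof.
rewrite /sqr_norm fineK// ge0_fin_numE -?sqr_summableE; first exact: valP.
by apply: esum_ge0 => g _; exact: sqr_norm_fun_ge0.
Qed.

Lemma sqr_norm_ge0 xi : 0 <= sqr_norm xi.
Proof.
rewrite -lee_fin sqr_normE; apply: esum_ge0 => g _; exact: sqr_norm_fun_ge0.
Qed.

Lemma sqr_normD xi eta :
  sqr_norm (xi + eta) <= 2 * sqr_norm xi + 2 * sqr_norm eta.
Proof. by rewrite -lee_fin EFinD !EFinM !sqr_normE esum_sqr_normD. Qed.

Lemma sqr_norm_lam g xi : sqr_norm (lam g xi) = sqr_norm xi.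
Proof.
by apply: EFin_inj; rewrite !sqr_normE (@esum_sqr_norm_reindex _ xi (lam_bij g)).
Qed.

End RegularRepresentations.

Section VonNeumannAlgebra.
Variables (R : realType) (G : groupType).
Local Notation l2 := (l2 R G).
Implicit Types (xi eta : l2) (g h : G) (T : l2 -> l2).

Definition bounded_op T : Prop :=
  exists M : R, forall xi, l2norm (T xi) <= M * l2norm xi.

Definition in_group_vN T : Prop :=
  [/\ linear T, bounded_op T & forall g xi, rho g (T xi) = T (rho g xi)].

Definition group_vN_pred : pred (l2 -> l2) := fun T => `[< in_group_vN T >].

Lemma bounded_opP T :
  bounded_op T <->
  exists2 K : R, 0 <= K & forall xi, sqr_norm (T xi) <= K * sqr_norm xi.
Proof.
split=> [[M TM]|[K K0 TK]].
  exists (M ^+ 2); first exact: sqr_ge0.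
  move=> xi; have := TM xi; rewrite /l2norm => TMxi.
  rewrite -(sqr_sqrtr (sqr_norm_ge0 (T xi))) -[sqr_norm xi in leRHS]sqr_sqrtr.
    by rewrite -exprMn lerXn2r ?nnegrE ?sqrtr_ge0// (le_trans _ TMxi)// sqrtr_ge0.
  exact: sqr_norm_ge0.
exists (Num.sqrt K) => xi.
by rewrite /l2norm -sqrtrM// ler_sqrt// mulr_ge0// sqr_norm_ge0.
Qed.

Lemma rhoD g xi eta : rho g (xi + eta) = rho g xi + rho g eta.
Proof. exact/val_inj. Qed.

Lemma rhoN g xi : rho g (- xi) = - rho g xi.
Proof. exact/val_inj. Qed.

Lemma rho0 g : rho g 0 = 0 :> l2.
Proof. exact/val_inj. Qed.

Lemma sqr_normN xi : sqr_norm (- xi) = sqr_norm xi.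
Proof.
rewrite /sqr_norm; congr fine; apply: eq_esum => g _.
by rewrite /sqr_norm_fun -(normcN (xi g)).
Qed.

Lemma sqr_norm0 : sqr_norm (0 : l2) = 0.
Proof.
rewrite /sqr_norm esum1// => g _.
by rewrite /sqr_norm_fun normc0 expr0n.
Qed.

Lemma group_vN_zmod_closed : zmod_closed group_vN_pred.
Proof.
split=> [|S T /asboolP[linS /bounded_opP[K K0 SK] rhoS]
             /asboolP[linT /bounded_opP[L L0 TL] rhoT]]; apply/asboolP; split.
- by move=> a x y; rewrite scaler0 addr0.
- exists 0 => xi; rewrite /l2norm mul0r.
  by rewrite [sqr_norm _]sqr_norm0 sqrtr0.
- by move=> g xi; rewrite [LHS]rho0.
- move=> a x y; rewrite !fctE linS linT scalerBr.
  by rewrite opprD addrACA.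
- apply/bounded_opP; exists (2 * K + 2 * L).
    by rewrite addr_ge0// mulr_ge0.
  move=> xi; apply: le_trans (sqr_normD _ _) _.
  rewrite [leRHS]mulrDl -!mulrA.
  by apply: lerD; rewrite ler_pM2l// ?sqr_normN.
- by move=> g xi; rewrite !fctE rhoD rhoN rhoS rhoT.
Qed.

HB.instance Definition _ :=
  GRing.isZmodClosed.Build (l2 -> l2) group_vN_pred group_vN_zmod_closed.

Record group_vN := GroupVN { vN_op :> l2 -> l2; _ : vN_op \in group_vN_pred }.
HB.instance Definition _ := [isSub for vN_op].
HB.instance Definition _ := [Choice of group_vN by <:].
HB.instance Definition _ := [SubChoice_isSubZmodule of group_vN by <:].

Lemma group_vNP (a : group_vN) : in_group_vN a.
Proof. exact/asboolP/(valP a). Qed.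

Lemma vN_one_proof : (id : l2 -> l2) \in group_vN_pred.
Proof.
by apply/asboolP; split=> //; exists 1 => xi; rewrite mul1r.
Qed.

Lemma vN_mul_proof (a b : group_vN) : a \o b \in group_vN_pred.
Proof.
have [lina /bounded_opP[K K0 aK] rhoa] := group_vNP a.
have [linb /bounded_opP[L L0 bL] rhob] := group_vNP b.
apply/asboolP; split=> [c x y /=||g xi /=]; first by rewrite linb lina.
  apply/bounded_opP; exists (K * L); first exact: mulr_ge0.
  move=> xi /=; apply: le_trans (aK _) _.
  by rewrite -mulrA ler_wpM2l.
by rewrite rhoa rhob.
Qed.

Definition vN_one : group_vN := GroupVN vN_one_proof.
Definition vN_mul (a b : group_vN) : group_vN := GroupVN (vN_mul_proof a b).

Lemma vN_mulA : associative vN_mul. Proof. by move=> a b c; exact/val_inj. Qed.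
Lemma vN_mul1l : left_id vN_one vN_mul. Proof. by move=> a; exact/val_inj. Qed.
Lemma vN_mul1r : right_id vN_one vN_mul. Proof. by move=> a; exact/val_inj. Qed.
Lemma vN_mulDl : left_distributive vN_mul +%R.
Proof. by move=> a b c; exact/val_inj. Qed.
Lemma vN_mulDr : right_distributive vN_mul +%R.
Proof.
move=> a b c; apply/val_inj/funext => xi /=.
have [lina _ _] := group_vNP a.
by have := lina 1 (b xi) (c xi); rewrite !scale1r.
Qed.

HB.instance Definition _ := GRing.Zmodule_isPzRing.Build group_vN
  vN_mulA vN_mul1l vN_mul1r vN_mulDl vN_mulDr.

(* Right modules over a ring A are [lmodType A^c]: for [m] in such a module,
   [a *: m] stands for m a. Here L(G) as a right module over itself. *)
Definition vN_rscale (a : group_vN^c) (x : group_vN) : group_vN := x * a.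

Lemma vN_rscaleA (a b : group_vN^c) x :
  vN_rscale a (vN_rscale b x) = vN_rscale (a * b) x.
Proof. by rewrite /vN_rscale -mulrA. Qed.
Lemma vN_rscale1 : left_id 1 vN_rscale. Proof. exact: mulr1. Qed.
Lemma vN_rscaleDr : right_distributive vN_rscale +%R.
Proof. by move=> a x y; rewrite /vN_rscale mulrDl. Qed.
Lemma vN_rscaleDl x : {morph vN_rscale^~ x : a b / a + b}.
Proof. by move=> a b; rewrite /vN_rscale mulrDr. Qed.

HB.instance Definition _ := GRing.Zmodule_isLmodule.Build group_vN^c group_vN
  vN_rscaleA vN_rscale1 vN_rscaleDr vN_rscaleDl.

Lemma lam_in_vN g : lam g \in group_vN_pred.
Proof.
apply/asboolP; split=> [a x y||h xi]; first exact/val_inj.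
  by exists 1 => xi; rewrite /l2norm sqr_norm_lam mul1r.
by apply/val_inj/funext => k /=; rewrite mulgA.
Qed.

Definition lamL g : group_vN := GroupVN (lam_in_vN g).

Definition tau (a : group_vN) : R[i] := inner (a (delta R 1%g)) (delta R 1%g).

(* b is the adjoint of a. *)
Definition adjoint_of (a b : group_vN) : Prop :=
  forall xi eta, inner (a xi) eta = inner xi (b eta).

End VonNeumannAlgebra.

Section Dimension.
Variables (R : realType) (G : groupType).
Local Notation L := (group_vN R G).

(* q = q^* = q^2, where the (i, j) entry of q^* is the adjoint of q j i. *)
Definition mx_projection n (q : 'M[L]_n) : Prop :=
  (forall i j, adjoint_of (q i j) (q j i)) /\ q *m q = q.

Definition mx_range n (q : 'M[L]_n) : set 'cV[L]_n :=
  [set q *m v | v in [set: 'cV[L]_n]].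

(* Right multiplication of a column by the scalar a is [v *m a%:M]. *)
Definition rlinear_on n (M : lmodType L^c) (D : set 'cV[L]_n)
    (phi : 'cV[L]_n -> M) : Prop :=
  (forall u v, D u -> D v -> phi (u + v) = phi u + phi v) /\
  (forall v (a : L), D v -> phi (v *m a%:M) = (a : L^c) *: phi v).

(* P is a submodule of M isomorphic to q L(G)^n: being the image of an injective
   right-linear map on q L(G)^n, P is automatically a submodule. The traces
   [tau (q i i)] are nonnegative real numbers since q is a projection. *)
Definition fgproj_dim (M : lmodType L^c) (P : set M) (d : R) : Prop :=
  exists (n : nat) (q : 'M[L]_n) (phi : 'cV[L]_n -> M),
    [/\ mx_projection q, rlinear_on (mx_range q) phi,
        set_bij (mx_range q) P phi
      & d = \sum_(i < n) complex.Re (tau (q i i))].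

Definition vN_dim (M : lmodType L^c) : \bar R :=
  ereal_sup [set d%:E | d in [set d | exists P : set M, fgproj_dim P d]].

End Dimension.

Section Cohomology.
Variables (R : realType) (G : groupType).
Local Notation L := (group_vN R G).

(* The first two differentials of the inhomogeneous (bar) cochain complex of G
   with coefficients in L(G), on which g acts by left multiplication by
   [lamL g]; the kernel of [d1] modulo the image of [d0] is H^1(G, L(G)). *)
Definition d0 (a : L) : G -> L := fun g => lamL R g * a - a.

Definition d1 (c : G -> L) : G * G -> L :=
  fun gh => lamL R gh.1 * c gh.2 - c (gh.1 * gh.2)%g + c gh.1.

Lemma d0_linear (a : L^c) (x y : L) : d0 (a *: x + y) = a *: d0 x + d0 y.
Proof.
apply/funext => g; rewrite /d0 !fctE.
have scE (z : L) : a *: z = z * (a : L) by [].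
by rewrite !scE mulrDr mulrBl mulrA opprD addrACA.
Qed.

Lemma d1_linear (a : L^c) (c e : G -> L) : d1 (a *: c + e) = a *: d1 c + d1 e.
Proof.
apply/funext => -[g h]; rewrite /d1 !fctE /=.
have scE (z : L) : a *: z = z * (a : L) by [].
rewrite !scE mulrDr !mulrDl mulNr mulrA opprD (addrACA (_ * _)).
exact: addrACA.
Qed.

Definition Z1_pred : pred (G -> L) := fun c => `[< d1 c = 0 >].

Lemma Z1_closed : submod_closed Z1_pred.
Proof.
split=> [|a c e /asboolP cZ /asboolP eZ]; apply/asboolP.
  apply/funext => -[g h]; change (lamL R g * 0 - 0 + 0 = 0 :> L).
  by rewrite mulr0 subr0 addr0.
by rewrite d1_linear cZ eZ scaler0 addr0.
Qed.

HB.instance Definition _ :=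
  GRing.isSubmodClosed.Build L^c (G -> L) Z1_pred Z1_closed.

Record Z1 := Cocycle { cocycle_fun :> G -> L; _ : cocycle_fun \in Z1_pred }.
HB.instance Definition _ := [isSub for cocycle_fun].
HB.instance Definition _ := [Choice of Z1 by <:].
HB.instance Definition _ := [SubChoice_isSubLmodule of Z1 by <:].

Definition B1_pred : pred Z1 := fun c => `[< exists a : L, val c = d0 a >].

Lemma B1_closed : submod_closed B1_pred.
Proof.
split=> [|a c e /asboolP[x cx] /asboolP[y ey]]; apply/asboolP.
  exists 0; apply/funext => g; rewrite /d0 mulr0 subr0.
  by [].
by exists (a *: x + y); rewrite d0_linear -cx -ey.
Qed.

Definition H1 : lmodType L^c := lmodquot B1_closed.

Definition beta1 : \bar R := vN_dim H1.

End Cohomology.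

(* Main.v *)
Require Import Defs.
From HB Require Import structures.
From mathcomp Require Import all_boot all_order all_algebra.
From mathcomp Require Import all_fingroup all_solvable.
From mathcomp Require Import generic_quotient.
From mathcomp Require Import complex ring lra.
From mathcomp Require Import boolp classical_sets functions cardinality fsbigop.
From mathcomp Require Import reals ereal numfun esum.

Set Implicit Arguments.
Unset Strict Implicit.
Unset Printing Implicit Defensive.
Import Order.TTheory GRing.Theory Num.Theory.
Local Open Scope classical_set_scope.
Local Open Scope ring_scope.

(* Let S normally generate G. A cocycle c : G -> l2(G) vanishing on S is zero: by
   Fox calculus this says that an integral matrix over Z[G] is injective on l2, and
   Lueck's approximation argument deduces it from injectivity modulo p over the
   finite p-quotients, where it holds because a normally generating subset of a
   finite p-group generates it. Hence restriction to S embeds the cocycles. A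
   submodule of H^1(G, LG) of dimension d, enlarged by the inner derivations (which
   have dimension 1, as G is infinite), is thus mapped injectively by an equivariant
   operator into functions on S, with weights making the restrictions square
   summable, and d + 1 is at most the trace of the projection onto any space
   containing the image. For S = Lambda that space consists of the weighted
   cocycles of Lambda, of dimension at most beta_1(Lambda) + 1; for S = {g_i} a
   cocycle satisfies (1 + g_i + ... + g_i^(n_i - 1)) c(g_i) = 0, which leaves
   dimension 1 - 1/n_i in the coordinate i.
   Complex l2 is treated as a sum of two real spaces, which doubles all traces. *)

(** * Real square summable families *)

(** Dimensions are given only as suprema over finitely generated projective submodules, so every
    comparison is made between traces of explicit projections. All of them rest on
    [rank_inequality]: for an equivariant contraction [T], the projection onto the orthogonal
    complement of its kernel has trace at most that of a projection whose range contains the image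
    of [T]. Weights are harmless there, since rescaling coordinates by positive numbers does not
    change the kernel. Finite presentation makes the Fox matrix finite: its rows belong to the
    relators and to words for finitely many elements of S, which suffice because the finitely many
    generators already lie in their normal closure. Over a finite quotient, the rows of the relators
    force a family of functions to extend to a cocycle. Passing from G to Lambda changes the algebra
    but not the trace: restricting the values of a cocycle, as functions on G, to Lambda gives a
    cocycle of Lambda, and the trace reads off only the coordinate at the identity. *)

HB.lock Definition abs_sum (R : realType) (X : choiceType) (u : X -> R) : R :=
  fine (esum [set: X] (EFin \o u)^\+ - esum [set: X] (EFin \o u)^\-)%E.

Section AbsoluteSums.
Variables (R : realType) (X : choiceType).
Implicit Types u v : X -> R.

Definition abs_summable u : Prop := summable [set: X] (EFin \o u).

Lemma abs_summable_le u v :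
  (forall x, `|u x| <= `|v x|) -> abs_summable v -> abs_summable u.
Proof.
by move=> uv; apply: le_lt_trans; apply: le_esum => x _ /=; rewrite lee_fin uv.
Qed.

Lemma abs_summableD u v :
  abs_summable u -> abs_summable v -> abs_summable (fun x => u x + v x).
Proof.
by move=> su sv; rewrite /abs_summable (_ : _ \o _ =
  (EFin \o u) \+ (EFin \o v))%E//; exact: summableD.
Qed.

Lemma abs_summableZ a u : abs_summable u -> abs_summable (fun x => a * u x).
Proof.
move=> su; apply: (@le_lt_trans _ _ (`|a|%:E * \esum_(x in [set: X]) `|(u x)%:E|)%E).
  apply: le_trans (ge0_esumZl_le _ _) => //.
  by apply: le_esum => x _ /=; rewrite -EFinM lee_fin normrM.
have := su; rewrite /abs_summable summableE => /fineK <-.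
by rewrite -EFinM ltry.
Qed.

Lemma abs_summableN u : abs_summable u -> abs_summable (fun x => - u x).
Proof. by apply: abs_summable_le => x; rewrite normrN. Qed.

Lemma ge0_abs_summable_fin u : (forall x, 0 <= u x) -> abs_summable u ->
  (esum [set: X] (EFin \o u) \is a fin_num)%E.
Proof.
rewrite /abs_summable summableE => u0.
by under eq_esum do rewrite /= ger0_norm//.
Qed.

Lemma abs_sumB u v : (forall x, 0 <= u x) -> (forall x, 0 <= v x) ->
  abs_summable u -> abs_summable v ->
  abs_sum (fun x => u x - v x) =
  fine (esum [set: X] (EFin \o u)) - fine (esum [set: X] (EFin \o v)).
Proof.
move=> u0 v0 su sv; rewrite -fineB ?ge0_abs_summable_fin//.
rewrite abs_sum.unlock -(esumB su sv); last 2 first.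
- by move=> x _; rewrite lee_fin.
- by move=> x _; rewrite lee_fin.
by congr fine.
Qed.

Lemma fine_esumD u v : (forall x, 0 <= u x) -> (forall x, 0 <= v x) ->
  abs_summable u -> abs_summable v ->
  fine (esum [set: X] (EFin \o (fun x => u x + v x))) =
  fine (esum [set: X] (EFin \o u)) + fine (esum [set: X] (EFin \o v)).
Proof.
move=> u0 v0 su sv; rewrite -fineD ?ge0_abs_summable_fin//.
by rewrite -esumD// => x _; rewrite lee_fin.
Qed.

Lemma ge0_esumZl (a : R) (u : X -> \bar R) : 0 <= a -> (forall x, 0 <= u x)%E ->
  (\esum_(x in [set: X]) (a%:E * u x) = a%:E * \esum_(x in [set: X]) u x)%E.
Proof.
move=> a0 u0; apply/eqP; rewrite eq_le ge0_esumZl_le//=.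
have [->|an0] := eqVneq a 0.
  by rewrite mul0e; apply: esum_ge0 => x _; rewrite mul0e.
have ai0 : 0 <= a^-1 by rewrite invr_ge0.
have := @ge0_esumZl_le _ _ (fun x => a%:E * u x)%E _ ai0.
have eqe x : (a^-1%:E * (a%:E * u x))%E = u x.
  by rewrite muleA -EFinM mulVf// mul1e.
under eq_esum do rewrite eqe.
move=> /(_ (fun x => mule_ge0 _ _)) le1.
apply: (@le_trans _ _ (a%:E * (a^-1%:E * \esum_(x in [set: X]) (a%:E * u x)))%E).
  by rewrite lee_wpmul2l ?lee_fin// le1// => x; rewrite lee_fin.
by rewrite muleA -EFinM mulfV// mul1e.
Qed.

Let pos u x := Num.max (u x) 0.
Let neg u x := Num.max (- u x) 0.
Let posB u x : u x = pos u x - neg u x.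
Proof.
by rewrite /pos /neg; have [h|h] := leP (u x) 0; have [k|k] := leP (- u x) 0; lra.
Qed.
Let pos0 u x : 0 <= pos u x. Proof. by rewrite le_max lexx orbT. Qed.
Let neg0 u x : 0 <= neg u x. Proof. by rewrite le_max lexx orbT. Qed.
Let spos u : abs_summable u -> abs_summable (pos u).
Proof.
by apply: abs_summable_le => x; rewrite (ger0_norm (pos0 _ _)) /pos ge_max normr_ge0 ler_norm.
Qed.
Let sneg u : abs_summable u -> abs_summable (neg u).
Proof. by move=> /abs_summableN/spos. Qed.

Lemma abs_sumD u v : abs_summable u -> abs_summable v ->
  abs_sum (fun x => u x + v x) = abs_sum u + abs_sum v.
Proof.
move=> su sv.
have ad (f g : X -> R) : (forall x, 0 <= f x) -> (forall x, 0 <= g x) ->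
  forall x, 0 <= f x + g x by move=> f0 g0 x; rewrite addr_ge0.
have e1 : (fun x => u x + v x) =
    fun x => (pos u x + pos v x) - (neg u x + neg v x).
  by apply/funext => x; rewrite [u x]posB [v x]posB; lra.
have eu w : w = fun x => pos w x - neg w x by apply/funext => x; exact: posB.
rewrite e1 abs_sumB; last 4 first.
- by apply: ad.
- by apply: ad.
- by apply: abs_summableD; apply: spos.
- by apply: abs_summableD; apply: sneg.
rewrite [in RHS](eu u) [in X in _ = _ + X](eu v) !abs_sumB//;
  [|exact: spos|exact: sneg|exact: spos|exact: sneg].
rewrite (fine_esumD (pos0 u) (pos0 v) (spos su) (spos sv)).
rewrite (fine_esumD (neg0 u) (neg0 v) (sneg su) (sneg sv)).
by rewrite opprD addrACA.
Qed.

Lemma ge0_abs_sum u : (forall x, 0 <= u x) ->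
  abs_sum u = fine (esum [set: X] (EFin \o u)).
Proof.
move=> u0; rewrite abs_sum.unlock [X in (_ - X)%E](_ : _ = 0%E) ?sube0.
  congr fine; apply: eq_esum => x _.
  by rewrite funeposE/=; apply/max_idPl; rewrite lee_fin.
apply: esum1 => x _; rewrite funenegE /=; apply/max_idPr.
by rewrite lee_fin oppr_le0.
Qed.

Lemma abs_sumN u : abs_summable u -> abs_sum (fun x => - u x) = - abs_sum u.
Proof.
move=> su; apply/eqP; rewrite -addr_eq0 -abs_sumD//; last exact: abs_summableN.
under eq_fun do rewrite addNr.
rewrite ge0_abs_sum//; apply/eqP.
by rewrite (_ : esum _ _ = 0%E)// esum1.
Qed.

Lemma abs_sumZ a u : abs_summable u -> abs_sum (fun x => a * u x) = a * abs_sum u.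
Proof.
have Zpos b v : 0 <= b -> abs_summable v -> (forall x, 0 <= v x) ->
    abs_sum (fun x => b * v x) = b * abs_sum v.
  move=> b0 sv v0; rewrite !ge0_abs_sum//; last by move=> x; rewrite mulr_ge0.
  rewrite (_ : _ \o _ = (fun x => b%:E * (v x)%:E)%E)// ge0_esumZl//.
  by rewrite fineM// ge0_abs_summable_fin.
have Zge0 b v : 0 <= b -> abs_summable v ->
    abs_sum (fun x => b * v x) = b * abs_sum v.
  move=> b0 sv.
  have -> : (fun x => b * v x) = fun x => b * pos v x + - (b * neg v x).
    by apply/funext => x; rewrite [in LHS]posB mulrBr.
  have -> : abs_sum v = abs_sum (pos v) - abs_sum (neg v).
    rewrite -abs_sumN; last exact: sneg.
    rewrite -abs_sumD; [|exact: spos|exact/abs_summableN/sneg].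
    by congr abs_sum; apply/funext => x; exact: posB.
  have sbn : abs_summable (fun x => b * neg v x) by apply/abs_summableZ/sneg.
  rewrite abs_sumD; [|exact/abs_summableZ/spos|exact/abs_summableN].
  by rewrite abs_sumN// !Zpos//; [by rewrite mulrBr|exact: sneg|exact: spos].
move=> su; have [a0|a0] := leP 0 a; first exact: Zge0.
have -> : (fun x => a * u x) = fun x => - ((- a) * u x).
  by apply/funext => x; rewrite mulNr opprK.
rewrite abs_sumN ?Zge0// ?oppr_ge0 ?ltW//; last exact: abs_summableZ.
by rewrite mulNr opprK.
Qed.

End AbsoluteSums.

Section SquareSummableReal.
Variables (R : realType) (X : choiceType).
Implicit Types f g : X -> R^o.

Lemma esum_le_uniq (u : X -> R) (M : R) : (forall x, 0 <= u x) ->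
  (forall s : seq X, uniq s -> \sum_(x <- s) u x <= M) ->
  (esum [set: X] (EFin \o u) <= M%:E)%E.
Proof.
move=> u0 uM; rewrite ge_ereal_sup// => _ [A [finA _]] <-.
by rewrite fsbig_finite//= sumEFin lee_fin uM// fset_uniq.
Qed.

Lemma esum_ge_uniq (u : X -> \bar R) (s : seq X) :
  (forall x, 0 <= u x)%E -> uniq s ->
  (\sum_(x <- s) u x <= esum [set: X] u)%E.
Proof.
move=> u0 us; apply: esum_ge; exists [set` s]; first by split.
by rewrite fsbig_seq.
Qed.

Definition sq_summable : pred (X -> R^o) :=
  fun f => `[< abs_summable (fun x => (f x : R) ^+ 2) >].

Lemma sq_summableE f :
  (f \in sq_summable) = (esum [set: X] (fun x => (f x ^+ 2)%:E) < +oo)%E.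
Proof.
rewrite unfold_in /sq_summable /abs_summable /summable.
under eq_esum => x _ do rewrite /= ger0_norm ?sqr_ge0//.
by apply/asboolP/idP.
Qed.

Lemma sq_summableP f :
  reflect (abs_summable (fun x => f x ^+ 2)) (f \in sq_summable).
Proof. exact: asboolP. Qed.

Lemma sq_summable_bounded f (M : R) :
  (forall s : seq X, uniq s -> \sum_(x <- s) f x ^+ 2 <= M) ->
  f \in sq_summable.
Proof.
move=> fM; rewrite sq_summableE; apply: (@le_lt_trans _ _ M%:E); last exact: ltry.
by apply: (@esum_le_uniq (fun x => f x ^+ 2)) => // x; exact: sqr_ge0.
Qed.

Lemma abs_summableM f g : f \in sq_summable -> g \in sq_summable ->
  abs_summable (fun x => f x * g x).
Proof.
move=> /sq_summableP sf /sq_summableP sg.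
apply: abs_summable_le (abs_summableD sf sg) => x.
rewrite [leRHS]ger0_norm ?addr_ge0 ?sqr_ge0// ler_norml.
have := sqr_ge0 (f x + g x); have := sqr_ge0 (f x - g x).
have := sqr_ge0 (f x); have := sqr_ge0 (g x); nra.
Qed.

Lemma sq_summable_submod_closed :
  submod_closed sq_summable.
Proof.
split=> [|a f g sf sg]; apply/sq_summableP.
  by apply: (@le_lt_trans _ _ 0%E) => //; rewrite esum1// => x _ /=; rewrite expr0n/= normr0.
have := abs_summableD (abs_summableZ (a ^+ 2) (asboolW sf)) (asboolW sg).
move=> /abs_summableD/(_ (abs_summableZ (2 * a) (abs_summableM sf sg))).
apply: abs_summable_le => x; rewrite le_eqVlt; apply/orP; left; apply/eqP.
by congr `|_|; rewrite !fctE/= sqrrD exprMn -[a *: _]/(a * f x); ring.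
Qed.

HB.instance Definition _ :=
  GRing.isSubmodClosed.Build R (X -> R^o) sq_summable sq_summable_submod_closed.

Record hl2 := Hl2 { hl2_val : X -> R^o; _ : hl2_val \in sq_summable }.
HB.instance Definition _ := [isSub for hl2_val].
HB.instance Definition _ := [Choice of hl2 by <:].
HB.instance Definition _ := [SubChoice_isSubLmodule of hl2 by <:].

(* The regular module [R^o] is only needed for the module structure. *)
Definition hl2_fun (f : hl2) : X -> R := hl2_val f.
Coercion hl2_fun : hl2 >-> Funclass.

End SquareSummableReal.
Arguments hl2_fun : simpl never.

HB.lock Definition ip (R : realType) (X : choiceType) (f g : hl2 R X) : R :=
  abs_sum (fun x => f x * g x).

Section InnerProduct.
Variables (R : realType) (X : choiceType).
Implicit Types f g h : hl2 R X.

Lemma hl2P f g : (forall x, f x = g x) -> f = g.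
Proof. by move=> fg; apply/val_inj/funext. Qed.

Lemma hl2D f g x : (f + g) x = f x + g x. Proof. by []. Qed.
Lemma hl2N f x : (- f) x = - f x. Proof. by []. Qed.
Lemma hl2Z a f x : (a *: f) x = a * f x. Proof. by []. Qed.
Lemma hl20 x : (0 : hl2 R X) x = 0. Proof. by []. Qed.
Lemma hl2_sum I (r : seq I) P (F : I -> hl2 R X) x :
  (\sum_(i <- r | P i) F i) x = \sum_(i <- r | P i) F i x.
Proof. by elim/big_rec2: _ => // i y z _ <-. Qed.

Let summ f g : abs_summable (fun x => f x * g x).
Proof. by apply: abs_summableM; exact: valP. Qed.

Lemma ip_abs_sum f g : ip f g = abs_sum (fun x => f x * g x).
Proof. by rewrite ip.unlock. Qed.

Lemma ipC f g : ip f g = ip g f.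
Proof. by rewrite !ip_abs_sum; congr abs_sum; apply/funext => x; rewrite mulrC. Qed.

Lemma ipDl f g h : ip (f + g) h = ip f h + ip g h.
Proof.
by rewrite !ip_abs_sum -abs_sumD//; congr abs_sum; apply/funext => x; rewrite -mulrDl.
Qed.

Lemma ipZl a f g : ip (a *: f) g = a * ip f g.
Proof.
by rewrite !ip_abs_sum -abs_sumZ//; congr abs_sum; apply/funext => x; rewrite mulrA.
Qed.

Lemma ipNl f g : ip (- f) g = - ip f g.
Proof. by rewrite -scaleN1r ipZl mulN1r. Qed.

Lemma ip0l f : ip 0 f = 0.
Proof. by rewrite -(scale0r 0) ipZl mul0r. Qed.

Lemma ipBl f g h : ip (f - g) h = ip f h - ip g h.
Proof. by rewrite ipDl ipNl. Qed.

Lemma ipDr f g h : ip h (f + g) = ip h f + ip h g.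
Proof. by rewrite !(ipC h) ipDl. Qed.

Lemma ipZr a f g : ip g (a *: f) = a * ip g f.
Proof. by rewrite !(ipC g) ipZl. Qed.

Lemma ipNr f g : ip g (- f) = - ip g f.
Proof. by rewrite !(ipC g) ipNl. Qed.

Lemma ip0r f : ip f 0 = 0. Proof. by rewrite ipC ip0l. Qed.

Lemma ipBr f g h : ip h (f - g) = ip h f - ip h g.
Proof. by rewrite !(ipC h) ipBl. Qed.

Lemma ip_suml I (r : seq I) P (F : I -> hl2 R X) g :
  ip (\sum_(i <- r | P i) F i) g = \sum_(i <- r | P i) ip (F i) g.
Proof. by elim/big_rec2: _ => [|i y z _ <-]; rewrite ?ip0l// ipDl. Qed.

Lemma ip_sumr I (r : seq I) P (F : I -> hl2 R X) g :
  ip g (\sum_(i <- r | P i) F i) = \sum_(i <- r | P i) ip g (F i).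
Proof. by rewrite ipC ip_suml; apply: eq_bigr => i _; rewrite ipC. Qed.

Lemma ipE f : (ip f f)%:E = esum [set: X] (fun x => (f x ^+ 2)%:E).
Proof.
rewrite ip_abs_sum ge0_abs_sum; last by move=> x; rewrite -expr2 sqr_ge0.
rewrite (_ : _ \o _ = fun x => (f x ^+ 2)%:E)//.
rewrite fineK// ge0_fin_numE -?sq_summableE; first exact: valP.
by apply: esum_ge0 => x _; rewrite lee_fin sqr_ge0.
Qed.

Lemma ip_ge0 f : 0 <= ip f f.
Proof.
by rewrite -lee_fin ipE; apply: esum_ge0 => x _; rewrite lee_fin sqr_ge0.
Qed.

Lemma ip_le_bound f M :
  (forall s : seq X, uniq s -> \sum_(x <- s) f x ^+ 2 <= M) -> ip f f <= M.
Proof.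
move=> fM; rewrite -lee_fin ipE.
by apply: (@esum_le_uniq _ _ (fun x => f x ^+ 2)) => // x; rewrite sqr_ge0.
Qed.

Lemma ip_ge_sum f (s : seq X) : uniq s -> \sum_(x <- s) f x ^+ 2 <= ip f f.
Proof.
move=> us; rewrite -lee_fin ipE -sumEFin.
by apply: esum_ge_uniq => // x; rewrite lee_fin sqr_ge0.
Qed.

Lemma sqr_coord_le f x : f x ^+ 2 <= ip f f.
Proof. by have := @ip_ge_sum f [:: x] isT; rewrite big_seq1. Qed.

Lemma ip_eq0 f : ip f f = 0 -> f = 0.
Proof.
move=> f0; apply: hl2P => x; apply/eqP; rewrite -sqrf_eq0 eq_le sqr_ge0 andbT.
by rewrite -f0 sqr_coord_le.
Qed.

Lemma basis_proof x : (fun y : X => (y == x)%:R : R^o) \in @sq_summable R X.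
Proof.
apply: (@sq_summable_bounded _ _ _ 1) => s us.
have [xs|xs] := boolP (x \in s).
  rewrite (bigD1_seq x)//= eqxx expr1n big1 ?addr0// => y /negPf ->.
  by rewrite expr0n.
rewrite big_seq big1// => y ys.
by have [yx|_] := eqVneq y x; [rewrite -yx ys in xs|rewrite expr0n].
Qed.

Definition basis x : hl2 R X := Hl2 (basis_proof x).

Lemma basisE x y : basis x y = (y == x)%:R. Proof. by []. Qed.

Lemma abs_sum_basis x : abs_sum (fun y : X => (y == x)%:R : R) = 1.
Proof.
rewrite ge0_abs_sum; last by move=> y; exact: ler0n.
rewrite (_ : esum _ _ = esum [set x] (fun y : X => (y == x)%:R%:E)).
  by rewrite esum_set1 ?eqxx ?lee_fin.
rewrite [RHS]esum_mkcond; apply: eq_esum => y _ /=.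
by have [->|yx] := eqVneq y x; [rewrite mem_set|rewrite memNset//= => /eqP; exact/negP].
Qed.

Lemma ip_basis f x : ip f (basis x) = f x.
Proof.
rewrite ip_abs_sum (_ : (fun _ => _) = fun y => f x * (y == x)%:R).
  rewrite abs_sumZ ?abs_sum_basis ?mulr1//.
  have := summ (basis x) (basis x).
  congr abs_summable; apply/funext => y; rewrite basisE.
  by case: eqP; rewrite ?mulr0 ?mulr1.
by apply/funext => y; rewrite basisE; have [->|_] := eqVneq y x; rewrite ?mulr0.
Qed.

Lemma ip_basis2 x y : ip (basis x) (basis y) = (x == y)%:R.
Proof. by rewrite ip_basis basisE eq_sym. Qed.

Lemma cauchy_schwarz f g : ip f g ^+ 2 <= ip f f * ip g g.
Proof.
have [g0|gn0] := eqVneq (ip g g) 0.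
  by rewrite (ip_eq0 g0) !ip0r expr0n mulr0.
have := ip_ge0 (ip g g *: f - ip f g *: g).
rewrite ipBl !ipBr !ipZl !ipZr (ipC g f).
have gp : 0 < ip g g by rewrite lt_neqAle eq_sym gn0 ip_ge0.
set a := ip f f; set b := ip f g; set c := ip g g.
move=> h; rewrite -subr_ge0 -(pmulr_rge0 _ gp) -/c.
by apply: le_trans h _; rewrite le_eqVlt; apply/orP; left; apply/eqP; ring.
Qed.

Lemma ipD_le f g : ip (f + g) (f + g) <= 2 * ip f f + 2 * ip g g.
Proof.
have := ip_ge0 (f - g); rewrite ipBl !ipBr ipDl !ipDr (ipC g f).
lra.
Qed.

Lemma parallelogram f g :
  ip (f + g) (f + g) + ip (f - g) (f - g) = 2 * ip f f + 2 * ip g g.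
Proof. by rewrite ipBl !ipBr ipDl !ipDr (ipC g f); ring. Qed.

Definition hl2_cvg (u : nat -> hl2 R X) (l : hl2 R X) : Prop :=
  forall e, 0 < e -> exists N, forall n, (N <= n)%N ->
    ip (u n - l) (u n - l) <= e.

Definition hl2_cauchy (u : nat -> hl2 R X) : Prop :=
  forall e, 0 < e -> exists N, forall m n, (N <= m)%N -> (N <= n)%N ->
    ip (u m - u n) (u m - u n) <= e.

End InnerProduct.

Section RealSequences.
Variable R : realType.

Lemma normr_le_sqr (x e : R) : 0 <= e -> x ^+ 2 <= e ^+ 2 -> `|x| <= e.
Proof.
by move=> e0 xe; rewrite ler_norml; apply/andP; split; nra.
Qed.

Lemma real_complete (a : nat -> R) :
  (forall e, 0 < e -> exists N, forall m n, (N <= m)%N -> (N <= n)%N ->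
     `|a m - a n| <= e) ->
  exists l, forall e, 0 < e -> exists N, forall n, (N <= n)%N -> `|a n - l| <= e.
Proof.
(* [sup S] is the limit inferior of [a]. *)
move=> ca; pose S := [set x | exists N, forall n, (N <= n)%N -> x <= a n].
have S_lb e N : (forall m n, (N <= m)%N -> (N <= n)%N -> `|a m - a n| <= e) ->
    S (a N - e).
  move=> aN; exists N => n Nn; have := aN _ _ (leqnn N) Nn.
  by rewrite ler_norml; lra.
have S_ub e N : (forall m n, (N <= m)%N -> (N <= n)%N -> `|a m - a n| <= e) ->
    ubound S (a N + e).
  move=> aN x [M xM]; apply: le_trans (xM (maxn M N) (leq_maxl _ _)) _.
  have := aN _ _ (leqnn N) (leq_maxr M N).
  by rewrite ler_norml; lra.
have supS : has_sup S.
  by have [N aN] := ca 1 ltr01; split; eexists; [exact: S_lb aN|exact: S_ub aN].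
exists (sup S) => e e0; have e20 : 0 < e / 2 by lra.
have [N aN] := ca _ e20; exists N => n Nn.
have h1 : a N - e / 2 <= sup S by apply: sup_upper_bound => //; exact: S_lb.
have h2 : sup S <= a N + e / 2.
  by apply: ge_sup; [case: supS|exact: S_ub].
have := aN _ _ (leqnn N) Nn; move: h1 h2; rewrite !ler_norml; lra.
Qed.

Lemma nonincreasing_cauchy (a : nat -> R) : (forall n, 0 <= a n) ->
  (forall n, a n.+1 <= a n) ->
  forall e, 0 < e -> exists N, forall m n, (N <= m)%N -> (m <= n)%N ->
    0 <= a m - a n <= e.
Proof.
move=> a0 adec e e0.
have amon m n : (m <= n)%N -> a n <= a m.
  move=> /subnK <-; elim: (n - m)%N => // k; apply: le_trans.
  by rewrite addSn adec.
pose S := [set a n | n in [set: nat]].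
have infS : has_inf S by split; [exists (a 0); exists 0%N|exists 0 => _ [n _ <-]].
have [_ [N _ <-] aN] := @inf_adherent _ _ _ e0 infS.
exists N => m n Nm mn; rewrite subr_ge0 amon//=.
have h1 : inf S <= a n by apply: ge_inf; [case: infS|exists n].
have := amon _ _ Nm; lra.
Qed.

End RealSequences.

Section Completeness.
Variables (R : realType) (X : choiceType).
Implicit Types f g h : hl2 R X.

Lemma ip_eq0_le f : (forall e, 0 < e -> ip f f <= e) -> f = 0.
Proof.
move=> fe; apply: ip_eq0; apply/eqP; rewrite eq_le ip_ge0 andbT.
by apply/ler_addgt0Pr => e e0; rewrite add0r fe.
Qed.

(** Coordinates converge by completeness of the reals. [lim_bound] carries the Cauchy estimate over
    to the limit on each finite set of coordinates, which is enough because [ip] is a supremum of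
    finite sums. *)
Lemma hl2_complete (u : nat -> hl2 R X) : hl2_cauchy u -> exists l, hl2_cvg u l.
Proof.
move=> cu.
have pt x : exists l, forall e, 0 < e ->
    exists N, forall n, (N <= n)%N -> `|u n x - l| <= e.
  apply: real_complete => e e0; have e20 : 0 < e ^+ 2 by rewrite exprn_gt0.
  have [N uN] := cu _ e20; exists N => m n Nm Nn.
  apply: normr_le_sqr (ltW e0) _.
  by apply: le_trans (uN _ _ Nm Nn); exact: (sqr_coord_le (u m - u n)).
have [l ul] := choice pt.
have lim_bound e N m (s : seq X) : 0 < e ->
    (forall m n, (N <= m)%N -> (N <= n)%N -> ip (u m - u n) (u m - u n) <= e) ->
    (N <= m)%N -> uniq s -> \sum_(x <- s) (u m x - l x) ^+ 2 <= 3 * e.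
  move=> e0 uN Nm us.
  (* The error allowed per coordinate, so small that all of [s] together contributes at most [e]. *)
  pose d := e / (2 * (size s).+1%:R).
  have d0 : 0 < d by rewrite divr_gt0// mulr_gt0// ltr0n.
  have [n [Nn un]] : exists n, (N <= n)%N /\
      forall x, x \in s -> (u n x - l x) ^+ 2 <= d.
    have [K uK] : exists K, forall n, (K <= n)%N -> forall x, x \in s ->
        (u n x - l x) ^+ 2 <= d.
      elim: s {us d d0} (d) d0 => [|x s IH] d d0; first by exists 0%N.
      have [K uK] := IH _ d0; have sd0 : 0 < Num.sqrt d by rewrite sqrtr_gt0.
      have [M uM] := ul x _ sd0; exists (maxn K M) => n.
      rewrite geq_max => /andP[Kn Mn] y; rewrite inE => /predU1P[->|]; last first.
        exact: uK.
      have := uM _ Mn; rewrite ler_norml => /andP[h1 h2].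
      have er : Num.sqrt d ^+ 2 = d by rewrite sqr_sqrtr ?ltW.
      by rewrite -[leRHS]er; nra.
    exists (maxn K N); split; first exact: leq_maxr.
    by apply: uK; exact: leq_maxl.
  apply: (@le_trans _ _ (\sum_(x <- s) (2 * (u m x - u n x) ^+ 2 + 2 * d))).
    rewrite big_seq [leRHS]big_seq; apply: ler_sum => x xs.
    have := un _ xs; have := sqr_ge0 ((u m x - u n x) - (u n x - l x)); nra.
  rewrite big_split/= -mulr_sumr big_const_seq count_predT iter_addr_0.
  have h1 := le_trans (ip_ge_sum (u m - u n) us) (uN _ _ Nm Nn).
  have h2 : d * (size s)%:R <= e / 2.
    rewrite /d invfM mulrA -[leRHS]mulr1 -mulrA ler_pM2l ?divr_gt0//.
    by rewrite mulrC ler_pdivrMr ?ltr0n// mul1r ler_nat.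
  have h3 : (2 * d) *+ size s <= e.
    by rewrite -mulr_natr -mulrA; lra.
  have -> : 3 * e = 2 * e + e by ring.
  by apply: lerD; rewrite // ler_pM2l.
have lH : (l : X -> R^o) \in @sq_summable R X.
  have [N uN] := cu 1 ltr01.
  apply: (@sq_summable_bounded _ _ _ (2 * ip (u N) (u N) + 6)) => s us.
  apply: (@le_trans _ _ (\sum_(x <- s) (2 * (u N x) ^+ 2 + 2 * (u N x - l x) ^+ 2))).
    by apply: ler_sum => x _; have := sqr_ge0 (2 * u N x - l x); nra.
  rewrite big_split/= -!mulr_sumr.
  have := lim_bound 1 N N s ltr01 uN (leqnn N) us.
  by have := ip_ge_sum (u N) us; lra.
exists (Hl2 lH) => e e0; have e30 : 0 < e / 3 by lra.
have [N uN] := cu _ e30; exists N => m Nm; apply: ip_le_bound => s us.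
by have := lim_bound _ _ m s e30 uN Nm us; lra.
Qed.

End Completeness.

Lemma invn_small (R : realType) (e : R) : 0 < e ->
  exists N, forall n, (N <= n)%N -> n.+1%:R^-1 <= e.
Proof.
move=> e0; have ei : 0 <= e^-1 by rewrite invr_ge0 ltW.
have [N eN] : exists N : nat, e^-1 < N%:R by exists (Num.bound e^-1); exact: archi_boundP.
exists N => n Nn; rewrite -[e]invrK lef_pV2 ?posrE ?invr_gt0 ?ltr0n//.
by apply: ltW (lt_le_trans eN _); rewrite ler_nat leqW.
Qed.

(** The final estimate of [ortho_proj_exists]: [a] comes from an almost minimizing vector and [b]
    from its distance to the limit; both squares are at most [d * c]. *)
Lemma sqrD_le_bound (R : realType) (d c q i a b : R) :
  0 <= d -> 0 <= c -> q <= d -> i <= d ->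
  a ^+ 2 <= i * c -> b ^+ 2 <= q * c -> (a + b) ^+ 2 <= d * (c + 1) * 4.
Proof.
move=> d0 c0 qd id h3 h4.
have h6 : a ^+ 2 <= d * c by apply: le_trans h3 _; rewrite ler_wpM2r.
have h7 : b ^+ 2 <= d * c by apply: le_trans h4 _; rewrite ler_wpM2r.
have := sqr_ge0 (a - b); rewrite sqrrB sqrrD.
have -> : d * (c + 1) * 4 = d * c * 4 + d * 4 by ring.
move: (d * c) (a * b) (a ^+ 2) (b ^+ 2) d0 h6 h7 => z y x' y'; clear; lra.
Qed.

(** * Projections and adjoints *)

Section Projection.
Variables (R : realType) (X : choiceType).
Implicit Types (f g h : hl2 R X) (A : set (hl2 R X)).

(** Closed subspaces are always given by equations, as [ortho A]. Accordingly [oproj A] below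
    projects onto [ortho A], not onto the span of [A]; for adjoint [T] and [S], [oproj (range S)] is
    the projection onto the kernel of [T]. *)
Definition ortho A : set (hl2 R X) := [set x | forall a, A a -> ip x a = 0].

Lemma ortho0 A : ortho A 0.
Proof. by move=> a _; rewrite ip0l. Qed.

Lemma orthoP A c f g : ortho A f -> ortho A g -> ortho A (c *: f + g).
Proof. by move=> Af Ag a Aa; rewrite ipDl ipZl Af// Ag// mulr0 addr0. Qed.

Lemma orthoD A f g : ortho A f -> ortho A g -> ortho A (f + g).
Proof. by move=> Af Ag; rewrite -[f]scale1r; exact: orthoP. Qed.

Lemma orthoZ A c f : ortho A f -> ortho A (c *: f).
Proof. by move=> Af; rewrite -[_ *: _]addr0; apply: orthoP => //; exact: ortho0. Qed.

Lemma orthoB A f g : ortho A f -> ortho A g -> ortho A (f - g).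
Proof. by move=> Af Ag; rewrite addrC -scaleN1r; exact: orthoP. Qed.

(** The optimal [t] is [ip f g / ip g g]. For [e = 0] this is the orthogonality of a norm
    minimizer. *)
Lemma ip_sqrB_le0 f g e : 0 <= e ->
  (forall t, ip f f - e <= ip (f - t *: g) (f - t *: g)) ->
  ip f g ^+ 2 <= e * ip g g.
Proof.
move=> e0 fg; have [g0|gn0] := eqVneq (ip g g) 0.
  by rewrite (ip_eq0 g0) ip0r expr0n mulr_ge0// ip_ge0.
have gp : 0 < ip g g by rewrite lt_neqAle eq_sym gn0 ip_ge0.
have := fg (ip f g / ip g g).
rewrite ipBl !ipBr !ipZl !ipZr (ipC g f).
set a := ip f f; set b := ip f g; set c := ip g g; rewrite -/c in gp gn0.
have -> : a - b / c * b - (b / c * b - b / c * (b / c * c)) = a - b ^+ 2 / c.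
  by field.
by move=> h; rewrite -ler_pdivrMr//; lra.
Qed.

(** A minimizing sequence for the distance to [ortho A] is Cauchy by the parallelogram identity; its
    limit stays in [ortho A], and [ip_sqrB_le0] makes the difference orthogonal. *)
Lemma ortho_proj_exists A x :
  exists p, ortho A p /\ forall v, ortho A v -> ip (x - p) v = 0.
Proof.
pose S := [set ip (x - v) (x - v) | v in ortho A].
have infS : has_inf S.
  split; first by exists (ip (x - 0) (x - 0)), 0 => //; exact: ortho0.
  by exists 0 => _ [v _ <-]; exact: ip_ge0.
have S_ge v : ortho A v -> inf S <= ip (x - v) (x - v).
  by move=> Av; apply: ge_inf; [case: infS|exists v].
have invn0 n : 0 < n.+1%:R^-1 :> R by rewrite invr_gt0 ltr0n.
have ex n : exists v, ortho A v /\ ip (x - v) (x - v) <= inf S + n.+1%:R^-1.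
  have [_ [v Av <-] xv] := @inf_adherent _ _ _ (invn0 n) infS.
  by exists v; split=> //; exact: ltW.
have [v vP] := choice ex.
have cv : hl2_cauchy v.
  move=> e e0; have e40 : 0 < e / 4 by lra.
  have [N eN] := invn_small e40; exists N => m n Nm Nn.
  have [[Am xm] [An xn]] := (vP m, vP n).
  have := parallelogram (x - v n) (x - v m).
  have -> : x - v n - (x - v m) = v m - v n by rewrite opprB addrC addrA subrK.
  have -> : x - v n + (x - v m) = 2 *: (x - 2^-1 *: (v m + v n)).
    rewrite scalerBr scalerA divff ?pnatr_eq0// scale1r scaler_nat mulr2n.
    by rewrite addrACA opprD (addrC (- v m)).
  rewrite ipZl ipZr.
  move: (S_ge _ (orthoZ 2^-1 (orthoD Am An))) (eN _ Nm) (eN _ Nn) xm xn.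
  move: (ip _ _) (ip (x - v m) _) (ip (x - v n) _) (ip (v m - v n) _) => a b c d.
  move: (inf S) m.+1%:R^-1 n.+1%:R^-1 => i j k; lra.
have [p vp] := hl2_complete cv.
have Ap : ortho A p.
  move=> a Aa; apply/eqP; rewrite -sqrf_eq0 eq_le sqr_ge0 andbT.
  apply/ler_addgt0Pr => e e0; rewrite add0r.
  have a1 : 0 < ip a a + 1 by have := ip_ge0 a; lra.
  have [N vN] := vp _ (divr_gt0 e0 a1).
  have -> : ip p a = - ip (v N - p) a by rewrite ipBl (vP N).1// sub0r opprK.
  rewrite sqrrN; apply: le_trans (cauchy_schwarz _ _) _.
  have := vN _ (leqnn N); rewrite ler_pdivlMr//.
  by have := ip_ge0 (v N - p); nra.
exists p; split=> // w Aw; apply/eqP; rewrite -sqrf_eq0 eq_le sqr_ge0 andbT.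
apply/ler_addgt0Pr => e e0; rewrite add0r.
have w1 : 0 < ip w w + 1 by have := ip_ge0 w; lra.
have d0 : 0 < e / (ip w w + 1) / 4 by rewrite !divr_gt0.
have [[N vN] [M eM]] := (vp _ d0, invn_small d0).
pose n := maxn M N.
have h1 := vN _ (leq_maxr M N : (N <= n)%N); have h2 := eM _ (leq_maxl M N : (M <= n)%N).
have h0 := ltW d0.
have h3 : ip (x - v n) w ^+ 2 <= n.+1%:R^-1 * ip w w.
  apply: ip_sqrB_le0 => [|t]; first by rewrite invr_ge0.
  rewrite lerBlDr; apply: le_trans (vP n).2 _; rewrite lerD2r.
  by have := S_ge _ (orthoD (vP n).1 (orthoZ t Aw)); rewrite opprD addrA.
have h4 := cauchy_schwarz (v n - p) w.
have -> : ip (x - p) w = ip (x - v n) w + ip (v n - p) w.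
  by rewrite -ipDl addrA subrK.
have h5 : e = e / (ip w w + 1) / 4 * (ip w w + 1) * 4.
  by field; rewrite gt_eqF.
by rewrite h5; apply: (sqrD_le_bound h0 (ip_ge0 w) h1 h2 h3 h4).
Qed.

End Projection.

HB.lock Definition oproj (R : realType) (X : choiceType) (A : set (hl2 R X))
  (x : hl2 R X) : hl2 R X := sval (cid (ortho_proj_exists A x)).

Section ProjectionTheory.
Variables (R : realType) (X : choiceType).
Implicit Types (f g h : hl2 R X) (A : set (hl2 R X)).

Lemma oproj_in A x : ortho A (oproj A x).
Proof. by rewrite oproj.unlock; case: cid => p []. Qed.

Lemma oproj_ortho A x v : ortho A v -> ip (x - oproj A x) v = 0.
Proof. by rewrite oproj.unlock; case: cid => p [_ +] /=; exact. Qed.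

Lemma oproj_uniq A x p : ortho A p ->
  (forall v, ortho A v -> ip (x - p) v = 0) -> oproj A x = p.
Proof.
move=> Ap xp; apply/eqP; rewrite -subr_eq0; apply/eqP/ip_eq0.
set d := oproj A x - p; have Ad : ortho A d by apply: orthoB => //; exact: oproj_in.
have -> : d = (x - p) - (x - oproj A x).
  by rewrite opprB addrC addrA subrK.
by rewrite ipBl xp ?oproj_ortho ?subr0// opprB addrC addrA subrK.
Qed.

Lemma oproj_id A x : ortho A x -> oproj A x = x.
Proof. by move=> Ax; apply: oproj_uniq => // v _; rewrite subrr ip0l. Qed.

Lemma oprojK A x : oproj A (oproj A x) = oproj A x.
Proof. by rewrite oproj_id//; exact: oproj_in. Qed.

Lemma oproj_sym A x y : ip (oproj A x) y = ip x (oproj A y).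
Proof.
have eqp u v : ip (oproj A u) v = ip (oproj A u) (oproj A v).
  have /eqP := oproj_ortho v (@oproj_in A u).
  by rewrite ipBl subr_eq0 (ipC v) (ipC (oproj A v)) => /eqP.
by rewrite eqp ipC -eqp ipC.
Qed.

Lemma oproj_linear A c x y : oproj A (c *: x + y) = c *: oproj A x + oproj A y.
Proof.
apply: oproj_uniq => [|v Av]; first by apply: orthoP; exact: oproj_in.
by rewrite opprD addrACA -scalerBr ipDl ipZl !oproj_ortho// mulr0 addr0.
Qed.

Lemma ip_oproj A x : ip (oproj A x) (oproj A x) = ip (oproj A x) x.
Proof. by rewrite oproj_sym oprojK oproj_sym. Qed.

Lemma ip_oprojB A x :
  ip (x - oproj A x) (x - oproj A x) = ip x x - ip (oproj A x) (oproj A x).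
Proof.
by rewrite ipBl !ipBr (ipC x (oproj A x)) -ip_oproj subrr subr0.
Qed.

Lemma oproj_contract A x : ip (oproj A x) (oproj A x) <= ip x x.
Proof. by rewrite -subr_ge0 -ip_oprojB ip_ge0. Qed.

(** Stability under the adjoint [U'] makes the orthogonal complement of [ortho A] stable under
    [U]. *)
Lemma oproj_comm A (U U' : hl2 R X -> hl2 R X) :
  (forall x y, ip (U x) y = ip x (U' y)) ->
  (forall x y, U (x - y) = U x - U y) ->
  (forall x, ortho A x -> ortho A (U x)) ->
  (forall x, ortho A x -> ortho A (U' x)) ->
  forall x, oproj A (U x) = U (oproj A x).
Proof.
move=> UU' UB AU AU' x; apply: oproj_uniq => [|v Av]; first exact/AU/oproj_in.
by rewrite -UB UU' oproj_ortho//; exact: AU'.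
Qed.

End ProjectionTheory.

Section Adjoints.
Variables (R : realType) (X Y : choiceType).
Implicit Types (T : hl2 R X -> hl2 R Y) (S : hl2 R Y -> hl2 R X).

(** Operators are bare functions: having an adjoint already forces linearity, see [adjoint_linear].
    In [bounded_by] the constant bounds the square of the operator norm. *)
Definition adjoint T S := forall x y, ip (T x) y = ip x (S y).

Definition bounded_by T (M : R) := forall x, ip (T x) (T x) <= M * ip x x.

Lemma ip_inj (x y : hl2 R Y) : (forall z, ip x z = ip y z) -> x = y.
Proof.
by move=> xy; apply/eqP; rewrite -subr_eq0; apply/eqP/ip_eq0; rewrite ipBl xy subrr.
Qed.

Lemma adjoint_linear T S c x y : adjoint T S -> T (c *: x + y) = c *: T x + T y.
Proof. by move=> TS; apply: ip_inj => z; rewrite TS !ipDl !ipZl !TS. Qed.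

Lemma adjointD T S x y : adjoint T S -> T (x + y) = T x + T y.
Proof. by move=> /adjoint_linear TS; have := TS 1 x y; rewrite !scale1r. Qed.

Lemma adjointZ T S c x : adjoint T S -> T (c *: x) = c *: T x.
Proof. by move=> TS; apply: ip_inj => z; rewrite TS !ipZl TS. Qed.

Lemma adjointB T S x y : adjoint T S -> T (x - y) = T x - T y.
Proof. by move=> TS; apply: ip_inj => z; rewrite TS !ipBl !TS. Qed.

Lemma adjoint0 T S : adjoint T S -> T 0 = 0.
Proof. by move=> TS; rewrite -(subrr 0) (adjointB _ _ TS) subrr. Qed.

End Adjoints.

Lemma adjointC (R : realType) (X Y : choiceType) (T : hl2 R X -> hl2 R Y) S :
  adjoint T S -> adjoint S T.
Proof. by move=> TS x y; rewrite ipC -TS ipC. Qed.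

Lemma adjoint_comp (R : realType) (X Y Z : choiceType)
    (T : hl2 R X -> hl2 R Y) S (T' : hl2 R Y -> hl2 R Z) S' :
  adjoint T S -> adjoint T' S' -> adjoint (T' \o T) (S \o S').
Proof. by move=> TS TS' x y /=; rewrite TS' TS. Qed.

Lemma adjoint_bounded (R : realType) (X Y : choiceType)
    (T : hl2 R X -> hl2 R Y) S M :
  adjoint T S -> 0 <= M -> bounded_by T M -> bounded_by S M.
Proof.
move=> TS M0 TM y; have := cauchy_schwarz (T (S y)) y.
have := TM (S y); rewrite (TS (S y) y).
have := ip_ge0 y; have := ip_ge0 (S y).
move: (ip (S y) (S y)) (ip y y) (ip (T _) _) => s t r s0 t0 h1 h2.
have [->|sn0] := eqVneq s 0; first exact: mulr_ge0.
have sp : 0 < s by rewrite lt_neqAle eq_sym sn0.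
rewrite -(ler_pM2l sp) -expr2; apply: le_trans h2 _.
by rewrite mulrA (mulrC s M) ler_wpM2r.
Qed.

Lemma sqrB_le_bound (R : realType) (d s t a b : R) : 0 <= d ->
  a ^+ 2 <= d * s -> b ^+ 2 <= d * t -> (a - b) ^+ 2 <= (2 * (s + t) + 1) * d.
Proof.
move=> d0; have := sqr_ge0 (a + b); rewrite sqrrD sqrrB.
have -> : (2 * (s + t) + 1) * d = 2 * (d * s) + 2 * (d * t) + d by ring.
by move: (d * s) (d * t) (a * b) (a ^+ 2) (b ^+ 2) => *; lra.
Qed.

Section AdjointExistence.
Variables (R : realType) (X Y : choiceType).

Definition trunc (s : seq X) (x : hl2 R X) : hl2 R X :=
  \sum_(i <- s) x i *: basis R i.

Lemma ip_trunc s (x y : hl2 R X) : ip (trunc s x) y = \sum_(i <- s) x i * y i.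
Proof. by rewrite ip_suml; apply: eq_bigr => i _; rewrite ipZl ipC ip_basis. Qed.

Lemma trunc_coord s (x : hl2 R X) i : uniq s ->
  trunc s x i = if i \in s then x i else 0.
Proof.
move=> us; rewrite hl2_sum; case: ifPn => [si|si].
  rewrite (bigD1_seq i)// hl2Z basisE eqxx mulr1/= big1 ?addr0// => j /negPf ji.
  by rewrite hl2Z basisE eq_sym ji mulr0.
rewrite big_seq big1// => j js; rewrite hl2Z basisE.
by case: eqVneq => [ij|_]; [rewrite ij js in si|rewrite mulr0].
Qed.

Lemma trunc_approx (x : hl2 R X) e : 0 < e ->
  exists2 s, uniq s & ip (x - trunc s x) (x - trunc s x) <= e.
Proof.
move=> e0; apply: contrapT => ns.
have : ip x x <= ip x x - e.
  apply: ip_le_bound => s us; rewrite lerBrDr -lerBrDl.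
  have [//|h] := leP e (ip x x - \sum_(i <- s) x i ^+ 2).
  exfalso; apply: ns; exists s => //; rewrite (le_trans _ (ltW h))//.
  rewrite ipBl !ipBr (ipC x) !ip_trunc.
  have -> : \sum_(i <- s) x i * trunc s x i = \sum_(i <- s) x i * x i.
    by rewrite big_seq [RHS]big_seq; apply: eq_bigr => i si; rewrite trunc_coord ?si.
  rewrite subrr subr0 lerD2l lerN2; apply: ler_sum => i _.
  by rewrite expr2.
lra.
Qed.

(** The [i]-th coordinate of the adjoint at [y] must be [ip (T (basis R i)) y]. Applying [T] to the
    finite combination with these coefficients bounds their sum of squares by [M * ip y y]; the
    adjoint identity, clear on truncations, extends by continuity. *)
Lemma adjoint_exists (T : hl2 R X -> hl2 R Y) M :
  (forall c x y, T (c *: x + y) = c *: T x + T y) -> 0 <= M -> bounded_by T M ->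
  exists S, adjoint T S.
Proof.
move=> Tl M0 TM.
have T0 : T 0 = 0 by have := Tl (-1) 0 0; rewrite scaler0 addr0 scaleN1r addNr.
have Tsum (s : seq X) (c : X -> R) :
    T (\sum_(i <- s) c i *: basis R i) = \sum_(i <- s) c i *: T (basis R i).
  by elim: s => [|i s IH]; rewrite ?big_nil// !big_cons Tl IH.
have SH y : (fun i => ip (T (basis R i)) y : R^o) \in @sq_summable R X.
  apply: (@sq_summable_bounded _ _ _ (M * ip y y)) => s us.
  pose c i := ip (T (basis R i)) y; pose x := \sum_(i <- s) c i *: basis R i.
  have xy : ip (T x) y = \sum_(i <- s) c i ^+ 2.
    by rewrite Tsum ip_suml; apply: eq_bigr => i _; rewrite ipZl expr2.
  have xx : ip x x = \sum_(i <- s) c i ^+ 2.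
    rewrite ip_suml; rewrite big_seq [RHS]big_seq; apply: eq_bigr => i si.
    rewrite ipZl ipC ip_basis hl2_sum (bigD1_seq i)// hl2Z basisE eqxx mulr1/=.
    rewrite big1 ?addr0 ?expr2// => j /negPf ji.
    by rewrite hl2Z basisE eq_sym ji mulr0.
  rewrite -[leLHS]/(\sum_(i <- s) c i ^+ 2).
  have := cauchy_schwarz (T x) y; have := TM x; rewrite xy xx.
  have := ip_ge0 y; have : 0 <= \sum_(i <- s) c i ^+ 2.
    by apply: sumr_ge0 => i _; exact: sqr_ge0.
  move: (\sum_(i <- s) _) (ip y y) (ip (T x) (T x)) => a t r s0 t0 h1 h2.
  have [->|sn0] := eqVneq a 0; first exact: mulr_ge0.
  have sp : 0 < a by rewrite lt_neqAle eq_sym sn0.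
  rewrite -(ler_pM2l sp) -expr2; apply: le_trans h2 _.
  by rewrite mulrA (mulrC a M) ler_wpM2r.
exists (fun y => Hl2 (SH y)) => x y; set S := Hl2 (SH y).
have trunc_eq s : ip (T (trunc s x)) y = ip (trunc s x) S.
  by rewrite ip_trunc Tsum ip_suml; apply: eq_bigr => i _; rewrite ipZl.
have split s : ip (T x) y - ip x S = ip (T (x - trunc s x)) y - ip (x - trunc s x) S.
  have -> : T (x - trunc s x) = T x - T (trunc s x).
    by rewrite addrC -scaleN1r Tl scaleN1r addrC.
  by rewrite !ipBl trunc_eq; ring.
apply/eqP; rewrite -subr_eq0 -sqrf_eq0 eq_le sqr_ge0 andbT.
apply/ler_addgt0Pr => e e0; rewrite add0r.
pose K := 2 * (M * ip y y + ip S S) + 1.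
have K0 : 0 < K.
  by have := ip_ge0 S; have := mulr_ge0 M0 (ip_ge0 y); rewrite /K; lra.
have [s us xs] := trunc_approx x (divr_gt0 e0 K0).
rewrite (split s); move: xs; set d := x - trunc s x; rewrite ler_pdivlMr// => xs.
have h1 := cauchy_schwarz (T d) y; have h2 := cauchy_schwarz d S.
have h3 : ip (T d) y ^+ 2 <= ip d d * (M * ip y y).
  apply: le_trans h1 _; rewrite mulrA (mulrC _ M).
  by apply: ler_wpM2r; [exact: ip_ge0|exact: TM].
apply: le_trans xs; rewrite mulrC; apply: sqrB_le_bound => //; exact: ip_ge0.
Qed.

End AdjointExistence.

(** * The rank inequality *)

Section PositiveContractions.
Variables (R : realType) (X : choiceType).
Implicit Types (A : hl2 R X -> hl2 R X).

(** [A - A^2 = (1 - A) A (1 - A) + A (1 - A) A] is a sum of two positive operators. *)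
Lemma pos_contraction_sqr A x : (forall x y, ip (A x) y = ip x (A y)) ->
  (forall x, 0 <= ip (A x) x <= ip x x) -> ip (A x) (A x) <= ip (A x) x.
Proof.
move=> Asym Apos; have /andP[] := Apos (x - A x).
rewrite (adjointB _ _ Asym) ipBl !ipBr => h _; have /andP[_] := Apos (A x).
by move: h; rewrite (Asym (A x) x); lra.
Qed.

End PositiveContractions.

Section NewtonStep.
Variables (R : realType) (X Y : choiceType).
Variables (T : hl2 R X -> hl2 R Y) (S : hl2 R Y -> hl2 R X).
Hypotheses (TS : adjoint T S) (T1 : bounded_by T 1).

Definition defect x := x - S (T x).

(** The map [T (3 - T^* T) / 2] together with its adjoint; it fixes partial isometries. *)
Definition newton_step :=
  (fun x => 2^-1 *: (3 *: T x - T (S (T x))),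
   fun z => 2^-1 *: (3 *: S z - S (T (S z)))).

Lemma defect_sym x y : ip (defect x) y = ip x (defect y).
Proof. by rewrite ipBl ipBr -TS (adjointC TS). Qed.

Lemma defect_pos x : 0 <= ip (defect x) x <= ip x x.
Proof.
rewrite ipBl (adjointC TS); have := ip_ge0 (T x); have := T1 x.
by rewrite mul1r; lra.
Qed.

Lemma newton_step_adjoint : adjoint newton_step.1 newton_step.2.
Proof.
move=> x z /=; rewrite ipZl ipZr ipBl ipBr ipZl ipZr TS.
by rewrite TS (adjointC TS) TS.
Qed.

(** With [c] the defect of [T], this is the identity [1 - (1 - c) (2 + c)^2 / 4 = (3 c^2 + c^3) /
    4]. *)
Lemma newton_step_defect x : x - newton_step.2 (newton_step.1 x) =
  4^-1 *: (3 *: defect (defect x) + defect (defect (defect x))).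
Proof.
have ST := adjointC TS.
rewrite /newton_step /defect /=.
rewrite !(adjointZ _ _ ST, adjointB _ _ ST, adjointZ _ _ TS, adjointB _ _ TS).
move: (S (T x)) (S (T (S (T x)))) (S (T (S (T (S (T x)))))) => a b c.
by apply: hl2P => i; rewrite !(hl2D, hl2N, hl2Z); field.
Qed.

End NewtonStep.

Section NewtonSequence.
Variables (R : realType) (X Y : choiceType).
Variables (T : hl2 R X -> hl2 R Y) (S : hl2 R Y -> hl2 R X).
Hypotheses (TS : adjoint T S) (T1 : bounded_by T 1).

(* The Newton-Schulz iteration converges to the partial isometry of the polar
   decomposition of [T]; it replaces the functional calculus. *)
Definition newton k := iter k (fun p => newton_step p.1 p.2) (T, S).

Let cc k := defect (newton k).1 (newton k).2.

Lemma newton_defectS k x :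
  ip (cc k.+1 x) x =
  4^-1 * (3 * ip (cc k x) (cc k x) + ip (cc k (cc k x)) (cc k x)).
Proof.
have : adjoint (newton k).1 (newton k).2.
  by elim: k => // k IH; exact: newton_step_adjoint.
move=> a; rewrite /cc /= /defect -/(defect _ _ _) newton_step_defect//.
rewrite -![_ - _]/(defect _ _ _) ipZl ipDl ipZl.
by rewrite (defect_sym a _ x) (defect_sym a (defect _ _ (defect _ _ _)) x).
Qed.

(** The last clause keeps the range of every iterate inside the range of [T], which
    [rank_inequality] relies on. *)
Lemma newton_spec k :
  [/\ adjoint (newton k).1 (newton k).2, bounded_by (newton k).1 1
    & exists g, forall x, (newton k).1 x = T (g x)].
Proof.
elim: k => [|k [a b [g yg]]]; first by split=> //; exists id.
have a' : adjoint (newton k.+1).1 (newton k.+1).2 by exact: newton_step_adjoint.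
split=> // [x|]; last first.
  exists (fun x => 2^-1 *: (3 *: g x - g ((newton k).2 ((newton k).1 x)))) => x /=.
  by rewrite !yg (adjointZ _ _ TS) (adjointB _ _ TS) (adjointZ _ _ TS).
have := newton_defectS k x; rewrite {1}/cc /defect ipBl (adjointC a').
have := ip_ge0 (cc k x); have /andP[] := defect_pos a b (cc k x).
rewrite -/(cc k _) mul1r; lra.
Qed.

Let cc_pos k x : 0 <= ip (cc k x) x <= ip x x.
Proof. by have [a b _] := newton_spec k; exact: defect_pos. Qed.

Let cc_sym k x y : ip (cc k x) y = ip x (cc k y).
Proof. by have [a b _] := newton_spec k; exact: defect_sym. Qed.

Let cc_dec k x : ip (cc k.+1 x) x <= ip (cc k x) x.
Proof.
have := pos_contraction_sqr x (cc_sym k) (cc_pos k).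
by have := cc_pos k (cc k x); rewrite newton_defectS; lra.
Qed.

Let cc_mon k l x : (k <= l)%N -> ip (cc l x) x <= ip (cc k x) x.
Proof.
by move=> /subnK <-; elim: (l - k)%N => // n; apply: le_trans; exact: cc_dec.
Qed.

Lemma ortho_rangeP x : ortho (range S) x <-> T x = 0.
Proof.
split=> [kx|Tx _ [y _ <-]]; last by rewrite -TS Tx ip0l.
by apply: ip_inj => z; rewrite TS kx ?ip0l//; exists z.
Qed.

(** The defects decrease and are positive, so [cc k x] converges to some [z]. The defects fix the
    kernel of [T], and [z] lies in it, so [z] is the projection of [x] onto the kernel. *)
Lemma newton_cvg x e : 0 < e -> exists N, forall k, (N <= k)%N ->
  ip (cc k x) x <= ip (oproj (range S) x) x + e.
Proof.
have tc := nonincreasing_cauchy (fun k => proj1 (andP (cc_pos k x))) (cc_dec^~ x).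
have cB k l : (k <= l)%N ->
    ip (cc k x - cc l x) (cc k x - cc l x) <= ip (cc k x) x - ip (cc l x) x.
  move=> kl; rewrite -ipBl.
  apply: (@pos_contraction_sqr _ _ (fun z => cc k z - cc l z)) => [u v|u].
    by rewrite ipBl ipBr !cc_sym.
  have := cc_mon u kl; have := cc_pos k u; have := cc_pos l u.
  by rewrite ipBl; lra.
have cu : hl2_cauchy (fun k => cc k x).
  move=> e' /tc[N tN]; exists N => m n Nm Nn.
  have [mn|/ltnW nm] := leqP m n.
    by have := cB _ _ mn; have := tN _ _ Nm mn; lra.
  rewrite -opprB ipNl ipNr opprK.
  by have := cB _ _ nm; have := tN _ _ Nn nm; lra.
have [z uz] := hl2_complete cu.
have Tz : T z = 0.
  apply: ip_eq0_le => e' e'0; have e2 : 0 < e' / 16 by lra.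
  have [[N tN] [M zM]] := (tc _ e2, uz _ e2).
  pose k := maxn N M.
  have h1 := tN _ _ (leq_maxl N M : (N <= k)%N) (leqnSn k).
  have h2 := zM _ (leq_maxr N M : (M <= k)%N).
  (* As [cc k <= cc 0], the left side is at most the form of [c^2 - c^3] with [c = cc k], and
     [c - (3 c^2 + c^3) / 4 >= (c^2 - c^3) / 4] because [c^2 <= c]. *)
  have h3 : ip (T (cc k x)) (T (cc k x)) <= 4 * (ip (cc k x) x - ip (cc k.+1 x) x).
    have c0 u : ip (cc 0 u) u = ip u u - ip (T u) (T u).
      by rewrite /cc /defect/= ipBl (adjointC TS).
    have := cc_mon (cc k x) (leq0n k); rewrite newton_defectS c0.
    by have := pos_contraction_sqr x (cc_sym k) (cc_pos k); lra.
  have -> : T z = T (cc k x) - T (cc k x - z).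
    by rewrite (adjointB (cc k x) z TS) opprB addrC subrK.
  have := ipD_le (T (cc k x)) (- T (cc k x - z)); rewrite [X in _ + 2 * X]ipNl ipNr opprK.
  by have := T1 (cc k x - z); rewrite mul1r; lra.
have kz : ortho (range S) z by apply/ortho_rangeP.
have Ez : oproj (range S) x = z.
  apply: oproj_uniq => // v /ortho_rangeP Tv.
  apply/eqP; rewrite -sqrf_eq0 eq_le sqr_ge0 andbT.
  apply/ler_addgt0Pr => e' e'0; rewrite add0r.
  have v1 : 0 < ip v v + 1 by have := ip_ge0 v; lra.
  have [N zN] := uz _ (divr_gt0 e'0 v1).
  have cv : cc N v = v.
    have [_ _ [g yg]] := newton_spec N; have [a _ _] := newton_spec N.
    rewrite /cc /defect; have -> : (newton N).1 v = 0.
      elim: (N) => //= n IH; rewrite IH.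
      have [b _ _] := newton_spec n.
      by rewrite (adjoint0 (adjointC b)) (adjoint0 b) scaler0 subr0 scaler0.
    by rewrite (adjoint0 (adjointC a)) subr0.
  have -> : ip (x - z) v = ip (cc N x - z) v by rewrite (ipBl x z) (ipBl (cc N x) z) cc_sym cv.
  apply: le_trans (cauchy_schwarz _ _) _.
  have := zN _ (leqnn N); rewrite ler_pdivlMr//.
  by have := ip_ge0 (cc N x - z); nra.
move=> e0; have x1 : 0 < ip x x + 1 by have := ip_ge0 x; lra.
have [N zN] := uz _ (divr_gt0 (exprn_gt0 2 e0) x1).
exists N => k Nk; rewrite Ez -lerBlDl -ipBl.
suff : `|ip (cc k x - z) x| <= e by rewrite ler_norml; lra.
apply: normr_le_sqr (ltW e0) _; apply: le_trans (cauchy_schwarz _ _) _.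
have := zN _ Nk; rewrite ler_pdivlMr//.
by have := ip_ge0 (cc k x - z); nra.
Qed.

(** The limit of the iteration is isometric on the orthogonal complement of the kernel; this
    inequality is all that is used of it. *)
Lemma newton_norm_cvg x e : 0 < e -> exists N, forall k, (N <= k)%N ->
  ip (x - oproj (range S) x) (x - oproj (range S) x) <=
  ip ((newton k).1 x) ((newton k).1 x) + e.
Proof.
move=> /newton_cvg-/(_ x)[N cN]; exists N => k Nk.
have [a _ _] := newton_spec k.
by have := cN _ Nk; rewrite ip_oprojB ip_oproj /cc /defect ipBl (adjointC a); lra.
Qed.

End NewtonSequence.

(** * Pullbacks and right translations *)

Section Pullback.
Variables (R : realType) (X Y : choiceType).
Implicit Types (e : X -> Y) (f g : hl2 R Y).

(* Junk value: [0] when [f \o e] is not square summable. *)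
Definition pull e f : hl2 R X := insubd 0 (fun x => f (e x) : R^o).

Lemma pull_proof e f : injective e ->
  (fun x => f (e x) : R^o) \in @sq_summable R X.
Proof.
move=> ie; apply: (@sq_summable_bounded _ _ _ (ip f f)) => s us.
rewrite -(big_map e xpredT (fun y => f y ^+ 2)).
by rewrite ip_ge_sum// map_inj_uniq.
Qed.

Lemma pullE e f x : injective e -> pull e f x = f (e x).
Proof. by move=> ie; rewrite /hl2_fun insubdK//; exact: pull_proof. Qed.

Lemma pull_bounded e : injective e -> bounded_by (pull e) 1.
Proof.
move=> ie f; rewrite mul1r; apply: ip_le_bound => s us.
under eq_bigr do rewrite pullE//.
rewrite -(big_map e xpredT (fun y => f y ^+ 2)).
by rewrite ip_ge_sum// map_inj_uniq.
Qed.

Lemma pull_linear e c f g : injective e ->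
  pull e (c *: f + g) = c *: pull e f + pull e g.
Proof. by move=> ie; apply: hl2P => x; rewrite hl2D hl2Z !pullE// hl2D hl2Z. Qed.

End Pullback.

Lemma pull_adjoint (R : realType) (X Y : choiceType) (e : X -> Y) (e' : Y -> X) :
  cancel e e' -> cancel e' e -> adjoint (@pull R _ _ e) (pull e').
Proof.
move=> ee' e'e; have ie := can_inj ee'; have ie' := can_inj e'e.
have pK (f : hl2 R Y) : pull e' (pull e f) = f.
  by apply: hl2P => y; rewrite !pullE// e'e.
have pK' (f : hl2 R X) : pull e (pull e' f) = f.
  by apply: hl2P => y; rewrite !pullE// ee'.
have iso (f : hl2 R Y) : ip (pull e f) (pull e f) = ip f f.
  apply/eqP; rewrite eq_le; have := pull_bounded ie f; rewrite mul1r => -> /=.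
  by have := pull_bounded ie' (pull e f); rewrite mul1r pK.
have isoD (f g : hl2 R Y) : ip (pull e f) (pull e g) = ip f g.
  have pD : pull e (f + g) = pull e f + pull e g.
    by rewrite -{1}[f]scale1r pull_linear// scale1r.
  have := iso (f + g); rewrite pD.
  rewrite !(ipDl, ipDr) !iso.
  by rewrite (ipC (pull e g)) (ipC g); lra.
by move=> f g; rewrite -{1}(pK' g) isoD.
Qed.

Lemma pull_basis (R : realType) (X Y : choiceType) (e : X -> Y) (e' : Y -> X) y :
  cancel e e' -> cancel e' e -> pull e (basis R y) = basis R (e' y).
Proof.
move=> ee' e'e; apply: hl2P => x; rewrite pullE ?basisE; last exact: can_inj ee'.
by rewrite (can2_eq ee' e'e).
Qed.

Section RightTranslation.
Variables (R : realType) (G : groupType).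

Definition rgt (I : choiceType) (g : G) : hl2 R (I * G)%type -> hl2 R (I * G)%type :=
  pull (fun x => (x.1, (x.2 * g)%g)).

Section One.
Variable I : choiceType.
Implicit Types (f : hl2 R (I * G)%type) (g : G).

Let rK g : cancel (fun x : I * G => (x.1, (x.2 * g)%g)) (fun x => (x.1, (x.2 * g^-1)%g)).
Proof. by case=> i h /=; rewrite mulgK. Qed.
Let rK' g : cancel (fun x : I * G => (x.1, (x.2 * g^-1)%g)) (fun x => (x.1, (x.2 * g)%g)).
Proof. by case=> i h /=; rewrite mulgVK. Qed.

Lemma rgtE g f i h : rgt g f (i, h) = f (i, (h * g)%g).
Proof. by rewrite pullE//; exact: can_inj (rK g). Qed.

Lemma rgt_adjoint g : adjoint (@rgt I g) (@rgt I g^-1%g).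
Proof. exact: pull_adjoint (rK g) (rK' g). Qed.

Lemma rgt_basis g (i : I) h : rgt g (basis R (i, h)) = basis R (i, (h * g^-1)%g).
Proof. exact: pull_basis (rK g) (rK' g). Qed.

Lemma rgtB g f f' : rgt g (f - f') = rgt g f - rgt g f'.
Proof. exact: adjointB (rgt_adjoint g). Qed.

Lemma rgtZ g c f : rgt g (c *: f) = c *: rgt g f.
Proof. exact: adjointZ (rgt_adjoint g). Qed.

End One.

(** Bounded operators of this kind are the real counterpart of matrices over the group von Neumann
    algebra. *)
Definition equivariant (I J : choiceType)
    (T : hl2 R (I * G)%type -> hl2 R (J * G)%type) :=
  forall g f, T (rgt g f) = rgt g (T f).

Lemma adjoint_equivariant (I J : choiceType)
    (T : hl2 R (I * G)%type -> hl2 R (J * G)%type) S :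
  adjoint T S -> equivariant T -> equivariant S.
Proof.
move=> TS Te g f; apply: ip_inj => h.
by rewrite (adjointC TS) !rgt_adjoint -Te (adjointC TS).
Qed.

End RightTranslation.

Section Rank.
Variables (R : realType) (G : groupType) (I J : choiceType).
Variables (T : hl2 R (I * G)%type -> hl2 R (J * G)%type).
Variables (S : hl2 R (J * G)%type -> hl2 R (I * G)%type).

Lemma esum_pairs (I' : choiceType) (u : I' * G -> R) : (forall x, 0 <= u x) ->
  (\esum_(x in [set: I' * G]) (u x)%:E =
   \esum_(i in [set: I']) \esum_(g in [set: G]) (u (i, g))%:E)%E.
Proof.
move=> u0; rewrite (@esum_esum _ _ _ setT (fun=> setT) (fun i g => (u (i, g))%:E)).
  rewrite (_ : [set: I'] `*`` _ = [set: I' * G]).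
    by apply: eq_esum => -[].
  by apply/seteqP; split.
by move=> i g _ _; rewrite lee_fin.
Qed.

(** The trace property: by equivariance the coefficient of [T (basis R (i, 1))] at [(j, g)] is that
    of [S (basis R (j, 1))] at [(i, g^-1)], so both sides sum the same squares. *)
Lemma hilbert_schmidt (s : seq I) : adjoint T S -> equivariant T -> uniq s ->
  ((\sum_(i <- s) ip (T (basis R (i, 1%g))) (T (basis R (i, 1%g))))%:E <=
   \esum_(j in [set: J]) (ip (S (basis R (j, 1%g))) (S (basis R (j, 1%g))))%:E)%E.
Proof.
move=> TS Te us.
have coef i j g : T (basis R (i, 1%g)) (j, g) = S (basis R (j, 1%g)) (i, (g^-1)%g).
  have := rgtE g (T (basis R (i, 1%g))) j 1%g; rewrite mul1g => <-.
  by rewrite -Te rgt_basis mul1g -ip_basis TS ipC ip_basis.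
rewrite -sumEFin.
under eq_bigr => i _.
  rewrite ipE (esum_pairs (u := fun x => T (basis R (i, 1%g)) x ^+ 2)); last first.
    by move=> x; exact: sqr_ge0.
  under eq_esum => j _ do under eq_esum => g _ do rewrite coef.
  over.
rewrite -esum_sum; last by move=> j i _ _; apply: esum_ge0 => g _; rewrite lee_fin sqr_ge0.
apply: le_esum => j _; rewrite ipE.
rewrite (esum_pairs (u := fun x => S (basis R (j, 1%g)) x ^+ 2)); last first.
  by move=> x; exact: sqr_ge0.
apply: le_trans (esum_ge_uniq _ us); last first.
  by move=> i; apply: esum_ge0 => g _; rewrite lee_fin sqr_ge0.
apply: lee_sum => i _.
rewrite [leRHS](@reindex_esum _ _ _ setT setT (fun g : G => (g^-1)%g))//.
by split=> // [g h _ _ /invg_inj|g _]//; exists (g^-1)%g; rewrite ?invgK.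
Qed.

End Rank.

Section RankInequality.
Variables (R : realType) (G : groupType) (I J : choiceType).
Variables (T : hl2 R (I * G)%type -> hl2 R (J * G)%type).
Variables (S : hl2 R (J * G)%type -> hl2 R (I * G)%type).
Hypotheses (TS : adjoint T S) (T1 : bounded_by T 1) (Te : equivariant T).

Lemma newton_equivariant k :
  equivariant (newton T S k).1 /\ equivariant (newton T S k).2.
Proof.
elim: k => [|k [IH1 IH2]]; first by split=> //=; exact: adjoint_equivariant Te.
by split=> g f /=; rewrite !(IH1, IH2) -rgtZ -rgtB -rgtZ.
Qed.

(* The vector [pi j] stands for the projection of a basis vector onto a subspace
   containing the range of [T]. *)
Lemma rank_inequality (pi : J -> hl2 R (J * G)%type) (s : seq I) :
  (forall j x, T x (j, 1%g) = ip (pi j) (T x)) -> uniq s ->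
  ((\sum_(i <- s) ip (basis R (i, 1%g) - oproj (range S) (basis R (i, 1%g)))
                     (basis R (i, 1%g) - oproj (range S) (basis R (i, 1%g))))%:E <=
   \esum_(j in [set: J]) (ip (pi j) (pi j))%:E)%E.
Proof.
move=> piT us; apply/lee_addgt0Pr => e e0.
have d0 : 0 < e / (size s).+1%:R by rewrite divr_gt0.
have [k kP] : exists k, forall i, i \in s ->
    ip (basis R (i, 1%g) - oproj (range S) (basis R (i, 1%g)))
       (basis R (i, 1%g) - oproj (range S) (basis R (i, 1%g))) <=
    ip ((newton T S k).1 (basis R (i, 1%g))) ((newton T S k).1 (basis R (i, 1%g)))
      + e / (size s).+1%:R.
  move: (e / _) d0 => d d0.
  have [N NP] : exists N, forall k, (N <= k)%N -> forall i, i \in s ->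
    ip (basis R (i, 1%g) - oproj (range S) (basis R (i, 1%g)))
       (basis R (i, 1%g) - oproj (range S) (basis R (i, 1%g))) <=
    ip ((newton T S k).1 (basis R (i, 1%g))) ((newton T S k).1 (basis R (i, 1%g))) + d.
    elim: (s) => [|i s' [N NP]]; first by exists 0%N.
    have [M MP] := newton_norm_cvg TS T1 (basis R (i, 1%g)) d0.
    exists (maxn N M) => k; rewrite geq_max => /andP[Nk Mk] j.
    by rewrite inE => /predU1P[->|]; [exact: MP|exact: NP].
  by exists N; exact: NP.
have [a b [g yg]] := newton_spec TS T1 k.
have [ye ze] := newton_equivariant k.
have b' := adjoint_bounded a ler01 b.
apply: (@le_trans _ _ ((\sum_(i <- s) ip ((newton T S k).1 (basis R (i, 1%g)))
   ((newton T S k).1 (basis R (i, 1%g))))%:E + e%:E)%E).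
  rewrite -EFinD lee_fin.
  apply: (@le_trans _ _ (\sum_(i <- s)
    (ip ((newton T S k).1 (basis R (i, 1%g))) ((newton T S k).1 (basis R (i, 1%g)))
      + e / (size s).+1%:R))).
    by rewrite big_seq [leRHS]big_seq; apply: ler_sum => i; exact: kP.
  rewrite big_split/= lerD2l big_const_seq count_predT iter_addr_0.
  by rewrite -(mulr_natr (e / _)) mulrAC ler_pdivrMr ?ltr0n// ler_pM2l// ler_nat.
rewrite leeD2r//; apply: le_trans (hilbert_schmidt a ye us) _.
apply: le_esum => j _; rewrite lee_fin.
set y := (newton T S k).1 in yg a b ye b' *; set z := (newton T S k).2 in a b' ze *.
set bj := basis R (j, 1%g).
(* [y] maps into the range of [T], where [bj] and [pi j] read off the same coordinate. Hence the
   squared norm of [z bj] is its inner product with [z (pi j)], and Cauchy-Schwarz compares the two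
   norms. *)
have zz : ip (z bj) (z bj) = ip (z (pi j)) (z bj).
  by rewrite !(adjointC a) yg -piT ipC ip_basis.
have := cauchy_schwarz (z (pi j)) (z bj); rewrite -zz; have := b' (pi j).
have := ip_ge0 (z bj); rewrite mul1r.
move: (ip (z bj) (z bj)) (ip (z (pi j)) (z (pi j))) => s' t s0 h1 h2.
have [->|sn0] := eqVneq s' 0; first exact: ip_ge0.
have sp : 0 < s' by rewrite lt_neqAle eq_sym sn0.
by apply: le_trans h1; rewrite -(ler_pM2r sp) -expr2.
Qed.

End RankInequality.

(** * Injectivity of integral matrices on square summable functions *)

Section SpectralCount.
Variables (R : realType) (d : nat).
Implicit Types (A : 'M[R]_d).

Lemma conj_mx_exp (F : fieldType) (P M : 'M[F]_d) m : P \in unitmx ->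
  (invmx P *m M *m P) ^+ m = invmx P *m (M ^+ m) *m P.
Proof.
move=> Pu; elim: m => [|m IH]; first by rewrite !expr0 mulmx1 mulVmx.
by rewrite !exprS IH -!mulmxE !mulmxA mulmxK.
Qed.

Lemma diag_mx_exp (F : fieldType) (v : 'rV[F]_d) m :
  diag_mx v ^+ m = diag_mx (\row_i (v 0 i ^+ m)).
Proof.
elim: m => [|m IH].
  rewrite expr0; apply/matrixP => i j; rewrite !mxE expr0.
  by case: eqP.
rewrite exprS IH -mulmxE mul_diag_mx; apply/matrixP => i j; rewrite !mxE.
by case: eqP => [->|_]; rewrite ?mulr1n ?mulr0n ?mulr0// -exprS.
Qed.

(* Since the product of the [t i] is at least [K ^- d], at most [d / j] of them lie
   below [K ^- j]. *)
Lemma eigenvalue_count (t : 'I_d -> R) (K : R) j m : (0 < j)%N -> 1 < K ->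
  (forall i, 0 < t i <= 1) -> 1 <= K ^+ d * \prod_i t i ->
  \sum_i (1 - t i) ^+ m <= d%:R * (1 - K ^- j) ^+ m + d%:R / j%:R.
Proof.
move=> j0 K1 t01 Kt; set s := K ^- j.
have K0 : 0 < K by apply: lt_trans K1; exact: ltr01.
have s0 : 0 < s by rewrite invr_gt0 exprn_gt0.
have s1 : s <= 1 by rewrite invf_le1 ?exprn_gt0// exprn_ege1// ltW.
pose r := #|[pred i | t i < s]|.
have prod_le : \prod_i t i <= s ^+ r.
  rewrite (bigID [pred i | t i < s])/=.
  apply: (@le_trans _ _ (\prod_(i | t i < s) s * \prod_(i | ~~ (t i < s)) 1)).
    apply: ler_pM.
    - by apply: prodr_ge0 => i _; have /andP[/ltW] := t01 i.
    - by apply: prodr_ge0 => i _; have /andP[/ltW] := t01 i.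
    - by apply: ler_prod => i si; have /andP[/ltW -> _] := t01 i; exact: ltW.
    - by apply: ler_prod => i si; have /andP[/ltW -> ->] := t01 i.
  by rewrite prodr_const big1// mulr1.
have rd : (r * j <= d)%N.
  rewrite -(@ler_eXn2l _ K)//.
  have : 1 <= K ^+ d * s ^+ r.
    by apply: le_trans Kt _; rewrite ler_pM2l ?exprn_gt0.
  by rewrite /s exprVn -exprM mulnC ler_pdivlMr ?exprn_gt0// mul1r.
have sum_le : \sum_i (1 - t i) ^+ m <= \sum_(i < d) (1 - s) ^+ m + r%:R.
  have -> : r%:R = \sum_(i < d) (t i < s)%R%:R :> R.
    rewrite -natr_sum; congr _%:R; rewrite /r -sum1_card big_mkcond/=.
    by apply: eq_bigr => i _; rewrite inE; case: (_ < _)%R.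
  rewrite -big_split; apply: ler_sum => i _ /=.
  have /andP[ti0 ti1] := t01 i.
  have [ts|ts] := leP s (t i).
    by rewrite addr0 lerXn2r// ?nnegrE; lra.
  apply: (@le_trans _ _ 1); first by apply: exprn_ile1; lra.
  by rewrite lerDr exprn_ge0// subr_ge0.
apply: le_trans sum_le _; rewrite sumr_const card_ord -(mulr_natl (_ ^+ m)) lerD2l.
by rewrite ler_pdivlMr ?ltr0n// -natrM ler_nat.
Qed.

(** The spectral theorem is applied to the complexification. Its eigenvalues are real, and the real
    or the imaginary part of an eigenvector is a nonzero real one, to which the hypothesis applies;
    dividing by [K] brings the eigenvalues into the range of [eigenvalue_count]. *)
Lemma symmetric_trace_bound A (K : R) j m : (0 < j)%N -> 1 < K -> A^T = A ->
  (forall lam (x : 'rV[R]_d), x != 0 -> x *m A = lam *: x -> 0 < lam <= K) ->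
  1 <= `|\det A| ->
  \tr ((1%:M - K^-1 *: A) ^+ m) <= d%:R * (1 - K ^- j) ^+ m + d%:R / j%:R.
Proof.
move=> j0 K1 Asym Aeig detA.
have K0 : 0 < K by apply: lt_trans K1; exact: ltr01.
pose Ac := map_mx (real_complex R) A.
have Aherm : Ac \is hermsymmx.
  apply: realsym_hermsym; last first.
    by apply/mxOverP => i k; rewrite mxE complex_real.
  apply/is_hermitianmxP; rewrite expr0 scale1r; apply/matrixP => i k.
  by rewrite !mxE -[in LHS]Asym mxE.
have /orthomx_spectralP Aspec := hermitian_normalmx Aherm.
have Preal := hermitian_spectral_diag_real Aherm.
move: Aspec Preal (spectral_unit Ac).
set P := spectralmx Ac; set D := spectral_diag Ac => Aspec Dreal Pu.
pose mu i := complex.Re (D 0 i).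
have Dmu i : D 0 i = (mu i)%:C%C.
  by rewrite RRe_real//; have /mxOverP := Dreal; apply.
have PA : P *m Ac = diag_mx D *m P.
  by rewrite [X in P *m X]Aspec !mulmxA mulmxV// mul1mx.
have mu_bnd i : 0 < mu i <= K.
  have rowA : row i P *m Ac = (mu i)%:C%C *: row i P.
    rewrite -row_mul PA mul_diag_mx; apply/rowP => k; rewrite !mxE.
    by rewrite Dmu.
  have row0 : row i P != 0.
    apply/negP => /eqP rP0; have := mulmxV Pu => /(congr1 (fun M => row i M)).
    rewrite row_mul rP0 mul0mx => /rowP/(_ i)/eqP; rewrite !mxE eqxx.
    by rewrite eq_sym oner_eq0.
  have reE (x : 'rV[R[i]]_d) k : (x *m Ac) 0 k =
      ((\sum_l complex.Re (x 0 l) * A l k) +i* (\sum_l complex.Im (x 0 l) * A l k))%C.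
    rewrite mxE; elim/big_rec3: _ => // l a b c _ ->; rewrite !mxE.
    by case: (x 0 l) => u v /=; congr (_ +i* _)%C => /=; ring.
  pose x := \row_k complex.Re (P i k); pose y := \row_k complex.Im (P i k).
  have xA : x *m A = mu i *: x.
    apply/rowP => k; have /rowP/(_ k) := rowA; rewrite reE !mxE.
    case: (P i k) => u v /= [h _]; rewrite mul0r subr0 in h.
    by rewrite -h; apply: eq_bigr => l _; rewrite !mxE.
  have yA : y *m A = mu i *: y.
    apply/rowP => k; have /rowP/(_ k) := rowA; rewrite reE !mxE.
    case: (P i k) => u v /= [_ h]; rewrite mul0r addr0 in h.
    by rewrite -h; apply: eq_bigr => l _; rewrite !mxE.
  have [x0|x0] := eqVneq x 0; last exact: Aeig x0 xA.
  have [y0|y0] := eqVneq y 0; last exact: Aeig y0 yA.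
  exfalso; move/negP: row0; apply; apply/eqP/rowP => k; rewrite !mxE.
  have /rowP/(_ k) := x0; have /rowP/(_ k) := y0; rewrite !mxE.
  by case: (P i k) => u v /= -> ->.
have detE : (\det A)%:C%C = \prod_i (mu i)%:C%C.
  rewrite -det_map_mx -/Ac Aspec !det_mulmx mulrAC -det_mulmx mulVmx// det1 mul1r.
  by rewrite det_diag; apply: eq_bigr.
have detR : \det A = \prod_i mu i.
  by apply: complexI; rewrite detE rmorph_prod.
have trE : \tr ((1%:M - K^-1 *: A) ^+ m) = \sum_i (1 - mu i / K) ^+ m.
  apply: complexI; rewrite -[LHS]trace_map_mx [RHS]rmorph_sum/= rmorphXn/=.
  have -> : map_mx (real_complex R) (1%:M - K^-1 *: A) =
      invmx P *m diag_mx (\row_i (1 - mu i / K)%:C%C) *m P.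
    have -> : diag_mx (\row_i (1 - mu i / K)%:C%C) =
        1%:M - (K^-1)%:C%C *: diag_mx D.
      apply/matrixP => k l; rewrite !mxE Dmu.
      case: eqP => [->|_]; last by rewrite !mulr0n mulr0 subr0.
      by rewrite !mulr1n rmorphB rmorph1 rmorphM mulrC.
    rewrite mulmxBr mulmxBl mulmx1 mulVmx// -scalemxAr -scalemxAl -Aspec.
    by rewrite raddfB/= map_mx1 map_mxZ.
  rewrite conj_mx_exp// mxtrace_mulC mulmxA mulmxV// mul1mx diag_mx_exp.
  by rewrite mxtrace_diag; apply: eq_bigr => i _; rewrite !mxE rmorphXn.
rewrite trE; apply: eigenvalue_count => // [i|].
  by have /andP[m0 mK] := mu_bnd i; rewrite divr_gt0// ler_pdivrMr// mul1r.
rewrite big_split/= prodr_const card_ord exprVn mulrCA mulfV ?mulr1.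
  move: detA; rewrite detR ger0_norm// prodr_ge0// => i _.
  by have /andP[/ltW] := mu_bnd i.
by rewrite expf_neq0// gt_eqF.
Qed.

End SpectralCount.

(** * Normal generation and finite p-quotients *)

Section NormalGeneration.
Variable G : groupType.
Implicit Types (S : set G) (N : set G).
Local Open Scope group_scope.

Lemma normally_generated_all S N : normally_generated S ->
  normal_subgroup N -> S `<=` N -> forall g, N g.
Proof.
move=> gS nN SN g; have : [set: G] g by [].
by rewrite -gS; exact: smallest_sub.
Qed.

(** The elements lying in the normal closure of some finite part of [S] form a normal subgroup
    containing [S], hence are all of [G]. *)
Lemma finite_normal_generators S (l : seq G) : normally_generated S ->
  exists2 s : seq G, (forall g, g \in s -> S g)
    & forall N, normal_subgroup N -> (forall g, g \in s -> N g) ->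
        forall g, g \in l -> N g.
Proof.
move=> gS; pose T := [set g : G | exists2 s : seq G, (forall h, h \in s -> S h)
    & forall N, normal_subgroup N -> (forall h, h \in s -> N h) -> N g].
have nT : normal_subgroup T.
  split.
  - by exists [::] => // N [].
  - move=> x y [s sS sN] [t tS tN]; exists (s ++ t).
      by move=> h; rewrite mem_cat => /orP[/sS|/tS].
    move=> N nN stN; have [_ NM _ _] := nN; apply: NM.
      by apply: sN => // h hs; apply: stN; rewrite mem_cat hs.
    by apply: tN => // h hs; apply: stN; rewrite mem_cat hs orbT.
  - move=> x [s sS sN]; exists s => // N nN sN'; have [_ _ NV _] := nN.
    by apply: NV; exact: sN.
  - move=> x y [s sS sN]; exists s => // N nN sN'; have [_ _ _ NJ] := nN.
    by apply: NJ; exact: sN.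
have ST : S `<=` T.
  move=> g Sg; exists [:: g] => [h|N nN]; first by rewrite inE => /eqP ->.
  by apply; rewrite inE.
have Tall := normally_generated_all gS nT ST.
elim: l => [|g l [t tS tN]]; first by exists [::].
have [s sS sN] := Tall g; exists (s ++ t).
  by move=> h; rewrite mem_cat => /orP[/sS|/tS].
move=> N nN stN h; rewrite inE => /predU1P[->|hl].
  by apply: sN => // k ks; apply: stN; rewrite mem_cat ks.
by apply: tN => // k ks; apply: stN; rewrite mem_cat ks orbT.
Qed.

End NormalGeneration.

Section FiniteQuotients.
Variables (G : groupType) (p : nat).
Hypothesis p_prime : prime p.
Local Open Scope group_scope.

(** Only the image of [phi] is a [p]-group; [phi] need not be onto, so permutation groups and direct
    products may serve as targets. *)
Record pquotient (gT : finGroupType) (phi : G -> gT) : Prop := PQuotient {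
  pquotM : forall g h, phi (g * h) = phi g * phi h;
  pquotX : forall g, exists e, phi g ^+ (p ^ e)%N = 1 }.

Lemma pquot1 (gT : finGroupType) (phi : G -> gT) : pquotient phi -> phi 1 = 1.
Proof.
by move=> [phiM _]; apply: (mulgI (phi 1)); rewrite -phiM !mulg1.
Qed.

(** [G] acts on the cosets of [H], numbered by ['I_d]. As [H] is normal, a permutation in the image
    is determined by the coset it assigns to [H], so the image has order [d], a power of [p]. *)
Lemma coset_pquotient (H : set G) (k : nat) : normal_subgroup H ->
  (left_cosets H #= `I_(p ^ k)%N)%card ->
  exists (gT : finGroupType) (phi : G -> gT),
    pquotient phi /\ forall g, ~ H g -> phi g <> 1.
Proof.
move=> [H1 HM HV HJ]; set d := (p ^ k)%N => /card_set_bijP[f [fd finj fsurj]].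
pose c x : set G := [set x * h | h in H].
have cc x : left_cosets H (c x) by exists x.
have cE x y : c x = c y <-> H (x^-1 * y).
  split=> [xy|Hxy].
    have : c y y by exists 1; rewrite ?mulg1.
    by rewrite -xy => -[h Hh <-]; rewrite mulKg.
  apply/seteqP; split=> z [h Hh <-].
    exists ((x^-1 * y)^-1 * h); first by apply: HM => //; exact: HV.
    by rewrite invgM invgK !mulgA mulgV mul1g.
  by exists ((x^-1 * y) * h); [exact: HM|rewrite !mulgA mulgV mul1g].
have flt x : (f (c x) < d)%N by have := fd _ (cc x).
pose kap x : 'I_d := Ordinal (flt x).
have kapE x y : kap x = kap y <-> H (x^-1 * y).
  rewrite -cE; split=> [[]|cxy]; last by apply: val_inj; rewrite /= cxy.
  by move=> fxy; apply: finj; rewrite ?inE.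
have kap_surj (i : 'I_d) : exists x, kap x = i.
  have [A [x _ <-] fA] := fsurj i (ltn_ord i).
  by exists x; apply: val_inj.
have [sec secK] := choice kap_surj.
have kapM g x y : kap x = kap y -> kap (g * x) = kap (g * y).
  by rewrite !kapE invgM -mulgA mulKg.
pose act g i := kap (g * sec i).
have actM g h i : act (g * h) i = act g (act h i).
  by rewrite /act -mulgA; apply: kapM; rewrite secK.
have act1 i : act 1 i = i by rewrite /act mul1g secK.
have act_inj g : injective (act g).
  by apply: (can_inj (g := act g^-1)) => i; rewrite -actM mulVg act1.
(* The inverse is needed because products of permutations are composed from left to right. *)
pose phi g : {perm 'I_d} := perm (@act_inj g^-1).
have phiM g h : phi (g * h) = phi g * phi h.
  by apply/permP => i; rewrite permM !permE invgM actM.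
have phi1 : phi 1 = 1 by apply/permP => i; rewrite permE invg1 act1 perm1.
pose Q := [set s : {perm 'I_d} | `[< exists g, s = phi g >]]%SET.
have QP s : reflect (exists g, s = phi g) (s \in Q).
  by rewrite inE; exact: asboolP.
have gQ : group_set Q.
  apply/group_setP; split; first by apply/QP; exists 1.
  by move=> _ _ /QP[g ->] /QP[h ->]; apply/QP; exists (g * h).
have kap_phi g i : phi g i = kap (g^-1 * sec i) by rewrite permE.
have phi_kap g x : phi g (kap x) = kap (g^-1 * x).
  by rewrite kap_phi; apply: kapM; rewrite secK.
have cardQ : #|Group gQ| = d.
  rewrite -[RHS]card_ord -(@card_in_imset _ _ (fun s : {perm 'I_d} => s (kap 1))).
    apply: eq_card => i; rewrite [RHS]inE; apply/imsetP.
    exists (phi (sec i)^-1); first by apply/QP; eexists.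
    by rewrite phi_kap invgK mulg1 secK.
  move=> _ _ /QP[g ->] /QP[h ->]; rewrite !phi_kap !mulg1 => /kapE; rewrite invgK => Hgh.
  apply/permP => i; rewrite !kap_phi; apply/kapE.
  rewrite invgM invgK -mulgA; have := HJ _ (sec i) Hgh.
  by rewrite conjgE !mulgA.
exists {perm 'I_d}, phi; split; first split=> // g.
  exists k; rewrite -/d; have : phi g \in Group gQ by apply/QP; exists g.
  by move=> /expg_cardG; rewrite cardQ.
move=> g nHg phig; apply: nHg.
have := phi_kap g 1; rewrite phig perm1 mulg1 => /kapE; rewrite invg1 mul1g.
by move=> /HV; rewrite invgK.
Qed.

(** One quotient for each element of the list; their product separates all of them from 1. *)
Lemma separating_pquotient (l : seq G) : residually_finite_p G p ->
  (forall g, g \in l -> g != 1) ->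
  exists (gT : finGroupType) (phi : G -> gT),
    pquotient phi /\ forall g, g \in l -> phi g != 1.
Proof.
move=> Gres; elim: l => [|g l IH] l1.
  exists {perm bool}, (fun=> 1); split=> //; split=> [_ _|_]; first by rewrite mulg1.
  by exists 0%N; rewrite expg1n.
have [|gT [phi [pq sep]]] := IH; first by move=> h hl; apply: l1; rewrite inE hl orbT.
have [|H [nH [k Hk] Hg]] := Gres g; first by apply: l1; rewrite inE eqxx.
have [gT' [psi [pq' sep']]] := coset_pquotient nH Hk.
have pairX (x : gT) (y : gT') n : ((x, y) : gT * gT') ^+ n = (x ^+ n, y ^+ n).
  by elim: n => // n IHn; rewrite !expgS IHn.
exists (gT * gT')%type, (fun h => (phi h, psi h)); split; first split.
- by move=> a b; rewrite (pquotM pq) (pquotM pq').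
- move=> a; have [e ae] := pquotX pq a; have [e' ae'] := pquotX pq' a.
  exists (e + e')%N; rewrite pairX expnD expgM ae expg1n.
  by rewrite mulnC expgM ae' expg1n.
move=> h; rewrite inE => /predU1P[->|hl]; apply/negP => /eqP[h1 h2].
  exact: (sep' g).
by have := sep h hl; rewrite h1 eqxx.
Qed.

(* A cocycle with values in functions on a finite p-quotient defines an affine
   action through a finite p-group, and in a p-group a normally generating subset
   generates, since maximal subgroups are normal. *)
Lemma modp_cocycle_eq0 (gT : finGroupType) (phi : G -> gT) (S : set G)
    (c : G -> gT -> 'F_p) :
  pquotient phi -> normally_generated S ->
  (forall g h y, c (g * h) y = (c g y + c h ((phi g)^-1 * y)%g)%R) ->
  (forall s, S s -> forall y, c s y = 0%R) -> forall g y, c g y = 0%R.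
Proof.
move=> pq gS cM cS.
have c1 y : c 1 y = 0%R.
  have := cM 1 1 y; rewrite mulg1 (pquot1 pq) invg1 mul1g.
  by move/eqP; rewrite -subr_eq0 opprD addrA subrr add0r oppr_eq0 => /eqP.
pose M := {ffun gT -> 'F_p}.
pose act g (m : M) : M := [ffun y => (c g y + m ((phi g)^-1 * y)%g)%R].
have actM g h m : act (g * h) m = act g (act h m).
  by apply/ffunP => y; rewrite !ffunE cM (pquotM pq) invgM addrA mulgA.
have act1 m : act 1 m = m.
  by apply/ffunP => y; rewrite !ffunE c1 (pquot1 pq) invg1 mul1g add0r.
have act_inj g : injective (act g).
  by apply: (can_inj (g := act g^-1)) => i; rewrite -actM mulVg act1.
pose psi g : {perm M} := perm (@act_inj g^-1).
have psiM g h : psi (g * h) = psi g * psi h.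
  by apply/permP => i; rewrite permM !permE invgM actM.
have psi1 : psi 1 = 1 by apply/permP => i; rewrite permE invg1 act1 perm1.
have psiV g : psi g^-1 = (psi g)^-1.
  by apply: (mulgI (psi g)); rewrite -psiM !mulgV.
have psiX g n : psi (g ^+ n) = psi g ^+ n.
  by elim: n => // n IH; rewrite !expgS psiM IH.
have phiX g n : phi (g ^+ n) = phi g ^+ n.
  by elim: n => [|n IH]; rewrite ?(pquot1 pq)// !expgS (pquotM pq) IH.
have psi_p g : exists e, psi g ^+ (p ^ e)%N = 1.
  (* [g ^+ (p ^ e)] acts trivially on [gT], hence translates [M] by an ['F_p]-valued function, and
     such a translation has exponent [p]. This accounts for the additional factor. *)
  have [e phie] := pquotX pq g; exists e.+1; rewrite expnSr expgM -psiX.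
  set h := g ^+ _; have phih : phi h = 1 by rewrite phiX.
  have chn n y : c (h ^+ n) y = (c h y *+ n)%R.
    elim: n => [|n IH]; first by rewrite c1.
    by rewrite expgS cM phih invg1 mul1g IH mulrS.
  have -> : psi h ^+ p = psi (h ^+ p) by rewrite psiX.
  suff : act (h ^+ p)^-1 =1 id by move=> E; apply/permP => m; rewrite permE E perm1.
  move=> m; apply: (@act_inj (h ^+ p)); rewrite -actM mulgV act1.
  apply/ffunP => y; rewrite ffunE phiX phih expg1n invg1 mul1g chn.
  by rewrite -mulr_natr pchar_Fp_0 ?mulr0 ?add0r.
pose Q := [set s : {perm M} | `[< exists g, s = psi g >]]%SET.
have QP s : reflect (exists g, s = psi g) (s \in Q).
  by rewrite inE; exact: asboolP.
have gQ : group_set Q.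
  apply/group_setP; split; first by apply/QP; exists 1.
  by move=> _ _ /QP[g ->] /QP[h ->]; apply/QP; exists (g * h).
pose QG := Group gQ.
have pQ : p.-group QG.
  apply/pgroupP => q q_prime /(Cauchy q_prime)[s /QP[g sg] oq].
  have [e ge] := psi_p g; have : (q %| p ^ e)%N.
    by rewrite -oq order_dvdn sg ge.
  by rewrite Euclid_dvdX// => /andP[/(prime_nt_dvdP _)-> //]; rewrite ?inE//; case: q q_prime {oq} => [|[]].
pose z : M := [ffun=> 0%R].
pose H := [set s in Q | s z == z]%SET.
have gH : group_set H.
  apply/group_setP; split; first by rewrite inE perm1 eqxx andbT; apply/QP; exists 1.
  move=> s t; rewrite [s \in H]inE [t \in H]inE [_ \in H]inE.
  move=> /andP[sQ /eqP sz] /andP[tQ /eqP tz].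
  by rewrite permM sz tz eqxx andbT (groupM (G := QG)).
have HQs : H \subset Q by apply/fintype.subsetP => s; rewrite inE => /andP[].
(* [H] is the stabilizer of the zero function and contains [psi s] for [s] in [S]. If it is all of
   [Q], then [act g z], which is [c g], is zero. Otherwise it lies in a maximal subgroup, whose
   preimage in [G] is normal, contains [S] and so is everything. *)
have [QH|[K maxK HK]] := maximal_exists (HQs : Group gH \subset QG).
  move=> g y; have : psi g^-1 \in H by rewrite [H]QH; apply/QP; exists g^-1.
  rewrite inE => /andP[_ /eqP]; rewrite permE invgK => /ffunP/(_ y).
  by rewrite !ffunE addr0.
have /andP[KQ nK] := p_maximal_normal pQ maxK.
exfalso; have : Q \subset K.
  apply/fintype.subsetP => _ /QP[g ->].
  apply: (normally_generated_all gS (N := [set g | psi g \in K])); last first.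
    move=> s Ss; apply: (fintype.subsetP HK); rewrite inE; apply/andP; split.
      by apply/QP; exists s.
    apply/eqP; rewrite permE; apply/ffunP => y; rewrite !ffunE addr0.
    have := cM s s^-1 y; rewrite mulgV c1 cS// add0r => /esym.
    move=> _; have := cM s s^-1 (phi s * y); rewrite mulgV c1 cS// add0r mulKg.
    by move=> <-.
  split=> /= [|x y|x|x y].
  - by rewrite psi1 group1.
  - by rewrite psiM => *; rewrite groupM.
  - by rewrite psiV groupV.
  - rewrite conjgE !psiM psiV => xK; rewrite -conjgE memJ_norm//.
    by apply: (fintype.subsetP nK); apply/QP; exists y.
by move=> QK; have := maxgroupp maxK; rewrite properE QK andbF.
Qed.

End FiniteQuotients.

(** * Extension by zero, components and left translations *)

Section Push.
Variables (R : realType) (X Y : choiceType) (e : X -> Y).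
Hypothesis ie : injective e.

Lemma push_exists : exists S : hl2 R X -> hl2 R Y, adjoint (pull e) S.
Proof.
by apply: (@adjoint_exists _ _ _ _ 1) => //; [move=> *; exact: pull_linear|exact: pull_bounded].
Qed.

(* Extension by zero along [e]. *)
Definition push : hl2 R X -> hl2 R Y := sval (cid push_exists).

Lemma push_adjoint : adjoint (pull e) push.
Proof. by rewrite /push; case: cid. Qed.

Lemma pushE f x : push f (e x) = f x.
Proof.
rewrite -ip_basis (adjointC push_adjoint) (_ : pull e _ = basis R x) ?ip_basis//.
by apply: hl2P => z; rewrite pullE// !basisE (inj_eq ie).
Qed.

Lemma push_out f y : (forall x, e x != y) -> push f y = 0.
Proof.
move=> ey; rewrite -ip_basis (adjointC push_adjoint) (_ : pull e _ = 0) ?ip0r//.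
by apply: hl2P => z; rewrite pullE// basisE (negPf (ey z)).
Qed.

Lemma pushK f : pull e (push f) = f.
Proof. by apply: hl2P => x; rewrite pullE// pushE. Qed.

Lemma ip_push f g : ip (push f) (push g) = ip f g.
Proof. by rewrite (adjointC push_adjoint) pushK. Qed.

End Push.

Section Components.
Variables (R : realType) (I X : choiceType).

Lemma pair_inj (i : I) : injective (fun x : X => (i, x)).
Proof. by move=> x y []. Qed.

Definition res (i : I) : hl2 R (I * X)%type -> hl2 R X := pull (fun x => (i, x)).
Definition inc (i : I) : hl2 R X -> hl2 R (I * X)%type := push (@pair_inj i).

Lemma resE i f x : res i f x = f (i, x).
Proof. by rewrite pullE//; exact: pair_inj. Qed.

Lemma incE i f x : inc i f x = (x.1 == i)%:R * f x.2.
Proof.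
case: x => j x /=; have [->|ji] := eqVneq j i; first by rewrite mul1r pushE.
by rewrite mul0r push_out// => y; apply/eqP => -[ij]; rewrite ij eqxx in ji.
Qed.

Lemma inc_res_adjoint i : adjoint (inc i) (res i).
Proof. by apply: (adjointC (@push_adjoint R _ _ _ (@pair_inj i))). Qed.

Lemma res_inc i j f : res i (inc j f) = (i == j)%:R *: f.
Proof. by apply: hl2P => x; rewrite resE incE hl2Z. Qed.

Lemma inc_basis i x : inc i (basis R x) = basis R (i, x).
Proof.
apply: hl2P => -[j y]; rewrite incE !basisE /= -natrM mulnb.
by congr (nat_of_bool _)%:R.
Qed.

End Components.

Section LeftTranslation.
Variables (R : realType) (G : groupType).

Definition lft (g : G) : hl2 R G -> hl2 R G := pull (fun h => (g^-1 * h)%g).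

Let lK g : cancel (fun h : G => (g^-1 * h)%g) (fun h => (g * h)%g).
Proof. by move=> h; rewrite mulVKg. Qed.
Let lK' g : cancel (fun h : G => (g * h)%g) (fun h => (g^-1 * h)%g).
Proof. by move=> h; rewrite mulKg. Qed.

Lemma lftE g f h : lft g f h = f (g^-1 * h)%g.
Proof. by rewrite pullE//; exact: can_inj (lK g). Qed.

Lemma lft_adjoint g : adjoint (lft g) (lft g^-1%g).
Proof. by rewrite /lft invgK; exact: pull_adjoint (lK g) (lK' g). Qed.

Lemma lftM g h f : lft (g * h)%g f = lft g (lft h f).
Proof. by apply: hl2P => k; rewrite !lftE invgM mulgA. Qed.

Lemma lft1 f : lft 1%g f = f.
Proof. by apply: hl2P => k; rewrite lftE invg1 mul1g. Qed.

End LeftTranslation.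

(* A matrix over the integral group ring of [G] is represented by a list of terms
   [(a, ((i, j), g))], standing for the coefficient [a * g] in the entry [(i, j)]. *)
Section FormalMatrices.
Variable G : groupType.

Definition fmat (I J : Type) : Type := seq (int * ((I * J) * G)).

Section Operations.
Variables I J K : finType.
Implicit Types (L : fmat I J) (M : fmat J K).

Definition fmul L M : fmat I K :=
  [seq (t.1 * u.1 * (t.2.1.2 == u.2.1.1)%:R,
        ((t.2.1.1, u.2.1.2), (t.2.2 * u.2.2)%g)) | t <- L, u <- M].

Definition ftrmx L : fmat J I :=
  [seq (t.1, ((t.2.1.2, t.2.1.1), (t.2.2)^-1%g)) | t <- L].

Definition fscale (a : int) L : fmat I J := [seq (a * t.1, t.2) | t <- L].

Definition fid : fmat I I := [seq (1, ((i, i), 1%g)) | i <- enum I].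

(** Bounds the column sums over every finite quotient at once ([fentry_colsum]), hence eigenvalues
    uniformly. *)
Definition fweight L : int := \sum_(t <- L) `|t.1|.

Section Entries.
Variables (H : groupType) (phi : G -> H).

Definition fentry L (x : I * H) (y : J * H) : int :=
  \sum_(t <- L) t.1 * ((t.2.1.1 == x.1) && (t.2.1.2 == y.1) &&
    (x.2 == phi t.2.2 * y.2)%g)%:R.

End Entries.
End Operations.

Fixpoint fexp (I : finType) (L : fmat I I) m : fmat I I :=
  if m is m'.+1 then fmul L (fexp L m') else fid I.

(** The normalized trace: over a finite quotient it is the trace of [fmx] divided by the group order
    ([fmx_trace]), and for [phi = id] it is the trace of the operator on [l2] ([fop_trace]). *)
Definition ftrace (I : finType) (H : groupType) (phi : G -> H) (L : fmat I I) : int :=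
  \sum_(t <- L) t.1 * ((t.2.1.1 == t.2.1.2) && (phi t.2.2 == 1)%g)%:R.

End FormalMatrices.

Section FormalOnFinite.
Variables (G : groupType) (gT : finGroupType) (phi : G -> gT).
Hypothesis phiM : forall g h, phi (g * h)%g = (phi g * phi h)%g.

Definition fmx (I J : finType) (L : fmat G I J) :
    'M[int]_(#|{: I * gT}|, #|{: J * gT}|) :=
  \matrix_(a, b) fentry phi L (enum_val a) (enum_val b).

Lemma big_enum_val_all (V : nmodType) (X : finType) (F : X -> V) :
  \sum_(a < #|X|) F (enum_val a) = \sum_x F x.
Proof. by rewrite [RHS](reindex _ (onW_bij _ (@enum_val_bij X))). Qed.

Let phi1 : phi 1%g = 1%g.
Proof. by apply: (mulgI (phi 1%g)); rewrite -phiM !mulg1. Qed.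

Let phiV g : phi g^-1%g = (phi g)^-1%g.
Proof. by apply: (mulgI (phi g)); rewrite -phiM !mulgV. Qed.

Lemma fmx_mul (I J K : finType) (L : fmat G I J) (M : fmat G J K) :
  fmx (fmul L M) = fmx L *m fmx M.
Proof.
apply/matrixP => a b; rewrite !mxE.
under eq_bigr do rewrite !mxE.
rewrite (big_enum_val_all (fun z : J * gT =>
  fentry phi L (enum_val a) z * fentry phi M z (enum_val b))).
move: (enum_val a) (enum_val b) => x y.
rewrite /fentry big_allpairs_dep/=.
under [RHS]eq_bigr => z _ do rewrite big_distrl/=.
rewrite [RHS]exchange_big/=; apply: eq_bigr => t _.
under [RHS]eq_bigr => z _ do rewrite big_distrr/=.
rewrite [RHS]exchange_big/=; apply: eq_bigr => u _.
rewrite (bigD1 (t.2.1.2, (phi u.2.2 * y.2)%g))//= big1 ?addr0; last first.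
  move=> [j h] /=; rewrite xpair_eqE negb_and => /orP[jn|hn].
    by rewrite (eq_sym _ j) (negPf jn) andbF mulr0 mul0r.
  by rewrite (negPf hn) andbF !mulr0.
rewrite !eqxx andbT phiM mulgA (eq_sym u.2.1.1).
move: (t.2.1.1 == x.1) (t.2.1.2 == u.2.1.1) (u.2.1.2 == y.1) (x.2 == _)%g t.1 u.1.
by case=> [] [] [] [] v w /=; ring.
Qed.

Lemma fmx_tr (I J : finType) (L : fmat G I J) : fmx (ftrmx L) = (fmx L)^T.
Proof.
apply/matrixP => a b; rewrite !mxE /fentry big_map/=.
move: (enum_val a) (enum_val b) => x y; apply: eq_bigr => t _.
congr (_ * (nat_of_bool _)%:R); rewrite [X in X && _]andbC; congr (_ && _).
by rewrite phiV; apply/eqP/eqP => ->; rewrite ?mulKg ?mulVKg.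
Qed.

Lemma fmx_cat (I J : finType) (L M : fmat G I J) : fmx (L ++ M) = fmx L + fmx M.
Proof. by apply/matrixP => a b; rewrite !mxE /fentry big_cat. Qed.

Lemma fmx_scale (I J : finType) c (L : fmat G I J) : fmx (fscale c L) = c *: fmx L.
Proof.
apply/matrixP => a b; rewrite !mxE /fentry big_map big_distrr/=.
by apply: eq_bigr => t _; rewrite mulrA.
Qed.

Lemma fmx_id (I : finType) : fmx (fid G I) = 1%:M.
Proof.
apply/matrixP => a b; rewrite !mxE /fentry big_map big_enum/=.
rewrite -(inj_eq enum_val_inj); move: (enum_val a) (enum_val b) => x y.
rewrite (bigD1 x.1)//= big1 ?addr0 => [|i ix].
  rewrite eqxx mul1r phi1 mul1g; case: x y => [i g] [j h] /=.
  by rewrite xpair_eqE; case: (_ && _).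
by rewrite (negPf ix) mulr0.
Qed.

Lemma fmx_exp (I : finType) (L : fmat G I I) m : fmx (fexp L m) = fmx L ^+ m.
Proof.
by elim: m => [|m IH]; rewrite ?fmx_id// fmx_mul IH exprS mulmxE.
Qed.

Lemma fmx_trace (I : finType) (L : fmat G I I) :
  \tr (fmx L) = #|gT|%:R * ftrace phi L.
Proof.
rewrite /mxtrace; under eq_bigr do rewrite mxE.
rewrite (big_enum_val_all (fun z : I * gT => fentry phi L z z)).
rewrite exchange_big/= /ftrace big_distrr/=; apply: eq_bigr => t _.
rewrite -big_distrr/= mulrCA; congr (_ * _).
rewrite -(pair_bigA _ (fun i h => ((t.2.1.1 == i) && (t.2.1.2 == i) && (h == phi t.2.2 * h)%g)%:R))/=.
rewrite (bigD1 t.2.1.1)//= [X in _ + X]big1 ?addr0 => [|i it]; last first.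
  by rewrite big1// => h _; rewrite eq_sym (negPf it).
rewrite eqxx (eq_sym t.2.1.2).
under eq_bigr => h _.
  rewrite (_ : (h == _)%g = (phi t.2.2 == 1%g)); last first.
    by rewrite -[in LHS](mul1g h) mulgA mulg1 (inj_eq (mulIg h)) eq_sym.
  over.
by rewrite big_const iter_addr_0 cardT -cardE mulr_natl.
Qed.

End FormalOnFinite.

HB.lock Definition fop (R : realType) (G : groupType) (I J : finType)
    (L : fmat G I J) (f : hl2 R (J * G)%type) : hl2 R (I * G)%type :=
  \sum_(t <- L) t.1%:~R *: inc t.2.1.1 (lft t.2.2 (res t.2.1.2 f)).

Section FormalOnL2.
Variables (R : realType) (G : groupType).

Lemma fopE (I J : finType) (L : fmat G I J) (f : hl2 R _) :
  fop L f = \sum_(t <- L) t.1%:~R *: inc t.2.1.1 (lft t.2.2 (res t.2.1.2 f)).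
Proof. by rewrite fop.unlock. Qed.

Lemma fop_adjoint (I J : finType) (L : fmat G I J) : adjoint (@fop R _ _ _ L) (fop (ftrmx L)).
Proof.
move=> f h; rewrite !fopE ip_suml big_map ip_sumr; apply: eq_bigr => t _ /=.
rewrite ipZl ipZr inc_res_adjoint lft_adjoint.
by rewrite (adjointC (@inc_res_adjoint _ _ _ _)).
Qed.

Lemma fopZ (I J : finType) (L : fmat G I J) c (f : hl2 R _) : fop L (c *: f) = c *: fop L f.
Proof. exact: (adjointZ _ _ (fop_adjoint L)). Qed.

Lemma fop_mul (I J K : finType) (L : fmat G I J) (M : fmat G J K) (f : hl2 R _) :
  fop (fmul L M) f = fop L (fop M f).
Proof.
rewrite [LHS]fopE [RHS]fopE big_allpairs_dep; apply: eq_bigr => t _ /=.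
have lin : forall (s : seq (int * (J * K * G))),
    \sum_(u <- s) (t.1 * u.1 * (t.2.1.2 == u.2.1.1)%:R)%:~R *:
       inc t.2.1.1 (lft (t.2.2 * u.2.2)%g (res u.2.1.2 f)) =
    t.1%:~R *: inc t.2.1.1 (lft t.2.2 (res t.2.1.2 (fop s f))); last exact: lin.
have h1 := adjointC (@inc_res_adjoint R J G t.2.1.2).
have h2 := lft_adjoint (R := R) t.2.2.
have h3 := @inc_res_adjoint R I G t.2.1.1.
elim=> [|u s IH].
  by rewrite !fopE !big_nil (adjoint0 h1) (adjoint0 h2) (adjoint0 h3) scaler0.
rewrite big_cons IH !fopE big_cons (adjointD _ _ h1) (adjointD _ _ h2) (adjointD _ _ h3).
rewrite scalerDr; congr (_ + _).
rewrite (adjointZ _ _ h1) (adjointZ _ _ h2) (adjointZ _ _ h3) res_inc.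
rewrite (adjointZ _ _ h2) (adjointZ _ _ h3) !scalerA lftM; congr (_ *: _).
by rewrite !intrM; congr (_ * _); case: (_ == _).
Qed.

Lemma fop_id (I : finType) (f : hl2 R _) : fop (fid G I) f = f.
Proof.
rewrite !fopE big_map big_enum/=; apply: hl2P => -[i g]; rewrite hl2_sum.
rewrite (bigD1 i)// hl2Z incE/= eqxx !mul1r lft1 resE big1 ?addr0// => j ji.
by rewrite hl2Z incE/= eq_sym (negPf ji) mul0r mulr0.
Qed.

Lemma fop_cat (I J : finType) (L M : fmat G I J) (f : hl2 R _) :
  fop (L ++ M) f = fop L f + fop M f.
Proof. by rewrite !fopE big_cat. Qed.

Lemma fop_scale (I J : finType) c (L : fmat G I J) (f : hl2 R _) :
  fop (fscale c L) f = c%:~R *: fop L f.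
Proof.
rewrite !fopE big_map scaler_sumr; apply: eq_bigr => t _.
by rewrite scalerA intrM.
Qed.

Lemma fop_diag (I : finType) (L : fmat G I I) i g :
  fop L (basis R (i, g)) (i, g) =
  (\sum_(t <- L) t.1 * ((t.2.1.1 == i) && (t.2.1.2 == i) && (t.2.2 == 1%g))%:R)%:~R.
Proof.
rewrite fopE hl2_sum rmorph_sum; apply: eq_bigr => t _ /=; rewrite hl2Z intrM.
rewrite rmorph_nat; congr (_ * _); rewrite incE lftE resE basisE /= xpair_eqE -natrM mulnb.
rewrite (eq_sym i) -andbA; congr ((nat_of_bool (_ && (_ && _)))%:R).
rewrite -[RHS](inj_eq (mulIg g)) mul1g; apply/eqP/eqP => h.
  by apply: (mulgI t.2.2^-1%g); rewrite mulKg h.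
by apply: (mulgI t.2.2); rewrite mulVKg h.
Qed.

Lemma fop_trace (I : finType) (L : fmat G I I) :
  \sum_i fop L (basis R (i, 1%g)) (i, 1%g) = (ftrace id L)%:~R.
Proof.
under eq_bigr do rewrite fop_diag.
rewrite -rmorph_sum/= /ftrace exchange_big/=; congr _%:~R; apply: eq_bigr => t _.
rewrite (bigD1 t.2.1.1)//= big1 ?addr0 ?eqxx; first by rewrite (eq_sym t.2.1.2).
by move=> i it; rewrite (eq_sym _ i) (negPf it) mulr0.
Qed.

End FormalOnL2.

Lemma fentry_colsum (G : groupType) (gT : finGroupType) (phi : G -> gT)
    (I J : finType) (L : fmat G I J) y :
  \sum_x `|fentry phi L x y| <= fweight L.
Proof.
apply: (@le_trans _ _ (\sum_(x : I * gT) \sum_(t <- L) `|t.1| *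
    ((t.2.1.1 == x.1) && (x.2 == phi t.2.2 * y.2)%g)%:R)).
  apply: ler_sum => x _; apply: le_trans (ler_norm_sum _ _ _) _.
  apply: ler_sum => t _; rewrite normrM normr_nat ler_wpM2l ?normr_ge0//.
  by case: (_ == _); case: (_ == _); case: (_ == _).
rewrite exchange_big/=; apply: ler_sum => t _; rewrite -mulr_sumr.
rewrite (bigD1 (t.2.1.1, (phi t.2.2 * y.2)%g))//= !eqxx big1 ?addr0 ?mulr1//.
move=> [i h]; rewrite xpair_eqE negb_and => /orP[it|ht] /=.
  by rewrite eq_sym (negPf it).
by rewrite (negPf ht) andbF.
Qed.

(** * Gram matrices over finite p-quotients *)

Section Injectivity.
Variables (R : realType) (G : groupType) (p : nat) (gT : finGroupType) (phi : G -> gT).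
Hypothesis pq : pquotient p phi.
Variables (I J : finType) (B : fmat G I J).
Hypothesis B_inj : forall f : J * gT -> 'F_p,
  (forall x, \sum_y (fentry phi B x y)%:~R * f y = 0) -> forall y, f y = 0.

Local Notation fmxR L := (map_mx (intr : int -> R) (fmx phi L)).

(** Injectivity modulo [p] gives a one-sided inverse over ['F_p]. Lifted to the integers, it has
    with [fmx phi B] a product of determinant 1 modulo [p], so of nonzero determinant, which is
    invertible over the reals. *)
Lemma fmx_injR (v : 'rV[R]_#|{: J * gT}|) : v *m (fmxR B)^T = 0 -> v = 0.
Proof.
pose Bp := map_mx (intr : int -> 'F_p) (fmx phi B).
have free : row_free Bp^T.
  apply: inj_row_free => w wB.
  have w0 : forall y, w 0 (enum_rank y) = 0.
    apply: B_inj => x; have /rowP/(_ (enum_rank x)) := wB; rewrite !mxE => wBx.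
    rewrite -[RHS]wBx -(big_enum_val_all (fun y => (fentry phi B x y)%:~R * w 0 (enum_rank y))).
    by apply: eq_bigr => a _; rewrite !mxE enum_rankK enum_valK mulrC.
  by apply/rowP => a; rewrite mxE -(enum_valK a) w0.
have [X BX] := row_freeP free.
pose Xz := \matrix_(i, j) (X i j : nat)%:Z.
have XzE : map_mx (intr : int -> 'F_p) Xz = X.
  by apply/matrixP => i j; rewrite !mxE -pmulrn natr_Zp.
pose M := (fmx phi B)^T *m Xz.
have detM : \det M != 0.
  apply/eqP => M0; have := det1 'F_p #|{: J * gT}|.
  by rewrite -BX -XzE map_trmx -map_mxM det_map_mx M0 => /esym/eqP; rewrite oner_eq0.
have MR : map_mx (intr : int -> R) M \in unitmx.
  by rewrite unitmxE det_map_mx unitfE intr_eq0.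
move=> vB; rewrite -[v](mulmxK MR) map_mxM -map_trmx mulmxA vB.
by rewrite !mul0mx.
Qed.

Let A := fmul (ftrmx B) B.

Let AE : fmxR A = (fmxR B)^T *m fmxR B.
Proof.
by rewrite (fmx_mul (pquotM pq)) (fmx_tr (pquotM pq)) map_mxM map_trmx.
Qed.

Lemma row_sqr_eq0 n (v : 'rV[R]_n) : (v *m v^T) 0 0 = 0 -> v = 0.
Proof.
rewrite mxE => /eqP; rewrite psumr_eq0 => [/allP h|i _]; last first.
  by rewrite mxE -expr2 sqr_ge0.
apply/rowP => i; have := h i (mem_index_enum _).
by rewrite !mxE -expr2 sqrf_eq0 => /eqP.
Qed.

Lemma row_sqr_ge0 n (v : 'rV[R]_n) : 0 <= (v *m v^T) 0 0.
Proof. by rewrite mxE sumr_ge0// => i _; rewrite mxE -expr2 sqr_ge0. Qed.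

Let A_quad (v : 'rV[R]_#|{: J * gT}|) : v *m fmxR A *m v^T =
  (v *m (fmxR B)^T) *m (v *m (fmxR B)^T)^T.
Proof. by rewrite AE trmx_mul trmxK !mulmxA. Qed.

Lemma fmx_gram_det : 1 <= `|\det (fmxR A)|.
Proof.
rewrite det_map_mx -intr_norm ler1z -gtz0_ge1 normr_gt0.
apply/eqP => d0; have : \det (fmxR A) = 0 by rewrite det_map_mx d0.
move=> /eqP/det0P[v v0 vA]; move/negP: v0; apply; apply/eqP/fmx_injR.
by apply: row_sqr_eq0; rewrite -A_quad vA mul0mx mxE.
Qed.

(** Positivity comes from injectivity of [B]; the upper bound compares the entry of largest absolute
    value of the eigenvector with a column sum. *)
Lemma fmx_eigen_bound lam (v : 'rV[R]_#|{: J * gT}|) : v != 0 ->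
  v *m fmxR A = lam *: v -> 0 < lam <= (fweight A)%:~R.
Proof.
move=> v0 vA; apply/andP; split.
  have := congr1 (fun M => (M *m v^T) 0 0) vA; rewrite A_quad -scalemxAl [RHS]mxE => E.
  have vv : 0 < (v *m v^T) 0 0.
    by rewrite lt_neqAle row_sqr_ge0 andbT eq_sym; apply: contra v0 => /eqP/row_sqr_eq0 ->.
  rewrite -(pmulr_lgt0 _ vv) -E lt_neqAle row_sqr_ge0 andbT eq_sym.
  by apply: contra v0 => /eqP/row_sqr_eq0/fmx_injR ->.
have [a va] : exists a, v 0 a != 0.
  apply: contrapT => nv; move/negP: v0; apply; apply/eqP/rowP => a; rewrite mxE.
  by apply/eqP/negPn/negP => va; apply: nv; exists a.
pose b := [arg max_(i > a) `|v 0 i|]%O.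
have vb i : `|v 0 i| <= `|v 0 b|.
  by rewrite /b; case: Order.TotalTheory.arg_maxP => // c _; apply.
have vb0 : 0 < `|v 0 b| by apply: lt_le_trans (vb a); rewrite normr_gt0.
rewrite -(ler_pM2r vb0); apply: le_trans (_ : `|lam| * `|v 0 b| <= _).
  by rewrite ler_wpM2r// ler_norm.
rewrite -normrM; have /rowP/(_ b) := vA; rewrite [RHS]mxE => <-; rewrite mxE.
apply: le_trans (ler_norm_sum _ _ _) _.
apply: (@le_trans _ _ (\sum_i `|v 0 b| * `|fmx phi A i b|%:~R)).
  apply: ler_sum => i _; rewrite normrM !mxE intr_norm.
  by apply: ler_wpM2r => //; exact: normr_ge0.
rewrite -mulr_sumr mulrC ler_wpM2r// -rmorph_sum ler_int.
have := fentry_colsum phi A (enum_val b).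
rewrite -(big_enum_val_all (fun x => `|fentry phi A x (enum_val b)|)).
by apply: le_trans; apply: ler_sum => i _; rewrite mxE.
Qed.

(** [K - B^* B] with [K = fweight A + 2]: the weight bounds the eigenvalues of the Gram matrix, and
    the 2 ensures [K > 1], as [eigenvalue_count] requires. It is kept integral so that its powers
    can be followed in every quotient. *)
Definition gram_shift : fmat G J J :=
  fscale (fweight A + 2) (fid G J) ++ fscale (-1) A.

Lemma gram_shift_trace j m : (0 < j)%N ->
  (ftrace phi (fexp gram_shift m))%:~R <=
  (fweight A + 2)%:~R ^+ m *
  (#|J|%:R * (1 - (fweight A + 2)%:~R ^- j) ^+ m + #|J|%:R / j%:R) :> R.
Proof.
move=> j0; set K : R := (fweight A + 2)%:~R.
have w0 : (0 : R) <= (fweight A)%:~R.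
  by rewrite ler0z; apply: sumr_ge0 => t _; exact: normr_ge0.
have KE : K = (fweight A)%:~R + 2 by rewrite /K intrD.
have K1 : 1 < K by rewrite KE; lra.
have K0 : 0 < K by rewrite KE; lra.
have := @symmetric_trace_bound R _ (fmxR A) K j m j0 K1.
rewrite AE trmx_mul trmxK -AE => /(_ erefl) bnd.
have {bnd}/bnd : forall lam (x : 'rV_#|{: J * gT}|), x != 0 ->
    x *m fmxR A = lam *: x -> 0 < lam <= K.
  move=> lam x x0 xA; have /andP[-> lw] := fmx_eigen_bound x0 xA.
  by rewrite /= (le_trans lw)// KE lerDl.
have cE : #|{: J * gT}|%:R = #|J|%:R * #|gT|%:R :> R by rewrite card_prod natrM.
move=> /(_ fmx_gram_det); rewrite cE => bnd.
have expE n : (K *: (1%:M - K^-1 *: fmxR A)) ^+ n =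
    K ^+ n *: (1%:M - K^-1 *: fmxR A) ^+ n.
  elim: n => [|n IH]; first by rewrite !expr0 scale1r.
  by rewrite !exprS IH -!mulmxE -scalemxAl -scalemxAr scalerA.
have trE : \tr (fmxR (fexp gram_shift m)) =
    K ^+ m * \tr ((1%:M - K^-1 *: fmxR A) ^+ m).
  rewrite (fmx_exp (pquotM pq)) rmorphXn/=.
  have -> : fmxR gram_shift = K *: (1%:M - K^-1 *: fmxR A).
    rewrite fmx_cat !fmx_scale (fmx_id (pquotM pq)).
    rewrite map_mxD !map_mxZ map_mx1 scalerBr scalerA mulfV ?gt_eqF// scale1r.
    by rewrite rmorphN1 scaleN1r.
  by rewrite expE mxtraceZ.
have gT0 : 0 < #|gT|%:R :> R.
  by rewrite ltr0n; apply/card_gt0P; exists 1%g.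
rewrite -(ler_pM2l gT0) mulrCA.
have -> : #|gT|%:R * (ftrace phi (fexp gram_shift m))%:~R = \tr (fmxR (fexp gram_shift m)).
  by rewrite trace_map_mx fmx_trace rmorphM rmorph_nat.
rewrite trE ler_pM2l ?exprn_gt0//; apply: le_trans bnd _.
by rewrite le_eqVlt; apply/orP; left; apply/eqP; ring.
Qed.

End Injectivity.

Lemma bernoulli_decay (R : realType) (x e : R) : 0 <= x < 1 -> 0 < e ->
  exists m, x ^+ m <= e.
Proof.
move=> /andP[x0 x1] e0; pose t := 1 - x; have t0 : 0 < t by rewrite /t; lra.
have bern m : x ^+ m * (1 + m%:R * t) <= 1.
  elim: m => [|m IH]; first by rewrite expr0 mul0r addr0 mul1r.
  apply: le_trans IH; rewrite exprSr -mulrA ler_wpM2l ?exprn_ge0//.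
  have mt : 0 <= m%:R * t by rewrite mulr_ge0// ltW.
  by rewrite -natr1 mulrDl mul1r /t in mt *; nra.
have te : 0 <= (t * e)^-1 by rewrite invr_ge0 mulr_ge0// ltW.
have [m hm] : exists m : nat, (t * e)^-1 < m%:R.
  by exists (Num.bound (t * e)^-1); exact: archi_boundP.
exists m; have m0 : 0 <= m%:R * t by rewrite mulr_ge0// ltW.
have me : 1 <= m%:R * t * e.
  by rewrite -mulrA -ler_pdivrMr ?mulr_gt0// div1r ltW.
have := bern m; have : 0 <= x ^+ m by rewrite exprn_ge0.
move: (x ^+ m) (m%:R * t) m0 me => y z; nra.
Qed.

(* Lueck's approximation argument: if [B] is injective modulo [p] over every finite
   p-quotient, then the integral Gram matrices have determinant at least 1 in absolute
   value, which bounds the number of their small eigenvalues uniformly. *)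
Section LueckApproximation.
Variables (R : realType) (G : groupType) (p : nat) (I J : finType) (B : fmat G I J).
Hypothesis (Gres : residually_finite_p G p).
Hypothesis B_inj : forall (gT : finGroupType) (phi : G -> gT), pquotient p phi ->
  forall f : J * gT -> 'F_p,
  (forall x, \sum_y (fentry phi B x y)%:~R * f y = 0) -> forall y, f y = 0.

Let A := fmul (ftrmx B) B.
Let K : R := (fweight A + 2)%:~R.

(** A fixed power involves finitely many group elements, so its trace is already computed in a
    [p]-quotient separating these from 1, where the bound is uniform. *)
Lemma ftrace_shift j m : (0 < j)%N ->
  (ftrace id (fexp (gram_shift B) m))%:~R <=
  K ^+ m * (#|J|%:R * (1 - K ^- j) ^+ m + #|J|%:R / j%:R) :> R.
Proof.
move=> j0; set L := fexp _ _.
have l1 g : g \in [seq t.2.2 | t <- L & t.2.2 != 1%g] -> g != 1%g.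
  by move=> /mapP[t + ->]; rewrite mem_filter => /andP[].
have [gT [phi [pq sep]]] := separating_pquotient Gres l1.
have -> : ftrace id L = ftrace phi L.
  rewrite /ftrace big_seq [RHS]big_seq; apply: eq_bigr => t tL.
  congr (_ * (nat_of_bool (_ && _))%:R).
  have [->|t1] := eqVneq t.2.2 1%g; first by rewrite (pquot1 pq) eqxx.
  apply/esym/negbTE/sep/mapP; exists t => //.
  by rewrite mem_filter t1.
exact: (gram_shift_trace R pq (B_inj pq)).
Qed.

(** If [B z = 0] then [C z = K z], so Cauchy-Schwarz bounds [K ^+ (2 m) * z x ^+ 2] by [ip z z]
    times a diagonal coefficient of [C ^+ (2 m)]. Even powers are positive, so this coefficient is
    at most the trace, which is small compared with [K ^+ (2 m)]. *)
Lemma fop_injective (z : hl2 R (J * G)%type) : fop B z = 0 -> z = 0.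
Proof.
move=> Bz; set C := gram_shift B.
have CC : adjoint (@fop R G J J C) (fop C).
  move=> f h; rewrite /C /gram_shift !fop_cat !fop_scale !fop_id.
  rewrite ipDl ipDr !ipZl !ipZr !fop_mul; congr (_ + _ * _).
  by rewrite (adjointC (fop_adjoint B)) (fop_adjoint B).
have expE m f : fop (fexp C m) f = iter m (fop C) f.
  by elim: m => [|m IH]; rewrite ?fop_id// fop_mul IH.
have iterC m : adjoint (iter m (@fop R G J J C)) (iter m (fop C)).
  by elim: m => // m IH f h; rewrite iterS CC IH -iterSr.
have Cz : fop C z = K *: z.
  rewrite /C /gram_shift fop_cat !fop_scale fop_id fop_mul Bz.
  by rewrite (adjoint0 (adjointC (fop_adjoint B))) scaler0 addr0.
have iterz m : iter m (fop C) z = K ^+ m *: z.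
  elim: m => [|m IH]; first by rewrite scale1r.
  by rewrite iterS IH fopZ Cz scalerA exprSr.
have w0 : (0 : R) <= (fweight A)%:~R.
  by rewrite ler0z; apply: sumr_ge0 => t _; exact: normr_ge0.
have KE : K = (fweight A)%:~R + 2 by rewrite /K intrD.
have K0 : 0 < K by rewrite KE; lra.
have K1 : 1 < K by rewrite KE; lra.
have diag_ge0 m x : 0 <= fop (fexp C (m + m)) (basis R x) x.
  by rewrite -ip_basis expE iterD iterC ip_ge0.
have diag_le m x : fop (fexp C (m + m)) (basis R x) x <= (ftrace id (fexp C (m + m)))%:~R.
  case: x => i g; rewrite -fop_trace (bigD1 i)//= fop_diag -(fop_diag R _ i 1%g).
  by rewrite lerDl sumr_ge0.
have bound j m x : (0 < j)%N ->
    z x ^+ 2 <= ip z z * (#|J|%:R * (1 - K ^- j) ^+ (m + m) + #|J|%:R / j%:R).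
  move=> j0; rewrite -(ler_pM2l (exprn_gt0 (m + m) K0)).
  have -> : K ^+ (m + m) * z x ^+ 2 = ip (iter m (fop C) z) (basis R x) ^+ 2.
    by rewrite ip_basis iterz hl2Z exprMn -exprM addnn muln2.
  rewrite iterC; apply: le_trans (cauchy_schwarz _ _) _.
  rewrite mulrCA ler_wpM2l ?ip_ge0// -iterC -iterD -expE ip_basis.
  exact: le_trans (diag_le m x) (ftrace_shift (m + m) j0).
apply: hl2P => x; apply/eqP; rewrite -sqrf_eq0 eq_le sqr_ge0 andbT.
apply/ler_addgt0Pr => e e0; rewrite add0r.
pose c := ip z z * #|J|%:R + 1.
have c0 : 0 <= ip z z * #|J|%:R by rewrite mulr_ge0// ip_ge0.
have ce : 0 < e / (2 * c) by rewrite divr_gt0// mulr_gt0// /c; lra.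
(* [j = N.+1] is fixed first, making [j^-1] small; [m] comes after it, because the base [1 - K ^- j]
   depends on [j]. *)
have [N hN] := invn_small ce; have hj := hN N (leqnn N).
have q01 : 0 <= 1 - K ^- N.+1 < 1.
  have h : 0 < K ^- N.+1 by rewrite invr_gt0 exprn_gt0.
  have : K ^- N.+1 <= 1 by rewrite invf_le1 ?exprn_gt0// exprn_ege1// ltW.
  by move: h; lra.
have [m hm] := bernoulli_decay q01 ce.
have hm2 : (1 - K ^- N.+1) ^+ (m + m) <= e / (2 * c).
  apply: le_trans hm; rewrite exprD ler_piMr ?exprn_ge0//; first by case/andP: q01.
  by rewrite exprn_ile1//; case/andP: q01 => ? /ltW.
apply: le_trans (bound N.+1 m x isT) _.
have ec : e = e / (2 * c) * (2 * c) by rewrite mulfVK// gt_eqF// mulr_gt0// /c; lra.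
have cE : ip z z * #|J|%:R = c - 1 by rewrite /c addrK.
rewrite [leRHS]ec -mulrDr mulrA cE; rewrite cE in c0; move: hj hm2 c0 (ltW ce).
move: (e / _) (N.+1%:R^-1) (_ ^+ (m + m)) => d u v hu hv hw d0.
apply: (@le_trans _ _ ((c - 1) * (d + d))); first by rewrite ler_wpM2l// lerD.
have -> : d * (2 * c) = (c - 1) * (d + d) + (d + d) by ring.
by rewrite lerDl addr_ge0.
Qed.
End LueckApproximation.

(** * Vanishing of cocycles *)

Section FoxCalculus.
Variables (G : groupType) (n : nat) (x : 'I_n -> G).
Implicit Types (u v w : word n).

Definition letter (l : 'I_n * bool) : G := (if l.2 then x l.1 else (x l.1)^-1)%g.

(* The term [(a, (i, g))] contributes [a * g] to the Fox derivative with respect to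
   the generator [i]. *)
Fixpoint fox w : seq (int * ('I_n * G)) :=
  if w is l :: w' then
    (if l.2 then (1, (l.1, 1%g)) else (-1, (l.1, (x l.1)^-1%g))) ::
    [seq (t.1, (t.2.1, (letter l * t.2.2)%g)) | t <- fox w']
  else [::].

Lemma word_eval_nil : word_eval x [::] = 1%g.
Proof. by rewrite /word_eval big_nil. Qed.

Lemma word_eval_cons l w : word_eval x (l :: w) = (letter l * word_eval x w)%g.
Proof. by rewrite /word_eval big_cons. Qed.

Lemma word_eval_cat u v : word_eval x (u ++ v) = (word_eval x u * word_eval x v)%g.
Proof.
elim: u => [|l u IH]; first by rewrite word_eval_nil mul1g.
by rewrite cat_cons !word_eval_cons IH mulgA.
Qed.

Section Evaluation.
Variables (V : zmodType) (H : groupType) (phi : G -> H) (f : 'I_n -> H -> V).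
Hypothesis phiM : forall g h, phi (g * h)%g = (phi g * phi h)%g.

(** The Fox derivatives of [w] applied to the family [f]. By [fox_eval_cat] this is the crossed
    homomorphism on words that sends the letter of the generator [i] to [f i]. *)
Definition fox_eval w (y : H) : V :=
  \sum_(t <- fox w) f t.2.1 ((phi t.2.2)^-1 * y)%g *~ t.1.

Let phi1 : phi 1%g = 1%g.
Proof. by apply: (mulgI (phi 1%g)); rewrite -phiM !mulg1. Qed.

Let phiV g : phi g^-1%g = (phi g)^-1%g.
Proof. by apply: (mulgI (phi g)); rewrite -phiM !mulgV. Qed.

Lemma fox_eval_nil y : fox_eval [::] y = 0.
Proof. by rewrite /fox_eval big_nil. Qed.

Lemma fox_eval_cons l w y : fox_eval (l :: w) y =
  (if l.2 then f l.1 y else - f l.1 (phi (x l.1) * y)%g) +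
  fox_eval w ((phi (letter l))^-1 * y)%g.
Proof.
rewrite /fox_eval big_cons big_map; congr (_ + _).
  case: l => i [] /=; first by rewrite phi1 invg1 mul1g.
  by rewrite phiV invgK mulrNz.
by apply: eq_bigr => t _ /=; rewrite phiM invgM mulgA.
Qed.

Lemma fox_eval_cat u v y :
  fox_eval (u ++ v) y = fox_eval u y + fox_eval v ((phi (word_eval x u))^-1 * y)%g.
Proof.
elim: u y => [|l u IH] y.
  by rewrite word_eval_nil phi1 invg1 mul1g fox_eval_nil add0r.
by rewrite cat_cons !fox_eval_cons IH addrA word_eval_cons phiM invgM mulgA.
Qed.

(** Once the relators evaluate to zero, the crossed homomorphism on words descends to [G]; the
    product rule handles concatenation, cancellation is immediate. *)
Lemma fox_eval_pres (rels : seq (word n)) u v :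
  (forall u v, word_eval x u = word_eval x v <-> pres_eq rels u v) ->
  (forall r, r \in rels -> forall y, fox_eval r y = 0) ->
  pres_eq rels u v -> forall y, fox_eval u y = fox_eval v y.
Proof.
move=> pres rel0; elim=> {u v} [||u v w _ IH1 _ IH2 y|u u' v v' uu' IH1 _ IH2 y|i b y|r rr y].
- by [].
- by move=> u v _ IH y; rewrite IH.
- by rewrite IH1 IH2.
- by rewrite !fox_eval_cat IH1 IH2; move/pres: uu' => ->.
- rewrite !fox_eval_cons !fox_eval_nil addr0 /letter; case: b => /=.
    by rewrite mulVKg subrr.
  by rewrite phiV invgK addNr.
- by rewrite rel0// fox_eval_nil.
Qed.

Lemma fox_eval_cocycle (c : G -> H -> V) w y :
  (forall g h y, c (g * h)%g y = c g y + c h ((phi g)^-1 * y)%g) ->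
  (forall i y, f i y = c (x i) y) -> fox_eval w y = c (word_eval x w) y.
Proof.
move=> cM fc.
have c1 z : c 1%g z = 0.
  have := cM 1%g 1%g z; rewrite mulg1 phi1 invg1 mul1g => /eqP.
  by rewrite -subr_eq0 opprD addrA subrr add0r oppr_eq0 => /eqP.
elim: w y => [|l w IH] y; first by rewrite word_eval_nil c1 fox_eval_nil.
rewrite fox_eval_cons word_eval_cons cM IH; congr (_ + _).
rewrite /letter; case: l => i [] /=; rewrite fc//.
have := cM (x i)^-1%g (x i) y; rewrite mulVg c1 phiV invgK => /esym/eqP.
by rewrite addr_eq0 => /eqP ->.
Qed.

End Evaluation.

(** The Fox Jacobian of the words [ws], one row for each word. *)
Definition fox_matrix (ws : seq (word n)) : fmat G 'I_(size ws) 'I_n :=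
  [seq (t.1, ((k, t.2.1), t.2.2)) |
    k : 'I_(size ws) <- enum 'I_(size ws), t : int * ('I_n * G) <- fox (nth [::] ws k)].

Lemma fox_matrix_entry (k : fieldType) (gT : finGroupType) (phi : G -> gT) ws
    (f : 'I_n * gT -> k) r y :
  \sum_z (fentry phi (fox_matrix ws) (r, y) z)%:~R * f z =
  fox_eval phi (fun i h => f (i, h)) (nth [::] ws r) y.
Proof.
rewrite /fentry /fox_matrix.
under eq_bigr => z _.
  rewrite big_allpairs_dep big_enum/= (bigD1 r)//= [X in _ + X]big1 ?addr0; last first.
    move=> s sr; rewrite big1// => t _.
    by rewrite (negPf sr) mulr0.
  rewrite rmorph_sum/= big_distrl/=.
  over.
rewrite exchange_big/=; apply: eq_bigr => t _.
rewrite (bigD1 (t.2.1, ((phi t.2.2)^-1 * y)%g))//= big1 ?addr0.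
  by rewrite !eqxx mulVKg eqxx mulr1 mulrzl.
move=> [i h]; rewrite xpair_eqE negb_and eqxx => /orP[it|ht] /=.
  by rewrite (eq_sym t.2.1) (negPf it) mulr0 mul0r.
suff /negPf -> : (y != phi t.2.2 * h)%g by rewrite andbF mulr0 mul0r.
by apply: contra ht => /eqP ->; rewrite mulKg.
Qed.

Lemma fox_matrix_op (R : realType) ws (z : hl2 R ('I_n * G)%type) r h :
  fop (fox_matrix ws) z (r, h) = fox_eval id (fun i h => z (i, h)) (nth [::] ws r) h.
Proof.
rewrite fopE big_allpairs_dep hl2_sum big_enum/=.
rewrite (bigD1 r)//= [X in _ + X]big1 ?addr0; last first.
  move=> s sr; rewrite hl2_sum big1// => t _.
  by rewrite hl2Z incE/= eq_sym (negPf sr) mul0r mulr0.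
rewrite hl2_sum; apply: eq_bigr => t _.
by rewrite hl2Z incE/= eqxx mul1r lftE resE mulrzl.
Qed.

End FoxCalculus.

Section CocycleVanishing.
Variables (R : realType) (p : nat) (G : groupType).
Hypotheses (p_prime : prime p) (G_fp : finitely_presented G).
Hypothesis G_res : residually_finite_p G p.

Lemma l2_cocycle_eq0 (S : set G) (c : G -> hl2 R G) : normally_generated S ->
  (forall g h, c (g * h)%g = c g + lft g (c h)) ->
  (forall s, S s -> c s = 0) -> forall g, c g = 0.
Proof.
move=> gS cM cS; have [n [rels [x [gens pres]]]] := G_fp.
have [s0 s0S s0N] := finite_normal_generators [seq x i | i <- enum 'I_n] gS.
have gs0 : normally_generated [set g | g \in s0].
  apply/seteqP; split=> // g _ N [nN s0N'].
  have xN i : N (x i) by apply: s0N => //; apply: map_f; rewrite mem_enum.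
  have [w <-] := gens g; have [N1 NM NV _] := nN.
  elim: w => [|l w IH]; first by rewrite word_eval_nil.
  by rewrite word_eval_cons; apply: NM => //; rewrite /letter; case: ifP => _; [|apply: NV].
have [wd wdE] := choice gens.
pose ws := rels ++ [seq wd s | s <- s0].
have wsP w : w \in ws -> exists k : 'I_(size ws), nth [::] ws k = w.
  by move=> ww; have wk := ww; rewrite -index_mem in wk; exists (Ordinal wk); rewrite /= nth_index.
have B_inj (gT : finGroupType) (phi : G -> gT) : pquotient p phi ->
    forall f : 'I_n * gT -> 'F_p,
    (forall z, \sum_y (fentry phi (fox_matrix x ws) z y)%:~R * f y = 0) ->
    forall y, f y = 0.
  move=> pq f fB; have phiM := pquotM pq.
  have fw w : w \in ws -> forall y, fox_eval x phi (fun i h => f (i, h)) w y = 0.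
    by move=> /wsP[k <-] y; rewrite -fox_matrix_entry fB.
  have eqw u v : word_eval x u = word_eval x v ->
      forall y, fox_eval x phi (fun i h => f (i, h)) u y =
                fox_eval x phi (fun i h => f (i, h)) v y.
    move=> /pres; apply: fox_eval_pres => // r rr; apply: fw.
    by rewrite mem_cat rr.
  (* The rows of the relators make the value independent of the word chosen for [g], so [C] is a
     cocycle; the rows of the words for [s0] make it vanish on [s0]. *)
  pose C g y := fox_eval x phi (fun i h => f (i, h)) (wd g) y.
  have C0 : forall g y, C g y = 0.
    apply: (modp_cocycle_eq0 p_prime pq gs0) => [g h y|s /= ss y].
      have -> : phi g = phi (word_eval x (wd g)) by rewrite wdE.
      rewrite /C -fox_eval_cat//; apply: eqw.
      by rewrite word_eval_cat !wdE.
    by apply: fw; rewrite mem_cat map_f ?orbT.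
  move=> [i y]; rewrite -(C0 (x i) y) /C (eqw _ [:: (i, true)]).
    by rewrite fox_eval_cons// fox_eval_nil addr0.
  by rewrite wdE word_eval_cons word_eval_nil mulg1.
pose z : hl2 R ('I_n * G)%type := \sum_i inc i (c (x i)).
have zE i h : z (i, h) = c (x i) h.
  rewrite hl2_sum (bigD1 i)//= incE eqxx mul1r big1 ?addr0// => j ji.
  by rewrite incE/= eq_sym (negPf ji) mul0r.
have cw w y : fox_eval x id (fun i h => z (i, h)) w y = c (word_eval x w) y.
  apply: (@fox_eval_cocycle _ _ x R G id _ _ (fun g y => c g y)) => // g h k.
  by rewrite cM hl2D lftE.
have c1 : c 1%g = 0.
  have := cM 1%g 1%g; rewrite mulg1 lft1 => /eqP.
  by rewrite -subr_eq0 opprD addrA subrr add0r oppr_eq0 => /eqP.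
have z0 : z = 0.
  apply: (fop_injective G_res (B := fox_matrix x ws)); first exact: B_inj.
  apply: hl2P => -[k h]; rewrite fox_matrix_op cw.
  have : nth [::] ws k \in ws by rewrite mem_nth.
  rewrite mem_cat => /orP[rk|/mapP[s ss ->]]; last by rewrite wdE cS//; exact: s0S.
  by have /pres -> := pres_rel rk; rewrite word_eval_nil c1.
move=> g; apply: hl2P => h; have [w <-] := gens g; rewrite -cw.
by rewrite /fox_eval big1// => t _; rewrite z0 hl20 mul0rz.
Qed.

End CocycleVanishing.

(** * Operators over the group von Neumann algebra *)

Section ComplexParts.
Variables (R : realType) (G : groupType).
Implicit Types (xi eta : l2 R G) (f h : hl2 R G).

Lemma normc_sqr (z : R[i]) : Normc.normc z ^+ 2 = complex.Re z ^+ 2 + complex.Im z ^+ 2.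
Proof. by case: z => a b /=; rewrite sqr_sqrtr// addr_ge0// sqr_ge0. Qed.

Lemma sqr_norm_ge_sum xi (s : seq G) : uniq s ->
  \sum_(g <- s) Normc.normc (xi g) ^+ 2 <= sqr_norm xi.
Proof.
move=> us; rewrite -lee_fin sqr_normE -sumEFin.
by apply: esum_ge_uniq => // g; exact: sqr_norm_fun_ge0.
Qed.

Lemma re_proof xi : (fun g => complex.Re (xi g) : R^o) \in @sq_summable R G.
Proof.
apply: (@sq_summable_bounded _ _ _ (sqr_norm xi)) => s us.
apply: le_trans (sqr_norm_ge_sum xi us); apply: ler_sum => g _.
by rewrite normc_sqr lerDl sqr_ge0.
Qed.

Lemma im_proof xi : (fun g => complex.Im (xi g) : R^o) \in @sq_summable R G.
Proof.
apply: (@sq_summable_bounded _ _ _ (sqr_norm xi)) => s us.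
apply: le_trans (sqr_norm_ge_sum xi us); apply: ler_sum => g _.
by rewrite normc_sqr lerDr sqr_ge0.
Qed.

Definition part (b : bool) xi : hl2 R G :=
  if b then Hl2 (im_proof xi) else Hl2 (re_proof xi).

Arguments part : simpl never.

Lemma partE b xi g : part b xi g = if b then complex.Im (xi g) else complex.Re (xi g).
Proof. by case: b. Qed.

Lemma toC_proof f h : (fun g => (f g +i* h g)%C) \in @sqr_summable R G.
Proof.
rewrite sqr_summableE.
apply: (@le_lt_trans _ _ (ip f f + ip h h)%:E); last exact: ltry.
apply: (@esum_le_uniq _ _ (fun g => Normc.normc (f g +i* h g)%C ^+ 2)) => [g|s us].
  exact: sqr_ge0.
under eq_bigr do rewrite normc_sqr/=.
by rewrite big_split lerD//; exact: ip_ge_sum.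
Qed.

Definition toC f h : l2 R G := L2 (toC_proof f h).

Lemma part_toC b f h : part b (toC f h) = if b then h else f.
Proof. by apply: hl2P => g; rewrite partE; case: b. Qed.

Lemma toC_part xi : toC (part false xi) (part true xi) = xi.
Proof. by apply/val_inj/funext => g /=; rewrite !partE; case: (xi g). Qed.

Lemma part_inj xi eta : (forall b, part b xi = part b eta) -> xi = eta.
Proof. by move=> e; rewrite -[xi]toC_part !e toC_part. Qed.

Lemma partD b xi eta : part b (xi + eta) = part b xi + part b eta.
Proof.
apply: hl2P => g; rewrite hl2D !partE.
have -> : (xi + eta) g = xi g + eta g by [].
by case: b; case: (xi g) (eta g) => ? ? [].
Qed.

Lemma part0 b : part b 0 = 0.
Proof. by apply: hl2P => g; rewrite partE; case: b. Qed.

Lemma partZ b (a : R[i]) xi : part b (a *: xi) =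
  if b then complex.Re a *: part true xi + complex.Im a *: part false xi
  else complex.Re a *: part false xi - complex.Im a *: part true xi.
Proof.
apply: hl2P => g; rewrite partE.
have -> : (a *: xi) g = a * xi g by [].
by case: b; rewrite ?hl2D ?hl2N !hl2Z !partE; case: a (xi g) => ? ? [].
Qed.

Lemma part_rho b g xi k : part b (rho g xi) k = part b xi (k * g)%g.
Proof. by rewrite !partE. Qed.

Lemma part_lam b g xi : part b (lam g xi) = lft g (part b xi).
Proof. by apply: hl2P => k; rewrite lftE !partE. Qed.

Lemma part_delta b g : part b (delta R g) = if b then 0 else basis R g.
Proof.
apply: hl2P => h; rewrite partE /=.
by case: b; rewrite ?basisE ?hl20; case: (h == g).
Qed.

Lemma abs_sum_rsum (u : G -> R) : rsum u = abs_sum u.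
Proof. by rewrite abs_sum.unlock. Qed.

Lemma Re_inner xi eta : complex.Re (inner xi eta) =
  ip (part false xi) (part false eta) + ip (part true xi) (part true eta).
Proof.
rewrite /inner /csum /= abs_sum_rsum !ip_abs_sum -abs_sumD; last 2 first.
- by apply: abs_summableM; exact: valP.
- by apply: abs_summableM; exact: valP.
congr abs_sum; apply/funext => g; rewrite !partE.
by case: (xi g) (eta g) => a b [c d] /=; ring.
Qed.

Lemma sqr_norm_part xi : sqr_norm xi =
  ip (part false xi) (part false xi) + ip (part true xi) (part true xi).
Proof.
apply: EFin_inj; rewrite sqr_normE EFinD !ipE -esumD; last 2 first.
- by move=> g _; rewrite lee_fin sqr_ge0.
- by move=> g _; rewrite lee_fin sqr_ge0.
by apply: eq_esum => g _; rewrite /sqr_norm_fun normc_sqr EFinD !partE.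
Qed.

Lemma Im_inner xi eta : complex.Im (inner xi eta) =
  complex.Re (inner xi ('i%C *: eta)).
Proof.
rewrite /inner /csum/=; congr rsum; apply/funext => g.
change (complex.Im (xi g * (eta g)^*%C) = complex.Re (xi g * ('i%C * eta g)^*%C)).
by case: (xi g) (eta g) => a b [c d] /=; ring.
Qed.

End ComplexParts.
Arguments part : simpl never.

(** The boolean index separates real ([false]) and imaginary ([true]) parts, turning complex
    functions into real ones with twice as many coordinates. *)
HB.lock Definition cinc (R : realType) (G : groupType) (I : choiceType) (i : I)
    (xi : l2 R G) : hl2 R ((I * bool) * G)%type :=
  inc (i, false) (part false xi) + inc (i, true) (part true xi).

Section ComplexComponents.
Variables (R : realType) (G : groupType) (I : choiceType).
Local Notation H := (hl2 R ((I * bool) * G)%type).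
Implicit Types (xi eta : l2 R G) (f h : H).

Definition cres (i : I) f : l2 R G := toC (res (i, false) f) (res (i, true) f).

Lemma part_cres b i f : part b (cres i f) = res (i, b) f.
Proof. by rewrite part_toC; case: b. Qed.

Lemma res_cinc (i j : I) b xi : res (i, b) (cinc j xi) = (i == j)%:R *: part b xi.
Proof.
apply: hl2P => g; rewrite cinc.unlock resE hl2D !incE /= !xpair_eqE hl2Z.
by case: b; rewrite /= ?andbT ?andbF mul0r ?addr0 ?add0r.
Qed.

Lemma cincE (i : I) xi j b g : cinc i xi ((j, b), g) = (j == i)%:R * part b xi g.
Proof. by rewrite -resE res_cinc hl2Z. Qed.

Lemma cres_inj f h : (forall i, cres i f = cres i h) -> f = h.
Proof.
move=> fh; apply: hl2P => -[[i b] g].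
by rewrite -!resE -!part_cres fh.
Qed.

Lemma cres_cinc (i j : I) xi : cres i (cinc j xi) = (i == j)%:R *: xi.
Proof.
apply: part_inj => b; rewrite part_cres res_cinc.
by case: eqP => _; rewrite ?scale1r// !scale0r part0.
Qed.

Lemma cinc_adjoint (i : I) xi f : ip (cinc i xi) f = complex.Re (inner xi (cres i f)).
Proof. by rewrite cinc.unlock ipDl !inc_res_adjoint Re_inner !part_cres. Qed.

Lemma ip_cinc (i : I) xi eta : ip (cinc i xi) (cinc i eta) = complex.Re (inner xi eta).
Proof. by rewrite cinc_adjoint cres_cinc eqxx scale1r. Qed.

Lemma sqr_norm_cinc (i : I) xi : ip (cinc i xi) (cinc i xi) = sqr_norm xi.
Proof. by rewrite ip_cinc Re_inner sqr_norm_part. Qed.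

Lemma sqr_norm_cres_le i f : sqr_norm (cres i f) <= ip f f.
Proof.
have e : ip (cinc i (cres i f)) f = sqr_norm (cres i f).
  by rewrite cinc_adjoint Re_inner sqr_norm_part.
have := ip_ge0 (cinc i (cres i f) - f).
rewrite ipBl !ipBr (ipC f (cinc _ _)) sqr_norm_cinc e.
by move: (sqr_norm _) (ip f f) => a b; lra.
Qed.

Definition flip (x : (I * bool) * G) : (I * bool) * G := ((x.1.1, ~~ x.1.2), x.2).

Lemma flipK : involutive flip.
Proof. by case=> [[i b] g]; rewrite /flip /= negbK. Qed.

Lemma Jop_proof f : (fun x : (I * bool) * G => (if x.1.2 then 1 else -1) * f (flip x) : R^o)
  \in @sq_summable R _.
Proof.
apply: (@sq_summable_bounded _ _ _ (ip (pull flip f) (pull flip f))) => s us.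
apply: le_trans (ip_ge_sum (pull flip f) us); apply: ler_sum => x _.
rewrite pullE; last exact: inv_inj flipK.
by case: x.1.2; rewrite exprMn ?sqrrN expr1n mul1r.
Qed.

(* Multiplication by the imaginary unit. *)
Definition Jop f : H := Hl2 (Jop_proof f).

Lemma JopE f i b g : Jop f ((i, b), g) =
  if b then f ((i, false), g) else - f ((i, true), g).
Proof.
have -> : Jop f ((i, b), g) = (if b then 1 else -1) * f ((i, ~~ b), g) by [].
by case: b; rewrite ?mul1r ?mulN1r.
Qed.

Lemma JopB f h : Jop (f - h) = Jop f - Jop h.
Proof.
apply: hl2P => -[[i b] g]; rewrite hl2D hl2N !JopE !hl2D !hl2N.
by case: b => //; rewrite opprB opprK addrC.
Qed.

Lemma JopK f : Jop (Jop f) = - f.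
Proof.
by apply: hl2P => -[[i b] g]; rewrite hl2N !JopE; case: b.
Qed.

Lemma Jop_adjoint f h : ip (Jop f) h = ip f (- Jop h).
Proof.
have pa := @pull_adjoint R _ _ _ _ flipK flipK.
have -> : ip (Jop f) h = ip (pull flip f) (pull flip (- Jop h)).
  rewrite !ip_abs_sum; congr abs_sum; apply/funext => -[[i b] g].
  rewrite !pullE; try exact: inv_inj flipK.
  rewrite /flip /= hl2N !JopE; case: b => //=; last by rewrite mulNr mulrN.
  by rewrite opprK.
by rewrite pa; congr ip; apply: hl2P => x; rewrite !pullE ?flipK//; exact: inv_inj flipK.
Qed.

Lemma cres_Jop i f : cres i (Jop f) = 'i%C *: cres i f.
Proof.
apply: part_inj => b; rewrite partZ !part_cres.
apply: hl2P => g; case: b; rewrite hl2D ?hl2N !hl2Z !resE JopE mul0r mul1r.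
  by rewrite add0r.
by rewrite add0r.
Qed.

Lemma cresD i f h : cres i (f + h) = cres i f + cres i h.
Proof.
by apply: part_inj => b; apply: hl2P => g; rewrite partD hl2D !part_cres !resE.
Qed.

Lemma cresZ i (c : R) f : cres i (c *: f) = c%:C%C *: cres i f.
Proof.
apply: part_inj => b; apply: hl2P => g; rewrite partZ !part_cres resE hl2Z /=.
by case: b; rewrite ?scale0r ?subr0 ?addr0 hl2Z resE.
Qed.

Lemma cinc_linear (i : I) (a : R[i]) xi eta : cinc i (a *: xi + eta) =
  complex.Re a *: cinc i xi + complex.Im a *: Jop (cinc i xi) + cinc i eta.
Proof.
apply: hl2P => -[[j b] g]; rewrite !hl2D !hl2Z JopE !cincE partD partZ.
by case: b => /=; rewrite !hl2D ?hl2N !hl2Z; ring.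
Qed.

Lemma rgt_cinc g (i : I) xi : rgt g (cinc i xi) = cinc i (rho g xi).
Proof. by apply: hl2P => -[[j b] k]; rewrite rgtE !cincE part_rho. Qed.

Lemma cres_rgt g i f : cres i (rgt g f) = rho g (cres i f).
Proof.
by apply: part_inj => b; apply: hl2P => k; rewrite part_cres resE rgtE (part_rho b g (cres i f)) part_cres resE.
Qed.

Lemma cinc_delta (i : I) (g : G) : cinc i (delta R g) = basis R ((i, false), g).
Proof. by rewrite cinc.unlock !part_delta (adjoint0 (@inc_res_adjoint _ _ _ _)) addr0 inc_basis. Qed.

Lemma Jop_basis (i : I) (g : G) : Jop (basis R ((i, false), g)) = basis R ((i, true), g).
Proof.
apply: hl2P => -[[j b] k]; rewrite JopE !basisE !xpair_eqE.
by case: b; rewrite ?andbT ?andbF// oppr0.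
Qed.

End ComplexComponents.

Lemma ler_sum_subset (R : realType) (T : eqType) (F : T -> R) (s t : seq T) :
  uniq s -> uniq t -> {subset s <= t} -> (forall x, 0 <= F x) ->
  \sum_(x <- s) F x <= \sum_(x <- t) F x.
Proof.
move=> us ut st F0.
rewrite (perm_big [seq x <- t | x \in s]) /=; last first.
  apply: uniq_perm => //; first exact: filter_uniq.
  by move=> x; rewrite mem_filter; apply/idP/andP => [xs|[]//]; split=> //; exact: st.
rewrite big_filter big_mkcond /=; apply: ler_sum => x _.
by case: ifP.
Qed.

Section GroupVN.
Variables (R : realType) (G : groupType).
Local Notation L := (group_vN R G).
Implicit Types (a b : L) (xi eta : l2 R G).

Lemma vN_lin a c xi eta : a (c *: xi + eta) = c *: a xi + a eta.
Proof. by have [+ _ _] := group_vNP a; exact. Qed.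

Lemma vN0 a : a 0 = 0.
Proof. by have := vN_lin a (-1) 0 0; rewrite scaler0 addr0 scaleN1r addNr. Qed.

Lemma vND a xi eta : a (xi + eta) = a xi + a eta.
Proof. by have := vN_lin a 1 xi eta; rewrite !scale1r. Qed.

Lemma vNZ a c xi : a (c *: xi) = c *: a xi.
Proof. by have := vN_lin a c xi 0; rewrite vN0 !addr0. Qed.

Lemma vN_sum a I (r : seq I) (F : I -> l2 R G) :
  a (\sum_(i <- r) F i) = \sum_(i <- r) a (F i).
Proof. by elim: r => [|i r IH]; rewrite ?big_nil ?vN0// !big_cons vND IH. Qed.

Lemma vN_rho a g xi : a (rho g xi) = rho g (a xi).
Proof. by have [_ _ +] := group_vNP a => ->. Qed.

Lemma vN_bounded a : exists2 M : R, 0 <= M & forall xi, sqr_norm (a xi) <= M * sqr_norm xi.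
Proof. by have [_ /bounded_opP[M M0 aM] _] := group_vNP a; exists M. Qed.

Lemma vN_eqP a b : (forall xi, a xi = b xi) -> a = b.
Proof. by move=> ab; apply/val_inj/funext. Qed.

Lemma vN_sumE I (r : seq I) (F : I -> L) xi :
  (\sum_(i <- r) F i) xi = \sum_(i <- r) F i xi.
Proof. by elim: r => [|i r IH]; rewrite ?big_nil// !big_cons -IH. Qed.

Definition vN_scale (c : R) a : L := insubd 0 (fun xi => c%:C%C *: a xi).

Lemma vN_scaleE c a xi : vN_scale c a xi = c%:C%C *: a xi.
Proof.
suff E : val (vN_scale c a) = (fun xi => c%:C%C *: a xi).
  exact: (congr1 (fun f => f xi) E).
apply: (insubdK (0 : L)); apply/asboolP; split=> [d x y||g x].
- by rewrite vN_lin scalerDr !scalerA mulrC.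
- have [M M0 aM] := vN_bounded a; apply/bounded_opP.
  exists (Normc.normc (c%:C%C) ^+ 2 * M); first by rewrite mulr_ge0// sqr_ge0.
  move=> x; rewrite -mulrA.
  apply: (@le_trans _ _ (Normc.normc (c%:C%C) ^+ 2 * sqr_norm (a x))).
    by rewrite -lee_fin EFinM !sqr_normE esum_sqr_normZ.
  by rewrite ler_wpM2l// sqr_ge0.
- by rewrite vN_rho; apply/val_inj.
Qed.

End GroupVN.

Section Nice.
Variables (R : realType) (G : groupType).
Local Notation L := (group_vN R G).
Local Notation H I := (hl2 R ((I * bool) * G)%type).

(** The real form of a matrix over [L(G)], possibly of infinite size: commutation with [Jop]
    restores complex linearity. For finite index sets, [vN_entry] and [opmx] pass between the two
    forms. *)
Record nice (I K : choiceType) (T : H I -> H K) : Prop := Nice {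
  nice_lin : forall c x y, T (c *: x + y) = c *: T x + T y;
  nice_bnd : exists2 M, 0 <= M & bounded_by T M;
  nice_rgt : equivariant T;
  nice_J : forall f, T (Jop f) = Jop (T f) }.

Section NiceTheory.
Variables I K : choiceType.
Implicit Types T : H I -> H K.

Lemma niceD T x y : nice T -> T (x + y) = T x + T y.
Proof. by move=> nT; have := nice_lin nT 1 x y; rewrite !scale1r. Qed.

Lemma nice0 T : nice T -> T 0 = 0.
Proof. by move=> nT; have := nice_lin nT (-1) 0 0; rewrite scaler0 addr0 scaleN1r addNr. Qed.

Lemma niceZ T c x : nice T -> T (c *: x) = c *: T x.
Proof. by move=> nT; have := nice_lin nT c x 0; rewrite (nice0 nT) !addr0. Qed.

Lemma nice_adjoint T S : nice T -> adjoint T S -> nice S.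
Proof.
move=> nT TS; have ST := adjointC TS; split.
- by move=> c x y; exact: adjoint_linear ST.
- by have [M M0 TM] := nice_bnd nT; exists M => //; exact: adjoint_bounded TM.
- exact: adjoint_equivariant (nice_rgt nT).
- move=> f; apply: ip_inj => h.
  by rewrite ST !Jop_adjoint ipNr -(nice_J nT) -ST ipNr.
Qed.

Lemma nice_exists_adjoint T : nice T -> exists S, adjoint T S.
Proof.
by move=> nT; have [M M0 TM] := nice_bnd nT; exact: adjoint_exists (nice_lin nT) M0 TM.
Qed.

Definition vN_entry T (k : K) (i : I) : L := insubd 0 (fun xi => cres k (T (cinc i xi))).

Lemma vN_entryE T k i xi : nice T -> vN_entry T k i xi = cres k (T (cinc i xi)).
Proof.
move=> nT; suff E : val (vN_entry T k i) = (fun xi => cres k (T (cinc i xi))).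
  exact: (congr1 (fun f => f xi) E).
apply: (insubdK (0 : L)); apply/asboolP; split=> [d x y||g x].
- rewrite cinc_linear (niceD _ _ nT) cresD; congr (_ + _).
  rewrite (niceD _ _ nT) !(niceZ _ _ nT) cresD !cresZ (nice_J nT) cres_Jop.
  rewrite scalerA -scalerDl; congr (_ *: _); rewrite [RHS]complexE.
  by rewrite mulrC.
- have [M M0 TM] := nice_bnd nT; apply/bounded_opP; exists M => // x.
  apply: le_trans (sqr_norm_cres_le _ _) _.
  by rewrite -(sqr_norm_cinc i); exact: TM.
- by rewrite -rgt_cinc (nice_rgt nT) cres_rgt.
Qed.

End NiceTheory.

Lemma nice_oproj (I : choiceType) (A : set (H I)) :
  (forall g f, ortho A f -> ortho A (rgt g f)) ->
  (forall f, ortho A f -> ortho A (Jop f)) -> nice (oproj A).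
Proof.
move=> Ag AJ; split.
- by move=> c x y; exact: oproj_linear.
- by exists 1 => // x; rewrite mul1r oproj_contract.
- move=> g f; apply: (oproj_comm (U' := rgt g^-1%g)) => [x y|x y|x Ax|x Ax].
  + exact: rgt_adjoint.
  + exact: rgtB.
  + exact: Ag.
  + exact: Ag.
- move=> f; apply: (oproj_comm (U' := fun h => - Jop h)) => [x y|x y|x Ax|x Ax].
  + exact: Jop_adjoint.
  + exact: JopB.
  + exact: AJ.
  + by rewrite -scaleN1r; apply: orthoZ; exact: AJ.
Qed.

Lemma nice_comp (I J K : choiceType) (T : H I -> H J) (U : H J -> H K) :
  nice T -> nice U -> nice (U \o T).
Proof.
move=> nT nU; split.
- by move=> c x y /=; rewrite (nice_lin nT) (nice_lin nU).
- have [[M M0 TM] [N N0 UN]] := (nice_bnd nT, nice_bnd nU).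
  exists (N * M); first exact: mulr_ge0.
  move=> x /=; apply: le_trans (UN _) _; rewrite -mulrA ler_wpM2l//; exact: TM.
- by move=> g f /=; rewrite (nice_rgt nT) (nice_rgt nU).
- by move=> f /=; rewrite (nice_J nT) (nice_J nU).
Qed.

Lemma nice_compl (I : choiceType) (T : H I -> H I) : nice T -> nice (fun x => x - T x).
Proof.
move=> nT; split.
- by move=> c x y; rewrite (nice_lin nT) opprD addrACA scalerBr.
- have [M M0 TM] := nice_bnd nT; exists (2 + 2 * M); first by rewrite addr_ge0// mulr_ge0.
  move=> x; apply: le_trans (ipD_le _ _) _; rewrite ipNl ipNr opprK (mulrDl 2 (2 * M)).
  by rewrite lerD2l -mulrA ler_pM2l//; exact: TM.
- by move=> g f; rewrite (nice_rgt nT) rgtB.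
- by move=> f; rewrite (nice_J nT) JopB.
Qed.

Lemma nice_scale (I K : choiceType) (T : H I -> H K) (c : R) :
  nice T -> nice (fun x => c *: T x).
Proof.
move=> nT; split.
- by move=> d x y; rewrite (nice_lin nT) scalerDr !scalerA mulrC.
- have [M M0 TM] := nice_bnd nT; exists (c ^+ 2 * M); first by rewrite mulr_ge0// sqr_ge0.
  by move=> x; rewrite ipZl ipZr mulrA -expr2 -mulrA ler_wpM2l ?sqr_ge0//; exact: TM.
- by move=> g f; rewrite (nice_rgt nT) rgtZ.
- move=> f; rewrite (nice_J nT); apply: hl2P => -[[i b] g].
  by rewrite hl2Z !JopE !hl2Z; case: b => //; rewrite mulrN.
Qed.

Lemma cres_sum (I : choiceType) T (r : seq T) (F : T -> H I) i :
  cres i (\sum_(t <- r) F t) = \sum_(t <- r) cres i (F t).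
Proof.
elim: r => [|t r IH]; last by rewrite !big_cons cresD IH.
by rewrite !big_nil -[0 in LHS](scale0r 0) cresZ rmorph0 scale0r.
Qed.

Lemma cinc_cres_sum (I : finType) (f : H I) : \sum_i cinc i (cres i f) = f.
Proof.
apply: cres_inj => i; rewrite cres_sum (bigD1 i)//= cres_cinc eqxx scale1r.
by rewrite big1 ?addr0// => j ji; rewrite cres_cinc eq_sym (negPf ji) scale0r.
Qed.

Section Assembly.
Variable K : choiceType.

(** Junk value: [0] when the family [v] is not square summable. *)
Definition casm (v : K -> l2 R G) : H K := insubd 0 (fun x => part x.1.2 (v x.1.1) x.2 : R^o).

Lemma casmP v M : (forall ks, uniq ks -> \sum_(k <- ks) sqr_norm (v k) <= M) ->
  (forall k, cres k (casm v) = v k) /\ ip (casm v) (casm v) <= M.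
Proof.
move=> vM; pose F (x : (K * bool) * G) : R^o := part x.1.2 (v x.1.1) x.2.
have FM (s : seq ((K * bool) * G)) : uniq s -> \sum_(x <- s) (F x : R) ^+ 2 <= M.
  move=> us; pose ks := undup [seq x.1.1 | x <- s].
  have uks : uniq ks by exact: undup_uniq.
  pose Fs : H K := \sum_(k <- ks) cinc k (v k).
  have cFs k : k \in ks -> cres k Fs = v k.
    move=> kk; rewrite cres_sum (bigD1_seq k)//= cres_cinc eqxx scale1r.
    by rewrite big1 ?addr0// => j jk; rewrite cres_cinc eq_sym (negPf jk) scale0r.
  have ipFs : ip Fs Fs = \sum_(k <- ks) sqr_norm (v k).
    rewrite -[in LHS]/(ip (\sum_(k <- ks) cinc k (v k)) Fs) ip_suml.
    rewrite big_seq [RHS]big_seq; apply: eq_bigr => k kk.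
    by rewrite cinc_adjoint cFs// Re_inner sqr_norm_part.
  apply: le_trans (vM _ uks); rewrite -ipFs.
  apply: le_trans (ip_ge_sum Fs us); rewrite big_seq [leRHS]big_seq.
  apply: ler_sum => -[[k b] g] xs; rewrite /F /=.
  have kk : k \in ks by rewrite mem_undup; apply/mapP; eexists; [exact: xs|].
  by rewrite -(cFs k kk) part_cres resE.
have FH : F \in @sq_summable R _ by exact: sq_summable_bounded FM.
have cE : casm v = F :> (_ -> _).
  by rewrite /hl2_fun /casm insubdK.
split=> [k|]; last by apply: ip_le_bound => s us; rewrite cE; exact: FM.
by apply: part_inj => b; apply: hl2P => g; rewrite part_cres resE cE.
Qed.

End Assembly.

Section OperatorOfMatrix.
Variables (I : finType) (K : choiceType) (z : K -> I -> L) (M : R).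

Definition opmx (f : H I) : H K := casm (fun k => \sum_i z k i (cres i f)).

(** Bounds over finite sets of rows suffice to make [opmx] meaningful when there are infinitely
    many. *)
Definition opmx_bounded := forall f ks, uniq ks ->
  \sum_(k <- ks) sqr_norm (\sum_i z k i (cres i f)) <= M * ip f f.

Hypothesis zM : opmx_bounded.

Lemma cres_opmx k f : cres k (opmx f) = \sum_i z k i (cres i f).
Proof. by have [+ _] := casmP (zM f). Qed.

Lemma opmx_bound : bounded_by opmx M.
Proof. by move=> f; have [_] := casmP (zM f). Qed.

Lemma nice_opmx : 0 <= M -> nice opmx.
Proof.
move=> M0; split.
- move=> c x y; apply: cres_inj => k; rewrite cresD cresZ !cres_opmx.
  rewrite scaler_sumr -big_split; apply: eq_bigr => i _ /=.
  by rewrite cresD cresZ vN_lin.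
- by exists M => //; exact: opmx_bound.
- move=> g f; apply: cres_inj => k; rewrite cres_rgt !cres_opmx.
  under eq_bigr do rewrite cres_rgt vN_rho.
  elim/big_rec2: _ => [|i u v _ ->]; first by rewrite rho0.
  by rewrite rhoD.
- move=> f; apply: cres_inj => k; rewrite cres_Jop !cres_opmx scaler_sumr.
  by apply: eq_bigr => i _; rewrite cres_Jop vNZ.
Qed.

End OperatorOfMatrix.

Lemma comb_bounded (I : finType) (z : I -> L) : exists2 M : R, 0 <= M &
  forall f : H I, sqr_norm (\sum_i z i (cres i f)) <= M * ip f f.
Proof.
elim: (index_enum I) => [|i r [M M0 rM]].
  by exists 0 => // f; rewrite big_nil sqr_norm0 mul0r.
have [N N0 iN] := vN_bounded (z i).
exists (2 * N + 2 * M); first by rewrite addr_ge0// mulr_ge0.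
move=> f; rewrite big_cons; apply: le_trans (sqr_normD _ _) _.
rewrite (mulrDl (2 * N)) -!mulrA lerD// ler_pM2l//.
by apply: le_trans (iN _) _; rewrite ler_wpM2l// sqr_norm_cres_le.
Qed.

Lemma opmx_bounded_fin (I K : finType) (z : K -> I -> L) :
  exists2 M, 0 <= M & opmx_bounded z M.
Proof.
have ex k : exists M, 0 <= M /\
    forall f : H I, sqr_norm (\sum_i z k i (cres i f)) <= M * ip f f.
  by have [M M0 h] := comb_bounded (z k); exists M.
have [M MP] := choice ex; exists (\sum_k M k).
  by apply: sumr_ge0 => k _; have [] := MP k.
move=> f ks uks; rewrite mulr_suml.
apply: (@le_trans _ _ (\sum_(k <- ks) M k * ip f f)).
  by apply: ler_sum => k _; have [_] := MP k; exact.
apply: ler_sum_subset => // [|k _|k]; first exact: index_enum_uniq.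
  exact: mem_index_enum.
by rewrite mulr_ge0 ?ip_ge0//; have [] := MP k.
Qed.

Lemma geometric_weights (K : choiceType) (code : K -> nat) (ks : seq K) :
  injective code -> uniq ks -> \sum_(k <- ks) (2^-1 : R) ^+ (code k).+1 <= 1.
Proof.
move=> ic uks; pose N := (\max_(k <- ks) code k).+1.
have geo m : \sum_(i <- iota 0 m) (2^-1 : R) ^+ i.+1 = 1 - 2^-1 ^+ m.
  elim: m => [|m IH]; first by rewrite big_nil expr0 subrr.
  rewrite -[m.+1]addn1 iotaD big_cat big_seq1/= IH add0n addn1.
  by rewrite !exprS; move: (_ ^+ m) => u; lra.
rewrite -(big_map code xpredT (fun m => 2^-1 ^+ m.+1)).
apply: (@le_trans _ _ (\sum_(i <- iota 0 N) (2^-1 : R) ^+ i.+1)).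
  apply: ler_sum_subset; rewrite ?map_inj_uniq ?iota_uniq//.
  move=> _ /mapP[k kk ->]; rewrite mem_iota add0n /= ltnS.
  exact: (leq_bigmax_seq (F := code) k kk).
by rewrite geo gerBl exprn_ge0// invr_ge0.
Qed.

(** The weight is [2^-1 ^+ (code k).+1 / (4 + M k)]. Here [M k] bounds row [k], which makes the
    weighted operator a contraction, and 4 bounds the square of the norm of [lamL k - 1], which
    makes the weighted coboundary map of [zD_bounded] one as well. *)
Lemma weights_exist (I : finType) (K : choiceType) (code : K -> nat) (z : K -> I -> L) :
  injective code -> exists w : K -> R, [/\ forall k, 0 < w k,
    opmx_bounded (fun k i => vN_scale (w k) (z k i)) 1
    & forall ks, uniq ks -> \sum_(k <- ks) 4 * w k ^+ 2 <= 1].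
Proof.
move=> ic.
have ex k : exists M, 0 <= M /\
    forall f : H I, sqr_norm (\sum_i z k i (cres i f)) <= M * ip f f.
  by have [M M0 h] := comb_bounded (z k); exists M.
have [M MP] := choice ex.
have M0 k : 0 <= M k by have [] := MP k.
pose w k : R := 2^-1 ^+ (code k).+1 / (4 + M k).
have d0 k : 0 < 4 + M k by have := M0 k; lra.
have g0 k : 0 < (2^-1 : R) ^+ (code k).+1 by rewrite exprn_gt0// invr_gt0.
have w0 k : 0 < w k by rewrite divr_gt0.
have wM k c : 0 <= c <= 4 + M k -> w k ^+ 2 * c <= 2^-1 ^+ (code k).+1.
  move=> /andP[c0 cM]; apply: (@le_trans _ _ (w k ^+ 2 * (4 + M k))).
    by rewrite ler_wpM2l ?sqr_ge0.
  have g1 : (2^-1 : R) ^+ (code k).+1 <= 1.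
    by rewrite exprn_ile1// ?invr_ge0// invf_le1// ler1n.
  have D4 : 4 <= 4 + M k by rewrite lerDl.
  rewrite /w; move: (_ ^+ (code k).+1) (4 + M k) g1 (g0 k) (d0 k) D4 => g D g1 g0' D0 D4.
  have -> : (g / D) ^+ 2 * D = g ^+ 2 / D by field; rewrite gt_eqF.
  by rewrite ler_pdivrMr// expr2 ler_pM2l//; lra.
exists w; split=> //.
- move=> f ks uks; rewrite mul1r.
  have -> : ip f f = 1 * ip f f by rewrite mul1r.
  apply: (@le_trans _ _ (\sum_(k <- ks) 2^-1 ^+ (code k).+1 * ip f f)); last first.
    by rewrite -mulr_suml ler_wpM2r ?ip_ge0// geometric_weights.
  apply: ler_sum => k _.
  have -> : \sum_i vN_scale (w k) (z k i) (cres i f) = (w k)%:C%C *: \sum_i z k i (cres i f).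
    by rewrite scaler_sumr; apply: eq_bigr => i _; rewrite vN_scaleE.
  have -> u : sqr_norm ((w k)%:C%C *: u) = w k ^+ 2 * sqr_norm u.
    by rewrite !sqr_norm_part !partZ /= !scale0r addr0 subr0 !ipZl !ipZr; ring.
  apply: (@le_trans _ _ (w k ^+ 2 * (M k * ip f f))).
    by rewrite ler_wpM2l ?sqr_ge0//; have [_] := MP k; exact.
  rewrite mulrA ler_wpM2r ?ip_ge0// wM// M0/=.
  by rewrite lerDr.
- move=> ks uks; apply: le_trans (geometric_weights ic uks); apply: ler_sum => k _.
  by rewrite mulrC wM// lerDl M0 andbT.
Qed.

End Nice.

(** * Cocycles and their cohomology classes *)

Section FirstCohomology.
Variables (R : realType) (G : groupType).
Local Notation L := (group_vN R G).
Local Open Scope quotient_scope.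

Definition prH (z : Z1 R G) : H1 R G :=
  \pi_(Quotient.quot (submod_zmodClosed (@B1_closed R G))) z.

Lemma prH_surj (x : H1 R G) : exists z, prH z = x.
Proof. by exists (repr x); rewrite /prH reprK. Qed.

Lemma prHD z z' : prH (z + z') = prH z + prH z'.
Proof. by rewrite /prH raddfD. Qed.

Lemma prHZ (a : L^c) z : prH (a *: z) = a *: prH z.
Proof. by rewrite /prH -quot_scale_pi. Qed.

Lemma prH_eq0 z : prH z = 0 <-> exists a : L, val z = d0 a.
Proof.
have -> : prH z = 0 <-> z \in submod_zmodClosed (@B1_closed R G).
  rewrite -[z in z \in _]subr0; split=> [|] h.
    by rewrite Quotient.idealrBE; apply/eqP; rewrite raddf0.
  by apply/eqP; rewrite /prH -(raddf0 (\pi_(Quotient.quot (submod_zmodClosed (@B1_closed R G))))) -Quotient.idealrBE.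
by split=> [/asboolP|h] //; apply/asboolP.
Qed.

Lemma prH_sum I (r : seq I) (F : I -> Z1 R G) :
  prH (\sum_(i <- r) F i) = \sum_(i <- r) prH (F i).
Proof.
elim: r => [|i r IH]; last by rewrite !big_cons prHD IH.
rewrite !big_nil; apply/prH_eq0; exists 0; rewrite -[LHS]/(0 : G -> L).
by apply/funext => g; rewrite /d0 mulr0 subr0.
Qed.

Lemma Z1_cocycle (z : Z1 R G) g h : z (g * h)%g = lamL R g * z h + z g.
Proof.
have /asboolP /(congr1 (fun f => f (g, h))) := valP z; rewrite /d1 /= => e.
have {}e : lamL R g * z h - z (g * h)%g + z g = 0 by exact: e.
by apply/eqP; rewrite -subr_eq0 -oppr_eq0 opprB -[X in _ == X]e addrAC.
Qed.

Lemma Z1P (z z' : Z1 R G) : (forall g, z g = z' g) -> z = z'.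
Proof. by move=> e; apply/val_inj/funext. Qed.

Lemma lamLM (g h : G) : lamL R (g * h)%g = lamL R g * lamL R h.
Proof. by apply: vN_eqP => xi; apply/val_inj/funext => k /=; rewrite invgM mulgA. Qed.

Lemma d0_in_Z1 (a : L) : d0 a \in @Z1_pred R G.
Proof.
apply/asboolP/funext => -[g h].
change (lamL R g * (lamL R h * a - a) - (lamL R (g * h)%g * a - a) +
  (lamL R g * a - a) = 0 :> L).
rewrite lamLM mulrBr mulrA; move: (lamL R g * lamL R h * a) (lamL R g * a) => x y.
by rewrite opprB [X in X + _]addrC !subrKA subrr.
Qed.

End FirstCohomology.

Lemma cres0 (R : realType) (G : groupType) (I : choiceType) (i : I) :
  cres i (0 : hl2 R ((I * bool) * G)%type) = 0.
Proof. by rewrite -(scale0r 0) cresZ rmorph0 scale0r. Qed.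

Section RealInner.
Variables (R : realType) (G : groupType).
Implicit Types xi eta : l2 R G.

Definition rip xi eta : R := complex.Re (inner xi eta).

Lemma ripE xi eta : rip xi eta =
  ip (part false xi) (part false eta) + ip (part true xi) (part true eta).
Proof. exact: Re_inner. Qed.

Lemma rip_suml I (r : seq I) (F : I -> l2 R G) eta :
  rip (\sum_(i <- r) F i) eta = \sum_(i <- r) rip (F i) eta.
Proof.
elim: r => [|i r IH]; first by rewrite !big_nil ripE !part0 !ip0l addr0.
by rewrite !big_cons -IH !ripE !partD !ipDl addrACA.
Qed.

Lemma ripC xi eta : rip xi eta = rip eta xi.
Proof. by rewrite !ripE ipC [X in _ + X]ipC. Qed.

Lemma rip_sumr I (r : seq I) (F : I -> l2 R G) eta :
  rip eta (\sum_(i <- r) F i) = \sum_(i <- r) rip eta (F i).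
Proof. by rewrite ripC rip_suml; apply: eq_bigr => i _; rewrite ripC. Qed.

Lemma ip_cres (I : finType) (f h : hl2 R ((I * bool) * G)%type) :
  ip f h = \sum_i rip (cres i f) (cres i h).
Proof.
rewrite -{1}(cinc_cres_sum f) ip_suml; apply: eq_bigr => i _.
by rewrite cinc_adjoint.
Qed.

End RealInner.

(** * Bounds for the first Betti number *)

Section UpperBound.
Variables (R : realType) (G : groupType) (K : choiceType) (code : K -> nat).
Variable h : K -> G.
Local Notation L := (group_vN R G).
Hypothesis code_inj : injective code.
Hypothesis vanishing : forall z : Z1 R G, (forall k, z (h k) = 0) -> z = 0.
Hypothesis d0_inj : forall a : L, d0 a = 0 -> a = 0.

Lemma Z1_sumE I (r : seq I) (F : I -> Z1 R G) g :
  (\sum_(i <- r) F i) g = \sum_(i <- r) F i g.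
Proof. by elim: r => [|i r IH]; rewrite ?big_nil// !big_cons -IH. Qed.

Section Embedding.
Variables (n : nat) (q : 'M[L]_n) (phi : 'cV[L]_n -> H1 R G).
Hypotheses (q_proj : mx_projection q) (phi_lin : rlinear_on (mx_range q) phi).
Hypothesis phi_inj : set_inj (mx_range q) phi.

Let range0 : mx_range q 0.
Proof. by exists 0 => //; rewrite mulmx0. Qed.

Let rangeD u v : mx_range q u -> mx_range q v -> mx_range q (u + v).
Proof. by move=> [x _ <-] [y _ <-]; exists (x + y) => //; rewrite mulmxDr. Qed.

Let rangeM u (a : L) : mx_range q u -> mx_range q (u *m a%:M).
Proof. by move=> [x _ <-]; exists (x *m a%:M) => //; rewrite mulmxA. Qed.

Let phi0 : phi 0 = 0.
Proof.
have [phiD _] := phi_lin; have := phiD 0 0 range0 range0.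
by rewrite addr0 => /eqP; rewrite -subr_eq0 opprD addrA subrr add0r oppr_eq0 => /eqP.
Qed.

Let q_mul (v : 'cV[L]_n) : q *m (q *m v) = q *m v.
Proof. by rewrite mulmxA; have [_ ->] := q_proj. Qed.

(** [z j] lifts the class of the [j]-th column of [q]. A right-linear map on the range of [q] is
    determined by these columns, but the lifts themselves need not respect [q], whence [q *m v] only
    on the left. *)
Lemma phi_lift : exists z : 'I_n -> Z1 R G, forall v : 'cV[L]_n,
  phi (q *m v) = prH (\sum_j (v j 0 : L^c) *: z j).
Proof.
have [z zP] := choice (fun j : 'I_n => prH_surj (phi (q *m delta_mx j 0))).
exists z => v; have [phiD phiM] := phi_lin.
have vE : v = \sum_j delta_mx j 0 *m (v j 0)%:M.
  apply/matrixP => i k; rewrite ord1 summxE (bigD1 i)//= [X in _ + X]big1 ?addr0.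
    by rewrite !mxE big_ord1 !mxE !eqxx mul1r mulr1n.
  move=> j ji; rewrite !mxE big_ord1 !mxE eq_sym (negPf ji) mul0r//.
rewrite {1}vE mulmx_sumr prH_sum.
have key (r : seq 'I_n) :
    phi (\sum_(j <- r) q *m (delta_mx j 0 *m (v j 0)%:M)) =
      \sum_(j <- r) prH ((v j 0 : L^c) *: z j) /\
    mx_range q (\sum_(j <- r) q *m (delta_mx j 0 *m (v j 0)%:M)).
  elim: r => [|j r [IH1 IH2]]; first by rewrite !big_nil.
  have rj : mx_range q (q *m delta_mx j 0) by exists (delta_mx j 0).
  rewrite !big_cons mulmxA; split; last by apply: rangeD => //; exact: rangeM.
  by rewrite phiD//; [rewrite IH1 phiM// prHZ zP|exact: rangeM].
by have [] := key (index_enum _).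
Qed.

Local Notation I := ('I_n + 'I_1)%type.
Local Notation H := (hl2 R ((I * bool) * G)%type).

(** The direct sum of [q] and 1; the additional coordinate stands for the inner derivations. *)
Let qhat (i j : I) : L := match i, j with
  | inl a, inl b => q a b | inr _, inr _ => 1 | _, _ => 0 end.

Let vN_zero xi : (0 : L) xi = 0. Proof. by []. Qed.
Let vN_oneE xi : (1 : L) xi = xi. Proof. by []. Qed.
Let vN_mulE (a b : L) xi : (a * b) xi = a (b xi). Proof. by []. Qed.
Let vN_addE (a b : L) xi : (a + b) xi = a xi + b xi. Proof. by []. Qed.
Let vN_subE (a b : L) xi : (a - b) xi = a xi - b xi. Proof. by []. Qed.
Let rip0l (xi : l2 R G) : rip 0 xi = 0 :> R.
Proof. by rewrite ripE !part0 !ip0l addr0. Qed.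

Lemma qhat_adj i j xi eta : rip (qhat i j xi) eta = rip xi (qhat j i eta).
Proof.
case: i j => [a|a] [b|b] /=; rewrite ?vN_zero ?vN_oneE//.
- by have [qa _] := q_proj; rewrite /rip qa.
- by rewrite rip0l ripC rip0l.
- by rewrite rip0l ripC rip0l.
Qed.

Lemma qhat_idem i k : \sum_j qhat i j * qhat j k = qhat i k.
Proof.
rewrite big_sumType/= big_ord1; case: i k => [a|a] [b|b] /=.
- by have [_ qq] := q_proj; rewrite mulr0 addr0 -[in RHS]qq mxE.
- by rewrite mulr1 big1 ?add0r// => j _; rewrite mulr0.
- by rewrite mulr0 addr0 big1// => j _; rewrite mul0r.
- by rewrite mulr1 big1 ?add0r// => j _; rewrite mul0r.
Qed.

Let Qb : exists2 M, 0 <= M & opmx_bounded qhat M := opmx_bounded_fin qhat.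
Let Q : H -> H := opmx qhat.

Let QE i f : cres i (Q f) = \sum_j qhat i j (cres j f).
Proof. by have [M _ QM] := Qb; exact: cres_opmx QM _ _. Qed.

Let nQ : nice Q.
Proof. by have [M M0 QM] := Qb; exact: nice_opmx QM M0. Qed.

Let Qadj : adjoint Q Q.
Proof.
move=> f g; rewrite !ip_cres.
under eq_bigr => i _.
  rewrite QE rip_suml; under eq_bigr => j _ do rewrite qhat_adj.
  over.
rewrite exchange_big/=; apply: eq_bigr => j _.
by rewrite QE rip_sumr.
Qed.

Let QK f : Q (Q f) = Q f.
Proof.
apply: cres_inj => i; rewrite !QE.
under eq_bigr => j _ do rewrite QE vN_sum.
rewrite exchange_big/=; apply: eq_bigr => k _.
by rewrite -(qhat_idem i k) vN_sumE; apply: eq_bigr => j _; rewrite vN_mulE.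
Qed.

Let Qcontract f : ip (Q f) (Q f) <= ip f f.
Proof.
have e : ip (Q f) (Q f) = ip (Q f) f by rewrite Qadj QK -Qadj.
have := ip_ge0 (f - Q f); rewrite ipBl !ipBr (ipC f) -e.
by move: (ip (Q f) _) (ip f f) => a b; lra.
Qed.

Let Q_diag i b : ip (Q (basis R ((i, b), 1%g))) (Q (basis R ((i, b), 1%g))) =
  complex.Re (tau (qhat i i)).
Proof.
have JJ (f : H) : ip (Jop f) (Jop f) = ip f f by rewrite Jop_adjoint JopK opprK.
have -> : ip (Q (basis R ((i, b), 1%g))) (Q (basis R ((i, b), 1%g))) =
    ip (Q (basis R ((i, false), 1%g))) (Q (basis R ((i, false), 1%g))).
  by case: b; [rewrite -Jop_basis (nice_J nQ) JJ|].
rewrite Qadj QK -cinc_delta cinc_adjoint QE; rewrite -/(rip _ _) rip_sumr.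
rewrite (bigD1 i)//= cres_cinc eqxx scale1r big1 ?addr0 => [|j ji]; last first.
  by rewrite cres_cinc (negPf ji) scale0r vN0 ripC rip0l.
by rewrite ripC.
Qed.

(* The families [F] are the weighted restrictions to the [h k] of the cocycles in a
   lift of the submodule, and of the inner derivations, which contribute the [+ 2]. *)
Lemma upper_bound (d : R) : d = \sum_(i < n) complex.Re (tau (q i i)) ->
  exists w : K -> R, [/\ forall k, 0 < w k,
    forall ks, uniq ks -> \sum_(k <- ks) 4 * w k ^+ 2 <= 1
    & forall pi : K * bool -> hl2 R ((K * bool) * G)%type,
      (forall F x, (exists u : G -> l2 R G,
           (forall g g', u (g * g')%g = lam g (u g') + u g) /\
           forall k, cres k F = (w k)%:C%C *: u (h k)) ->
         F (x, 1%g) = ip (pi x) F) ->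
      ((2 * d + 2)%:E <= esum [set: K * bool] (fun x => (ip (pi x) (pi x))%:E))%E].
Proof.
move=> dE; have [z phiz] := phi_lift.
(* The columns [inl j] are the lifted cocycles multiplied by [q], the column [inr] is the coboundary
   [lamL g - 1]. *)
pose Z (g : G) (i : I) : L :=
  match i with inl j => \sum_i z i g * q i j | inr _ => lamL R g - 1 end.
have [w [w0 wT w4]] := weights_exist (fun k => Z (h k)) code_inj.
exists w; split=> // pi piP.
pose Zw k i := vN_scale (w k) (Z (h k) i).
pose T : H -> hl2 R ((K * bool) * G)%type := opmx Zw.
have nT : nice T by exact: nice_opmx wT ler01.
have TE k f : cres k (T f) = (w k)%:C%C *: \sum_i Z (h k) i (cres i f).
  by rewrite (cres_opmx wT) scaler_sumr; apply: eq_bigr => i _; rewrite vN_scaleE.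
have T1 : bounded_by T 1 by exact: opmx_bound wT.
have [S TS] := nice_exists_adjoint nT.
have kerP f : ortho (range S) f <-> T f = 0 by exact: (ortho_rangeP TS f).
pose E := oproj (range S).
have nE : nice E.
  apply: nice_oproj => [g f /kerP Tf|f /kerP Tf]; apply/kerP.
    by rewrite (nice_rgt nT) Tf (adjoint0 (rgt_adjoint g)).
  rewrite (nice_J nT) Tf; apply: hl2P => -[[k b] g].
  by rewrite JopE !hl20 oppr0; case: b.
have TEf f : T (E f) = 0 by apply/kerP; exact: oproj_in.
(* The entries of [E] form a column [v] and a scalar [a]. That [T] kills the range of [E] says that
   the cocycle [\sum_i z i * (q *m v) i 0 + d0 a] vanishes on all [h k], so it is zero. Injectivity
   of [phi] gives [q *m v = 0], then [d0_inj] gives [a = 0], and together these say that [Q] kills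
   the range of [E]. *)
have QE0 f : Q (E f) = 0.
  rewrite -(cinc_cres_sum f).
  have -> : Q (E (\sum_i cinc i (cres i f))) = \sum_i Q (E (cinc i (cres i f))).
    elim: (index_enum _) => [|i r IH]; last by rewrite !big_cons (niceD _ _ nE) (niceD _ _ nQ) IH.
    by rewrite !big_nil (nice0 nE) (nice0 nQ).
  rewrite big1// => l _; set xi := cres l f.
  pose v := \col_j vN_entry E (inl j : I) l.
  pose a := vN_entry E (inr ord0 : I) l.
  have entE i eta : vN_entry E i l eta = cres i (E (cinc l eta)) by exact: vN_entryE.
  have rel k : \sum_i z i (h k) * (q *m v) i 0 + (lamL R (h k) * a - a) = 0.
    apply: vN_eqP => eta.
    have /(congr1 (cres k)) := TEf (cinc l eta).
    rewrite TE cres0 => /eqP.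
    rewrite scaler_eq0 => /orP[/eqP wk0|/eqP].
      have := w0 k; have -> : w k = 0 by case: wk0.
      by rewrite ltxx.
    rewrite big_sumType big_ord1 => e0.
    have {e0}e : \sum_j (\sum_i z i (h k) * q i j) (cres (inl j) (E (cinc l eta))) +
        (lamL R (h k) - 1) (cres (inr ord0) (E (cinc l eta))) = 0 by exact: e0.
    rewrite vN_subE vN_oneE -!entE in e.
    rewrite vN_zero -[RHS]e vN_addE vN_subE vN_mulE; congr (_ + _).
    rewrite vN_sumE; under [RHS]eq_bigr => j _ do rewrite vN_sumE -entE.
    rewrite [RHS]exchange_big; apply: eq_bigr => i _.
    rewrite vN_mulE mxE vN_sumE vN_sum; apply: eq_bigr => j _.
    by rewrite !vN_mulE mxE.
  pose da : Z1 R G := Cocycle (d0_in_Z1 a).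
  have zz0 : \sum_i ((q *m v) i 0 : L^c) *: z i + da = 0.
    apply: vanishing => k; rewrite -[RHS](rel k).
    rewrite -[LHS]/((\sum_i ((q *m v) i 0 : L^c) *: z i) (h k) + (lamL R (h k) * a - a)).
    by rewrite Z1_sumE.
  have qv0 : q *m v = 0.
    have : phi (q *m (q *m v)) = phi 0.
      rewrite phiz phi0; apply/prH_eq0; exists (- a).
      have -> : \sum_i ((q *m v) i 0 : L^c) *: z i = - da.
        by apply/eqP; rewrite -addr_eq0 zz0.
      apply/funext => g; rewrite /d0 mulrN opprK.
      by rewrite -[LHS]/(- (lamL R g * a - a)) opprB addrC.
    rewrite q_mul => /phi_inj; rewrite !inE; apply; last exact: range0.
    by exists v.
  have a0 : a = 0.
    apply: d0_inj; apply/funext => g; rewrite -[LHS]/(da g).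
    have : da = 0.
      by rewrite -[LHS]add0r -[RHS]zz0 qv0; congr (_ + _); rewrite big1// => i _; rewrite mxE scale0r.
    by move=> ->.
  apply: cres_inj => i; rewrite QE.
  rewrite cres0.
  under eq_bigr => j _ do rewrite -entE.
  rewrite big_sumType big_ord1/=; case: i => [i|i].
    rewrite vN_zero addr0.
    have /colP/(_ i) := qv0; rewrite !mxE => /(congr1 (fun b : L => b xi)).
    rewrite vN_sumE => e; rewrite -[RHS]e; apply: eq_bigr => j _.
    by rewrite vN_mulE mxE.
  by rewrite big1 ?add0r// -/a a0.
have piT x f : T f (x, 1%g) = ip (pi x) (T f).
  apply: piP; exists (fun g => \sum_i Z g i (cres i f)); split=> [g g'|k]; last exact: TE.
  have -> : lam g (\sum_i Z g' i (cres i f)) = lamL R g (\sum_i Z g' i (cres i f)) by [].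
  rewrite vN_sum -big_split; apply: eq_bigr => i _.
  rewrite -[RHS]/((lamL R g * Z g' i + Z g i) (cres i f)).
  congr (vN_op _ _); case: i => [j|j]; rewrite /Z.
    rewrite mulr_sumr -big_split; apply: eq_bigr => i _ /=.
    by rewrite Z1_cocycle mulrDl mulrA.
  by rewrite lamLM mulrBr mulr1 addrA subrK.
apply: le_trans (rank_inequality TS T1 (nice_rgt nT) piT (index_enum_uniq (I * bool)%type)).
rewrite lee_fin.
apply: (@le_trans _ _ (\sum_(x : I * bool) ip (Q (basis R (x, 1%g))) (Q (basis R (x, 1%g))))).
  rewrite -(pair_bigA _ (fun i b => ip (Q (basis R ((i, b), 1%g))) (Q (basis R ((i, b), 1%g)))))/=.
  under eq_bigr => i _.
    under eq_bigr => b _ do rewrite Q_diag.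
    rewrite big_bool; over.
  have tr1 : complex.Re (tau (qhat (inr ord0) (inr ord0))) = 1.
    rewrite /qhat /tau -[complex.Re _]/(rip (delta R 1%g) (delta R 1%g)) ripE !part_delta.
    by rewrite ip_basis2 eqxx ip0l addr0.
  have trd : \sum_j complex.Re (tau (qhat (inl j) (inl j))) = d by rewrite dE.
  by rewrite big_sumType big_ord1 big_split trd tr1 -[leRHS]/(d + d + (1 + 1)); lra.
(* As [Q] kills the kernel of [T], it factors through [1 - E], and contractivity compares the
   diagonal terms. *)
apply: ler_sum => x _; set bx := basis R (x, 1%g).
have -> : Q bx = Q (bx - E bx).
  by rewrite (adjointB _ _ Qadj) QE0 subr0.
exact: Qcontract.
Qed.

End Embedding.
End UpperBound.

Lemma push_basis (R : realType) (X Y : choiceType) (e : X -> Y) (ie : injective e) x :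
  push ie (basis R x) = basis R (e x).
Proof.
apply: ip_inj => f; rewrite (adjointC (@push_adjoint R _ _ _ ie)).
by rewrite ipC ip_basis pullE// ipC ip_basis.
Qed.

(** * Weighted cocycles and the trace of their projection *)

Section LowerBound.
Variables (R : realType) (G : groupType) (w : G -> R).
Local Notation L := (group_vN R G).
Hypothesis w0 : forall k, 0 < w k.
Hypothesis w4 : forall ks, uniq ks -> \sum_(k <- ks) 4 * w k ^+ 2 <= 1.
Local Notation H I := (hl2 R ((I * bool) * G)%type).

Definition unweight (f : H G) (k : G) : l2 R G := ((w k)^-1)%:C%C *: cres k f.

(* Orthogonality to these vectors characterizes the families [w k *: u k] with [u] a
   cocycle. *)
Definition cocycle_relations : set (H G) :=
  [set a | exists k l b g, a = (w l)^-1 *: basis R ((l, b), (k^-1 * g)%g)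
    - (w (k * l)%g)^-1 *: basis R (((k * l)%g, b), g) + (w k)^-1 *: basis R ((k, b), g)].

Lemma part_unweight b f k g : part b (unweight f k) g = (w k)^-1 * f ((k, b), g).
Proof.
by rewrite partZ /=; case: b; rewrite scale0r ?addr0 ?subr0 hl2Z part_cres resE.
Qed.

Lemma cocycle_relationsP f : ortho cocycle_relations f <->
  forall k l, unweight f (k * l)%g = lam k (unweight f l) + unweight f k.
Proof.
split=> [fA k l|fc _ [k [l [b [g ->]]]]].
  apply: part_inj => b; apply: hl2P => g; rewrite partD hl2D part_lam lftE !part_unweight.
  have /fA : cocycle_relations ((w l)^-1 *: basis R ((l, b), (k^-1 * g)%g)
    - (w (k * l)%g)^-1 *: basis R (((k * l)%g, b), g) + (w k)^-1 *: basis R ((k, b), g)).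
    by exists k, l, b, g.
  rewrite ipDr ipBr !ipZr !ip_basis => e.
  by apply/eqP; rewrite -subr_eq0 -oppr_eq0 opprB -[X in _ == X]e addrAC.
have /(congr1 (fun u => part b u g)) := fc k l.
rewrite partD hl2D part_lam lftE !part_unweight ipDr ipBr !ipZr !ip_basis => ->.
by rewrite opprD addrA subrr sub0r addNr.
Qed.

(** [D] is the weighted coboundary map [xi |-> (w k (lam k xi - xi))_k], a contraction by [w4]. *)
Let zD (k : G) (i : 'I_1) : L := vN_scale (w k) (lamL R k - 1).
Let D : H 'I_1 -> H G := opmx zD.

Let sqr_normZ (c : R) (x : l2 R G) : sqr_norm (c%:C%C *: x) = c ^+ 2 * sqr_norm x.
Proof. by rewrite !sqr_norm_part !partZ /= !scale0r addr0 subr0 !ipZl !ipZr; ring. Qed.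

Let zD_bounded : opmx_bounded zD 1.
Proof.
move=> f ks uks; rewrite mul1r.
apply: (@le_trans _ _ (\sum_(k <- ks) 4 * w k ^+ 2 * sqr_norm (cres ord0 f))).
  apply: ler_sum => k _; rewrite big_ord1 vN_scaleE sqr_normZ.
  rewrite -mulrA mulrCA ler_wpM2l ?sqr_ge0//.
  have -> : (lamL R k - 1) (cres ord0 f) = lam k (cres ord0 f) + - cres ord0 f by [].
  by apply: le_trans (sqr_normD _ _) _; rewrite sqr_norm_lam sqr_normN; lra.
rewrite -mulr_suml; apply: le_trans (sqr_norm_cres_le ord0 f).
by rewrite ler_piMl ?sqr_norm_ge0// w4.
Qed.

Let nD : nice D. Proof. exact: nice_opmx zD_bounded ler01. Qed.

Let unweight_D f k : unweight (D f) k = lam k (cres ord0 f) - cres ord0 f.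
Proof.
rewrite /unweight (cres_opmx zD_bounded) big_ord1 vN_scaleE scalerA -rmorphM/=.
by rewrite mulVf ?gt_eqF// scale1r.
Qed.

Let lamD k (x y : l2 R G) : lam k (x + y) = lam k x + lam k y.
Proof. exact/val_inj. Qed.
Let lamN k (x : l2 R G) : lam k (- x) = - lam k x.
Proof. exact/val_inj. Qed.
Let lamM k l (x : l2 R G) : lam (k * l)%g x = lam k (lam l x).
Proof. by apply/val_inj/funext => g /=; rewrite invgM mulgA. Qed.

Let D_cocycle f : ortho cocycle_relations (D f).
Proof.
apply/cocycle_relationsP => k l; rewrite !unweight_D lamM lamD lamN.
by rewrite addrA subrK.
Qed.

(** [P] projects onto the weighted cocycles and [P'] onto those orthogonal to all coboundaries. [N]
    projects onto the orthogonal complement of the coboundaries, so that [x - N x] is the component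
    of [x] in their closure. *)
Let P := oproj cocycle_relations.
Let P' := oproj (cocycle_relations `|` range D).
Let N := oproj (range D).

Let orthoU f : ortho (cocycle_relations `|` range D) f <->
  ortho cocycle_relations f /\ ortho (range D) f.
Proof.
split=> [h|[h1 h2] a [/h1|/h2]//].
by split=> a ha; apply: h; [left|right].
Qed.

(** Coboundaries are cocycles, so the space of cocycles is the orthogonal sum of the closure of the
    coboundaries and the range of [P']. *)
Lemma proj_split x : ip (P x) (P x) = ip (P' x) (P' x) + ip (x - N x) (x - N x).
Proof.
have compl y : ortho (range D) (y - P y).
  by move=> _ [f _ <-]; apply: oproj_ortho; exact: D_cocycle.
have yV : ortho cocycle_relations (x - N x).
  set y := x - N x; suff -> : y = P y by exact: oproj_in.
  apply/eqP; rewrite -subr_eq0; apply/eqP/ip_eq0.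
  rewrite [X in ip _ X](_ : _ = y - P y)// ipBr.
  rewrite (oproj_ortho y (@oproj_in _ _ _ y)) subr0.
  by rewrite ipC; apply: oproj_ortho; exact: compl.
have P'E : P' x = P x - (x - N x).
  apply: oproj_uniq => [|v /orthoU[v1 v2]].
    apply/orthoU; split; first by apply: orthoB => //; exact: oproj_in.
    have -> : P x - (x - N x) = N x - (x - P x).
      by rewrite !opprB addrCA.
    by apply: orthoB => //; exact: oproj_in.
  have -> : x - (P x - (x - N x)) = (x - P x) + (x - N x).
    by rewrite (opprB (P x)) addrCA addrC.
  by rewrite ipDl !oproj_ortho// addr0.
have NE : ip (x - N x) (x - N x) = ip (x - N x) x.
  by rewrite [LHS]ipBr (oproj_ortho x (@oproj_in _ _ (range D) x)) subr0.
by rewrite NE !ip_oproj -/P' P'E -ipDl subrK.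
Qed.

(** [rank_inequality] for the adjoint of [D]: the coboundaries come from a single copy of complex
    [l2], which has two real coordinates. *)
Lemma coboundary_trace (s : seq (G * bool)) : uniq s ->
  \sum_(x <- s) ip (basis R (x, 1%g) - N (basis R (x, 1%g)))
    (basis R (x, 1%g) - N (basis R (x, 1%g))) <= 2.
Proof.
move=> us; have [S DS] := nice_exists_adjoint nD.
have SD := adjointC DS; have nS := nice_adjoint nD DS.
have D1 : bounded_by D 1 by exact: opmx_bound zD_bounded.
have S1 := adjoint_bounded DS ler01 D1.
have := rank_inequality SD S1 (nice_rgt nS) (pi := fun j => basis R (j, 1%g)) _ us.
rewrite -lee_fin => h; apply: le_trans (h _) _ => [j x|].
  by rewrite ipC ip_basis.
apply: (@esum_le_uniq _ _ (fun x => ip (basis R (x, 1%g)) (basis R (x, 1%g)))) => [x|t ut].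
  exact: ip_ge0.
under eq_bigr do rewrite ip_basis2 eqxx.
rewrite big_const_seq count_predT iter_addr_0 ler_nat.
have := max_card (mem t); rewrite (card_uniqP ut) card_prod card_ord card_bool.
by [].
Qed.

Section FiniteCompression.
Variables (n : nat) (e : 'I_n -> G).
Hypothesis e_inj : injective e.

Let e2 (x : ('I_n * bool) * G) : (G * bool) * G := ((e x.1.1, x.1.2), x.2).
Let e2_inj : injective e2.
Proof. by move=> [[i b] g] [[j c] k] [/e_inj -> -> ->]. Qed.

Let npull : nice (pull e2 : H G -> H 'I_n).
Proof.
split.
- by move=> c x y; exact: pull_linear.
- by exists 1 => //; exact: pull_bounded.
- by move=> g f; apply: hl2P => -[[i b] k]; rewrite rgtE !(pullE _ _ e2_inj) rgtE.
- by move=> f; apply: hl2P => -[[i b] k]; rewrite [RHS]JopE !(pullE _ _ e2_inj) JopE.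
Qed.

Let npush : nice (push e2_inj : H 'I_n -> H G).
Proof. exact: nice_adjoint npull (@push_adjoint R _ _ _ e2_inj). Qed.

Let ortho_stable : nice P'.
Proof.
have lamJ (f : H G) k : unweight (Jop f) k = 'i%C *: unweight f k.
  by rewrite /unweight cres_Jop !scalerA mulrC.
have lamR g (f : H G) k : unweight (rgt g f) k = rho g (unweight f k).
  by rewrite /unweight cres_rgt; apply/val_inj.
have [S DS] := nice_exists_adjoint nD.
have nS := nice_adjoint nD DS.
have kerP f : ortho (range D) f <-> S f = 0 by exact: (ortho_rangeP (adjointC DS) f).
apply: nice_oproj => [g f|f] /orthoU[/cocycle_relationsP fc /kerP fD]; apply/orthoU; split.
- apply/cocycle_relationsP => k l; rewrite !lamR fc rhoD; congr (_ + _).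
  by apply/val_inj/funext => m /=; rewrite mulgA.
- by apply/kerP; rewrite (nice_rgt nS) fD (adjoint0 (rgt_adjoint g)).
- apply/cocycle_relationsP => k l; rewrite !lamJ fc scalerDr; congr (_ + _).
  exact/val_inj.
- apply/kerP; rewrite (nice_J nS) fD; apply: hl2P => -[[i b] g].
  by rewrite JopE !hl20 oppr0; case: b.
Qed.

(** [P'] involves one coordinate for each group element, whereas the supremum defining [beta1]
    ranges over finite matrices. Compressed to the coordinates [e i], it yields a finitely generated
    projective module, the orthogonal complement of the kernel of [T0], which [T0] maps into the
    cocycles. *)
Let T0 : H 'I_n -> H G := P' \o push e2_inj.
Let S0 : H G -> H 'I_n := pull e2 \o P'.

Let T0S0 : adjoint T0 S0.
Proof.
apply: adjoint_comp; first exact: adjointC (@push_adjoint R _ _ _ e2_inj).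
by move=> x y; exact: oproj_sym.
Qed.

Let nT0 : nice T0. Proof. exact: nice_comp npush ortho_stable. Qed.

Let E0 := oproj (range S0).
Let kerP f : ortho (range S0) f <-> T0 f = 0.
Proof. exact: (ortho_rangeP T0S0 f). Qed.

Let nE0 : nice E0.
Proof.
apply: nice_oproj => [g f /kerP Tf|f /kerP Tf]; apply/kerP.
  by rewrite (nice_rgt nT0) Tf (adjoint0 (rgt_adjoint g)).
rewrite (nice_J nT0) Tf; apply: hl2P => -[[k b] g].
by rewrite JopE !hl20 oppr0; case: b.
Qed.

Let qop (x : H 'I_n) := x - E0 x.
Let nq : nice qop. Proof. exact: nice_compl nE0. Qed.

Let q_sym x y : ip (qop x) y = ip x (qop y).
Proof. by rewrite ipBl ipBr oproj_sym. Qed.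

Let q_idem x : qop (qop x) = qop x.
Proof.
have EE : E0 (x - E0 x) = 0.
  have EE : adjoint E0 E0 by move=> y z; exact: oproj_sym.
  by rewrite (adjointB _ _ EE) [E0 (E0 x)]oprojK subrr.
by rewrite {1}/qop EE subr0.
Qed.

(* [qop] is the projection onto the orthogonal complement of the kernel of [T0]. *)
Definition compression_mx : 'M[L]_n := \matrix_(i, j) vN_entry qop i j.
Local Notation q := compression_mx.

Let qE i j xi : q i j xi = cres i (qop (cinc j xi)).
Proof. by rewrite mxE vN_entryE. Qed.

Let q_rip i j xi eta : rip (q i j xi) eta = rip xi (q j i eta).
Proof.
rewrite !qE ripC -[LHS]cinc_adjoint -[RHS]cinc_adjoint.
by rewrite -q_sym ipC.
Qed.

Lemma compression_proj : mx_projection q.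
Proof.
split=> [i j xi eta|].
  apply/eqP; rewrite eq_complex; apply/andP; split; apply/eqP.
    exact: q_rip.
  rewrite !Im_inner -[LHS]/(rip _ _) -[RHS]/(rip _ _) q_rip.
  by rewrite (vNZ (q j i)).
apply/matrixP => i j; rewrite mxE; apply: vN_eqP => xi; rewrite vN_sumE.
rewrite (eq_bigr (fun k => cres i (qop (cinc k (cres k (qop (cinc j xi))))))); last first.
  by move=> k _; rewrite -[LHS]/(q i k (q k j xi)) !qE.
rewrite -cres_sum qE.
have -> : \sum_k qop (cinc k (cres k (qop (cinc j xi)))) =
    qop (\sum_k cinc k (cres k (qop (cinc j xi)))).
  elim: (index_enum _) => [|k r IH]; first by rewrite !big_nil (nice0 nq).
  by rewrite !big_cons (niceD _ _ nq) IH.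
by rewrite cinc_cres_sum q_idem.
Qed.

Let zc (j : 'I_n) (k : G) : L := vN_entry (fun x => (w k)^-1 *: T0 x) k j.

Let zcE j k xi : zc j k xi = unweight (T0 (cinc j xi)) k.
Proof. by rewrite vN_entryE ?cresZ//; exact: nice_scale. Qed.

Let T0_in f : ortho cocycle_relations (T0 f) /\ ortho (range D) (T0 f).
Proof. by apply/orthoU; exact: oproj_in. Qed.

Let zc_Z1 j : zc j \in @Z1_pred R G.
Proof.
apply/asboolP/funext => -[k l].
change (lamL R k * zc j l - zc j (k * l)%g + zc j k = 0 :> L).
apply: vN_eqP => xi.
change (lam k (zc j l xi) - zc j (k * l)%g xi + zc j k xi = 0).
rewrite !zcE; have [/cocycle_relationsP -> _] := T0_in (cinc j xi).
by rewrite opprD addrA subrr sub0r addNr.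
Qed.

Let phi (v : 'cV[L]_n) : H1 R G :=
  prH (\sum_j (v j 0 : L^c) *: Cocycle (zc_Z1 j)).

Let phiD u v : phi (u + v) = phi u + phi v.
Proof.
rewrite -prHD; congr prH; rewrite -big_split; apply: eq_bigr => j _ /=.
by rewrite mxE scalerDl.
Qed.

(** If the class is zero, [T0 F] is a weighted coboundary; being orthogonal to all coboundaries it
    vanishes, so [F] lies in the kernel of [T0] and [qop F = 0]. *)
Let phi_inj : set_inj (mx_range q) phi.
Proof.
move=> u v; rewrite !inE => -[u' _ <-] [v' _ <-] uv.
set t := q *m u' - q *m v'.
have qt : q *m t = t.
  by rewrite mulmxBr !mulmxA; have [_ ->] := compression_proj.
have : phi t = 0.
  have : phi (t + q *m v') = phi (q *m v') by rewrite subrK.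
  by rewrite phiD => /eqP; rewrite -subr_eq0 addrK => /eqP.
move=> /prH_eq0[a ta].
suff t0 : t = 0 by apply/eqP; rewrite -subr_eq0 -/t t0.
rewrite -qt; apply/matrixP => i o; rewrite ord1 [LHS]mxE [RHS]mxE.
apply: vN_eqP => xi.
pose F := \sum_j cinc j (t j 0 xi).
have T0F : T0 F = \sum_j T0 (cinc j (t j 0 xi)).
  rewrite /F; elim: (index_enum _) => [|k r IH]; first by rewrite !big_nil (nice0 nT0).
  by rewrite !big_cons (niceD _ _ nT0) IH.
have T0D : T0 F = D (cinc ord0 (a xi)).
  apply: cres_inj => k.
  have wC : ((w k)^-1)%:C%C != 0 :> R[i].
    by apply/eqP => -[]; apply/eqP; rewrite invr_eq0 gt_eqF.
  apply: (scalerI wC); rewrite -!/(unweight _ k) unweight_D cres_cinc eqxx scale1r.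
  have -> : lam k (a xi) - a xi = d0 a k xi by [].
  have <- : (\sum_j (t j 0 : L^c) *: Cocycle (zc_Z1 j)) k xi = d0 a k xi by rewrite -ta.
  rewrite Z1_sumE vN_sumE.
  rewrite T0F /unweight cres_sum scaler_sumr; apply: eq_bigr => j _.
  by rewrite -/(unweight _ k) -zcE.
have T0F0 : T0 F = 0.
  apply: ip_eq0; rewrite {2}T0D; have [_] := T0_in F; apply.
  by exists (cinc ord0 (a xi)).
have qF : qop F = 0.
  by rewrite /qop (_ : E0 F = F) ?subrr//; apply/oproj_id/kerP.
rewrite vN_sumE; transitivity (cres i (qop F)); last by rewrite qF cres0.
have -> : qop F = \sum_j qop (cinc j (t j 0 xi)).
  rewrite /F; elim: (index_enum _) => [|k r IH]; first by rewrite !big_nil (nice0 nq).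
  by rewrite !big_cons (niceD _ _ nq) IH.
rewrite cres_sum; apply: eq_bigr => j _.
by rewrite -[LHS]/(q i j (t j 0 xi)) qE.
Qed.

Lemma compression_dim : exists P0 : set (H1 R G),
  fgproj_dim P0 (\sum_i complex.Re (tau (q i i))).
Proof.
exists (phi @` mx_range q), n, q, phi; split=> //; first exact: compression_proj.
- split=> [u v _ _|v a _]; first exact: phiD.
  rewrite -prHZ; congr prH; rewrite scaler_sumr; apply: eq_bigr => j _.
  rewrite scalerA; congr (_ *: _); rewrite mxE big_ord1 !mxE eqxx mulr1n.
  by [].
- by split.
Qed.

(** [T0] agrees with [T0 \o qop], and [T0] is a contraction, so each diagonal term of [P'] is at
    most the one of [qop]. *)
Lemma compression_trace :
  \sum_i \sum_b ip (P' (basis R ((e i, b), 1%g))) (P' (basis R ((e i, b), 1%g))) <=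
  2 * \sum_i complex.Re (tau (q i i)).
Proof.
have JJ (f : H 'I_n) : ip (Jop f) (Jop f) = ip f f by rewrite Jop_adjoint JopK opprK.
rewrite mulr_sumr; apply: ler_sum => i _.
have tr b : ip (qop (basis R ((i, b), 1%g))) (qop (basis R ((i, b), 1%g))) =
    complex.Re (tau (q i i)).
  have -> : ip (qop (basis R ((i, b), 1%g))) (qop (basis R ((i, b), 1%g))) =
      ip (qop (basis R ((i, false), 1%g))) (qop (basis R ((i, false), 1%g))).
    by case: b; [rewrite -Jop_basis (nice_J nq) JJ|].
  rewrite q_sym q_idem -cinc_delta cinc_adjoint /tau qE.
  by rewrite -[LHS]/(rip _ _) -[RHS]/(rip _ _) ripC.
have le b : ip (P' (basis R ((e i, b), 1%g))) (P' (basis R ((e i, b), 1%g))) <=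
    complex.Re (tau (q i i)).
  rewrite -(tr b); set bi := basis R ((i, b), 1%g).
  have -> : P' (basis R ((e i, b), 1%g)) = T0 bi by rewrite /T0 /= push_basis.
  have -> : T0 bi = T0 (qop bi).
    rewrite (adjointB _ _ T0S0) (_ : T0 (E0 bi) = 0) ?subr0//.
    by apply/kerP; exact: oproj_in.
  by apply: le_trans (oproj_contract _ _) _; rewrite ip_push.
by rewrite big_bool mulr_natl mulr2n lerD.
Qed.

End FiniteCompression.

(** A lower bound for [beta1]: by [proj_split] the trace of [P] is that of [P'], which finite
    compressions bound by [2 * beta1], plus at most 2 from the coboundaries. *)
Lemma lower_bound :
  (esum [set: G * bool] (fun x => (ip (oproj cocycle_relations (basis R (x, 1%g)))
     (oproj cocycle_relations (basis R (x, 1%g))))%:E) <=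
   2%:E * beta1 R G + 2%:E)%E.
Proof.
rewrite ge_ereal_sup// => _ [A [finA _]] <-.
rewrite fsbig_finite//=; move: (finmap.fset_uniq (fset_set A)).
move: (finmap.enum_fset (fset_set A)) => s us.
under eq_bigr => x _ do rewrite (proj_split (basis R (x, 1%g))) EFinD.
rewrite big_split/=; apply: leeD; last first.
  by rewrite sumEFin lee_fin coboundary_trace.
(* The finite set of pairs is enlarged to both parts of every group element in it, since a
   compression treats the two parts of a coordinate together. *)
pose ks := undup [seq x.1 | x <- s]; pose n := size ks.
pose e (i : 'I_n) : G := nth 1%g ks i.
have e_inj : injective e.
  move=> i j /eqP; rewrite nth_uniq ?undup_uniq// => /eqP ij; exact: val_inj.
have [P0 Pd] := compression_dim e_inj.
apply: (@le_trans _ _ ((2 * \sum_i complex.Re (tau (compression_mx e i i)))%:E)); last first.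
  rewrite EFinM lee_wpmul2l ?lee_fin// /beta1 /vN_dim.
  apply: ereal_sup_ubound => /=.
  by exists (\sum_i complex.Re (tau (compression_mx e i i))) => //; exists P0.
rewrite sumEFin lee_fin; apply: le_trans (compression_trace e_inj).
pose F (x : G * bool) := ip (P' (basis R (x, 1%g))) (P' (basis R (x, 1%g))).
have -> : \sum_i \sum_b ip (P' (basis R ((e i, b), 1%g))) (P' (basis R ((e i, b), 1%g))) =
    \sum_(x <- [seq (k, b) | k <- ks, b <- index_enum bool]) F x.
  rewrite big_allpairs_dep (big_nth 1%g) big_mkord.
  by [].
apply: (@ler_sum_subset _ _ F) => //.
- by apply: allpairs_uniq; rewrite ?undup_uniq ?index_enum_uniq// => -[? ?] [? ?].
- move=> [k b] ks'; apply/allpairsP; exists (k, b); split=> //=.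
    by rewrite mem_undup; apply/mapP; exists (k, b).
  exact: mem_index_enum.
- by move=> x; exact: ip_ge0.
Qed.

End LowerBound.

(** * Normally generating subgroups and elements *)

Section MainTheorem.
Variables (R : realType) (p : nat) (G : groupType).
Hypotheses (p_prime : prime p) (G_infinite : infinite_set [set: G])
  (G_fp : finitely_presented G) (G_res : residually_finite_p G p).
Local Notation L := (group_vN R G).

(** Evaluation at a vector, followed by the real or imaginary part, turns [z] into a real
    [l2]-cocycle. *)
Lemma Z1_eq0 (S : set G) : normally_generated S ->
  forall z : Z1 R G, (forall s, S s -> z s = 0) -> z = 0.
Proof.
move=> gS z zS; apply: Z1P => g; apply: vN_eqP => xi; apply: part_inj => b.
rewrite -[RHS]/(part b (0 : l2 R G)) part0.
apply: (l2_cocycle_eq0 p_prime G_fp G_res (c := fun g => part b (z g xi)) gS) => [k l|s Ss].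
  rewrite Z1_cocycle -part_lam -partD addrC.
  by [].
by rewrite zS// -[RHS](part0 _ _ b).
Qed.

(** Every [a xi] is invariant under left translations, hence a constant function, and a square
    summable constant on an infinite group is zero. *)
Lemma d0_eq0 (a : L) : d0 a = 0 -> a = 0.
Proof.
move=> a0; apply: vN_eqP => xi; set v : l2 R G := a xi.
have vc g : v g = v 1%g.
  have : lam g v - v = 0 := congr1 (fun f : G -> L => f g xi) a0.
  move=> /eqP; rewrite subr_eq0 => /eqP /(congr1 (fun f : l2 R G => f g)) /= <-.
  by rewrite mulVg.
suff v1 : v 1%g = 0 by apply/val_inj/funext => g; rewrite -[LHS]/(v g) vc v1.
apply/eqP/negPn/negP => v1.
set c := Normc.normc (v 1%g) ^+ 2.
have c0 : 0 < c.
  by rewrite exprn_gt0// lt_def; apply/andP; split;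
    [apply: contra v1 => /eqP/Normc.eq0_normc ->|case: (v 1%g) => x y; exact: sqrtr_ge0].
pose m := Num.bound (sqr_norm v / c).
have [B _ mB] := infinite_set_fset m G_infinite.
have := sqr_norm_ge_sum v (finmap.fset_uniq B).
under eq_bigr do rewrite vc -/c.
rewrite big_const_seq count_predT iter_addr_0 -mulr_natr => le.
have := archi_boundP (divr_ge0 (sqr_norm_ge0 v) (ltW c0)); rewrite -/m ltr_pdivrMr// => lt.
have : sqr_norm v < sqr_norm v; last by rewrite ltxx.
apply: (lt_le_trans lt); apply: le_trans le.
by rewrite mulrC ler_pM2l// ler_nat.
Qed.

(** Words in the finitely many generators are countable; the code supplies the weights. *)
Lemma group_code : exists code : G -> nat, injective code.
Proof.
have [n [rels [x [gens _]]]] := G_fp.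
have [v vE] := choice gens.
by exists (fun g => pickle (v g)) => g h /(pcan_inj pickleK) e; rewrite -(vE g) e vE.
Qed.

Section Subgroup.
Variable Lambda : groupClosed G.
Local Notation Gamma := (subgroup Lambda).

Let iota (y : (Gamma * bool) * Gamma) : (Gamma * bool) * G := (y.1, val y.2).
Let iota_inj : injective iota.
Proof. by move=> [x g] [y h] [-> /val_inj ->]. Qed.

(** Left translation by an element of [Gamma] preserves [Gamma] inside [G], so restricting the
    values to functions on [Gamma] respects the cocycle identity. *)
Lemma restrict_cocycle (w : Gamma -> R) (F : hl2 R ((Gamma * bool) * G)%type)
    (u : G -> l2 R G) : (forall k, 0 < w k) ->
  (forall g g', u (g * g')%g = lam g (u g') + u g) ->
  (forall k, cres k F = (w k)%:C%C *: u (val k)) ->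
  ortho (cocycle_relations w) (pull iota F).
Proof.
move=> w0 uM Fu.
have E k b g : part b (unweight w (pull iota F) k) g = part b (u (val k)) (val g).
  rewrite part_unweight pullE// -[F _]resE -part_cres Fu partZ /=.
  by case: b; rewrite scale0r ?addr0 ?subr0 hl2Z mulKf// gt_eqF.
apply/cocycle_relationsP => k l; apply: part_inj => b; apply: hl2P => g.
rewrite partD part_lam hl2D lftE !E.
by rewrite -[val (k * l)%g]/(val k * val l)%g uM partD part_lam hl2D lftE.
Qed.

Lemma beta1_subgroup_le : normally_generated [set` Lambda] ->
  (beta1 R G <= beta1 R Gamma)%E.
Proof.
move=> gL; rewrite ge_ereal_sup// => _ [d [P [n [q [phi [qp pl pb dE]]]]]] <-.
have [code code_inj] := group_code.
have ci : injective (code \o val : Gamma -> nat) := inj_comp code_inj val_inj.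
have vanish (z : Z1 R G) : (forall k : Gamma, z (val k) = 0) -> z = 0.
  by move=> z0; apply: (Z1_eq0 gL) => s sL; exact: (z0 (Subgroup sL)).
have [w [w0 w4 wP]] := upper_bound ci vanish d0_eq0 qp pl (set_bij_inj pb) dE.
(* The projection over [Gamma], extended by zero to [G]. Its norm is unchanged, which is why the
   trace over [G] is the trace over [Gamma]. *)
pose pi x := push iota_inj (oproj (cocycle_relations w) (basis R (x, 1%g))).
have : ((2 * d + 2)%:E <= 2%:E * beta1 R Gamma + 2%:E)%E.
  apply: (@le_trans _ _ _ _ _ (wP pi _)) => [F x [u [uM Fu]]|].
    rewrite /pi (adjointC (@push_adjoint R _ _ _ iota_inj)) oproj_sym oproj_id.
      by rewrite ipC ip_basis pullE.
    exact: restrict_cocycle Fu.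
  apply: le_trans (lower_bound w0 w4).
  by apply: le_esum => x _; rewrite /pi ip_push.
case: (beta1 R Gamma) => [r||]; rewrite ?leey//.
  by rewrite -EFinM -EFinD !lee_fin; lra.
by rewrite gt0_muleNy ?lte_fin// addNye.
Qed.

End Subgroup.

Section Elements.
Variables (k : nat) (g : 'I_k -> G) (n : 'I_k -> option nat).
Hypothesis gn : forall i, has_order (g i) (n i).
Local Notation H := (hl2 R (('I_k * bool) * G)%type).

(* If [a ^+ m = 1], then [\sum_(j < m) lam (a ^+ j) (u a) = u (a ^+ m) = 0] for a
   cocycle [u]; hence the correction term. *)
Definition averaged_basis (x : 'I_k * bool) : H :=
  if n x.1 is Some m then
    basis R (x, 1%g) - m%:R^-1 *: \sum_(j < m) basis R (x, (g x.1 ^- j)%g)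
  else basis R (x, 1%g).

Lemma cocycle_power_sum (u : G -> l2 R G) b a m :
  (forall k l, u (k * l)%g = lam k (u l) + u k) ->
  \sum_(j < m) part b (u a) (a ^- j)%g = part b (u (a ^+ m)%g) 1%g.
Proof.
move=> uM.
have U c e y : part b (u (c * e)%g) y = part b (u e) (c^-1 * y)%g + part b (u c) y.
  by rewrite uM partD hl2D part_lam lftE.
elim: m => [|m IH].
  have := U 1%g 1%g 1%g; rewrite big_ord0 expg0 invg1 !mulg1.
  by move=> /eqP; rewrite -subr_eq subrr => /eqP.
by rewrite big_ord_recr /= IH expgSr U mulg1 addrC.
Qed.

Lemma averaged_basisP (w : 'I_k -> R) (F : H) (u : G -> l2 R G) x :
  (forall k l, u (k * l)%g = lam k (u l) + u k) ->
  (forall i, cres i F = (w i)%:C%C *: u (g i)) ->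
  F (x, 1%g) = ip (averaged_basis x) F.
Proof.
move=> uM Fu; case: x => i b; have := gn i; rewrite /averaged_basis /=.
have FE y : F ((i, b), y) = w i * part b (u (g i)) y.
  rewrite -resE -part_cres Fu partZ /=.
  by case: b; rewrite scale0r ?addr0 ?subr0 hl2Z.
case: (n i) => [m [m0 gm _]|_]; last by rewrite ipC ip_basis.
rewrite ipBl ipZl ip_suml ipC ip_basis.
under eq_bigr do rewrite ipC ip_basis FE.
rewrite -mulr_sumr cocycle_power_sum// gm.
have := cocycle_power_sum b 1%g 0 uM; rewrite big_ord0 expg0 => <-.
by rewrite !mulr0 subr0.
Qed.

(** By minimality of [m] the translates [g ^- j], [j < m], are distinct, so their sum [s] has
    squared norm [m], and the averaged vector is the basis vector minus its projection onto the line
    of [s]. *)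
Lemma averaged_basis_norm x :
  ip (averaged_basis x) (averaged_basis x) = 1 - inv_order R (n x.1).
Proof.
have := gn x.1; rewrite /averaged_basis.
case: (n x.1) => [m [m0 gm mmin]|_] /=; last by rewrite ip_basis2 eqxx subr0.
set s := \sum_(j < m) _.
have inj (i j : 'I_m) : (g x.1 ^- i = g x.1 ^- j)%g -> i = j.
  move=> /invg_inj; wlog ij : i j / (i <= j)%N => [th|e].
    by have [/th//|/ltnW ji /esym /(th _ _ ji)] := leqP i j.
  apply/val_inj/eqP; rewrite eqn_leq ij/= -subn_eq0; apply/negPn; rewrite -lt0n.
  apply/negP => ji; suff : (m <= j - i)%N by rewrite leqNgt (leq_ltn_trans (leq_subr _ _)).
  apply: mmin ji _; apply: (mulgI (g x.1 ^+ i)%g).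
  by rewrite -expgnDr subnKC// mulg1 e.
have sb (j : 'I_m) : ip s (basis R (x, (g x.1 ^- j)%g)) = 1.
  rewrite ip_suml (bigD1 j)//= ip_basis2 eqxx big1 ?addr0// => i ij.
  rewrite ip_basis2 xpair_eqE eqxx/=; case: eqP => // /inj e.
  by rewrite e eqxx in ij.
have ss : ip s s = m%:R.
  rewrite {2}/s ip_sumr; under eq_bigr do rewrite sb.
  by rewrite sumr_const card_ord.
have sb0 : ip s (basis R (x, 1%g)) = 1.
  by have := sb (Ordinal m0); rewrite expg0 invg1.
rewrite ipBl !ipBr !ipZl !ipZr ss sb0 ip_basis2 eqxx !mulr1.
have mR : (m%:R : R) != 0 by rewrite pnatr_eq0 -lt0n.
by rewrite mulVf// mulr1 subrr subr0 ipC sb0 mulr1.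
Qed.

Lemma beta1_elements_le : normally_generated (range g) ->
  (beta1 R G <= (k%:R - 1 - \sum_(i < k) inv_order R (n i))%:E)%E.
Proof.
move=> gg; rewrite ge_ereal_sup// => _ [d [P [m [q [phi [qp pl pb dE]]]]]] <-.
have vanish (z : Z1 R G) : (forall i, z (g i) = 0) -> z = 0.
  by move=> z0; apply: (Z1_eq0 gg) => _ [i _ <-].
have [w [w0 w4 wP]] := upper_bound (@ord_inj k) vanish d0_eq0 qp pl (set_bij_inj pb) dE.
have : ((2 * d + 2)%:E <= (\sum_(x : 'I_k * bool) (1 - inv_order R (n x.1)))%:E)%E.
  apply: (@le_trans _ _ _ _ _ (wP averaged_basis _)).
    by move=> F x [u [uM Fu]]; exact: averaged_basisP uM Fu.
  apply: (@esum_le_uniq _ _ (fun x => ip (averaged_basis x) (averaged_basis x))) => [x|s us].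
    exact: ip_ge0.
  under [leRHS]eq_bigr do rewrite -averaged_basis_norm.
  apply: ler_sum_subset => //; rewrite ?index_enum_uniq// => x; last exact: ip_ge0.
  by rewrite mem_index_enum.
rewrite -(pair_bigA _ (fun i b => 1 - inv_order R (n i)))/=.
under eq_bigr => i _ do rewrite sumr_const card_bool -mulr_natl.
rewrite -mulr_sumr big_split/= sumrN sumr_const card_ord !lee_fin -mulr_natl mulr1.
by move: (\sum_i _) => t; lra.
Qed.

End Elements.

End MainTheorem.

Theorem theorem4p1 (R : realType) (p : nat) (G : groupType)
    (p_prime : prime p) (G_infinite : infinite_set [set: G])
    (G_fp : finitely_presented G) (G_res : residually_finite_p G p) :
  (forall Lambda : groupClosed G,
     normally_generated [set` Lambda] ->
     (beta1 R G <= beta1 R (subgroup Lambda))%E) /\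
  (forall (k : nat) (g : 'I_k -> G) (n : 'I_k -> option nat),
     (forall i, has_order (g i) (n i)) ->
     normally_generated (range g) ->
     (beta1 R G <= (k%:R - 1 - \sum_(i < k) inv_order R (n i))%:E)%E).
Proof.
split=> [Lambda|k g n].
  exact: (beta1_subgroup_le R p_prime G_infinite G_fp G_res (Lambda := Lambda)).
exact: (beta1_elements_le R p_prime G_infinite G_fp G_res).
Qed.
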